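(* Let $a>0$ and let $\lambda:E\to[0,\infty)$ be continuous, with $\lambda^{\pm}(y)=\lambda(y,\pm1)$. Suppose there is a $y_0>0$ such that (i) $\inf_{y\ge y_0}\lambda^+(y)>\sup_{y\ge y_0}\lambda^-(y)$, and (ii) $\inf_{y\le-y_0}\lambda^-(y)>\sup_{y\le-y_0}\lambda^+(y)$. Then the zig-zag process $(Y(t),J(t))_{t\ge0}$ with speed $a$ and switching rate $\lambda$ is exponentially ergodic, i.e. there exist constants $0<\rho<1$ and $0<\kappa<\infty$ and a norm-like function $V:E\to[0,\infty)$ such that $$\left\|\mathbb{P}_{y,j}\big((Y(t),J(t))\in\cdot\big)-\mu\right\|_f\le\kappa f(y,j)\rho^t,\qquad t\ge0,\ (y,j)\in E,$$ where $f(y,j)=1+V(y,j)$ and $\mu$ is the invariant probability measure of the process with density proportional to $(y,j)\mapsto\exp(-\Psi(y))$ with respect to $\mathrm{Leb}\otimes(\delta_{-1}+\delta_{+1})$, $\Psi(y)=\frac1a\int_0^y\{\lambda^+(\eta)-\lambda^-(\eta)\}\,d\eta$.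
   Context: $E=\mathbb{R}\times\{-1,+1\}$ with the product topology. For $(y,j)\in E$ let $F(t;y,j)=\exp\left(-\int_0^t\lambda(y+ajs,j)\,ds\right)$, $t\ge0$. The zig-zag process $(Y(t),J(t))$ started from $(y,j)$, with law $\mathbb{P}_{y,j}$, is defined as follows: $T_0=0$, $Y(0)=y$, $J(0)=j$; for $i=1,2,\dots$, $Z_i$ is a random variable with $\mathbb{P}_{y,j}(Z_i>t\mid Z_1,\dots,Z_{i-1})=F(t;Y(T_{i-1}),J(T_{i-1}))$, $T_i=T_{i-1}+Z_i$, $J(t)=J(T_{i-1})$ for $T_{i-1}<t<T_i$, $J(T_i)=-J(T_{i-1})$, and $Y(t)=Y(T_{i-1})+J(T_{i-1})a(t-T_{i-1})$ for $T_{i-1}<t\le T_i$. A function $V\in C(E)$ is norm-like if $V(y,j)\to\infty$ as $|y|\to\infty$. For $f:E\to[1,\infty)$ and a signed measure $\nu$ on the Borel sets of $E$, $\|\nu\|_f=\sup_{|g|\le f}|\nu(g)|$. The measure with density $\exp(-\Psi)$ is finite under the hypotheses and $\mu$ is normalized so that $\mu(E)=1$. *)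

(* Defs.v *)
From HB Require Import structures.
From mathcomp Require Import all_boot all_order all_algebra.
From mathcomp Require Import all_classical all_reals all_analysis.

Set Implicit Arguments.
Unset Strict Implicit.
Unset Printing Implicit Defensive.
Import Order.TTheory GRing.Theory Num.Theory.
Import numFieldNormedType.Exports.
Local Open Scope classical_set_scope.
Local Open Scope ring_scope.

(* R x {-1, +1}, with [true] encoding the direction +1 and [false] the
   direction -1; [bool] carries the discrete topology and sigma-algebra. *)
Notation zzE R := (R * bool)%type.

Definition dir (R : realType) (j : bool) : R := if j then 1 else -1.
Arguments dir : clear implicits.

Definition zz_survival (R : realType) (a : R) (lam : zzE R -> R)
    (t : R) (x : zzE R) : R :=
  expR (- \int[lebesgue_measure]_(s in `[0, t])
            lam (x.1 + a * dir R x.2 * s, x.2)).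

Section jump_times.
Context (R : realType) (Omega : Type) (Z : nat -> Omega -> R).

(* The waiting times are indexed from 0: [Z k] is the (k+1)-th one. *)
Definition jump_time (n : nat) (w : Omega) : R := \sum_(k < n) Z k w.

Definition past (n : nat) : set (set Omega) :=
  <<s \bigcup_(k in `I_n) preimage_set_system setT (Z k) measurable >>.

End jump_times.

(* A realization of the zig-zag process started from [x], on some probability
   space. [zz_cond] says that the conditional probability of [Z n > t] given
   [Z 0, ..., Z (n-1)] is the survival function at the state entered at the
   n-th jump. As that function is 1 at t = 0, waiting times are almost surely
   positive; [zz_Z_gt0] fixes a version for which this holds surely, as is
   needed for the pathwise description to be consistent.  Nothing is required
   of the path beyond the supremum of the jump times, except measurability. *)
Record zigzag (R : realType) (a : R) (lam : zzE R -> R) (x : zzE R) := Zigzag {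
  zz_disp : measure_display;
  zz_space : measurableType zz_disp;
  zz_prob : probability zz_space R;
  zz_Z : nat -> {RV zz_prob >-> R};
  zz_state : R -> {RV zz_prob >-> zzE R};
  zz_Z_gt0 : forall n w, 0 < zz_Z n w;
  zz_cond : forall n (t : R), 0 <= t ->
    forall A, past (fun k => zz_Z k : zz_space -> R) n A ->
    zz_prob (A `&` [set w | t < zz_Z n w]) =
    (\int[zz_prob]_(w in A)
       (zz_survival a lam t (zz_state (jump_time zz_Z n w) w))%:E)%E;
  zz_start : forall w, zz_state 0 w = x;
  zz_dir_const : forall n w t,
    jump_time zz_Z n w < t < jump_time zz_Z n.+1 w ->
    (zz_state t w).2 = (zz_state (jump_time zz_Z n w) w).2;
  zz_dir_flip : forall n w,
    (zz_state (jump_time zz_Z n.+1 w) w).2 =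
    ~~ (zz_state (jump_time zz_Z n w) w).2;
  zz_position : forall n w t,
    jump_time zz_Z n w < t <= jump_time zz_Z n.+1 w ->
    (zz_state t w).1 =
      (zz_state (jump_time zz_Z n w) w).1
      + dir R (zz_state (jump_time zz_Z n w) w).2 * a
        * (t - jump_time zz_Z n w)
}.

Definition zz_law (R : realType) (a : R) (lam : zzE R -> R) (x : zzE R)
    (X : zigzag a lam x) (t : R) : probability (zzE R) R :=
  distribution (zz_prob X) (zz_state X t).

Definition norm_like (R : realType) (V : zzE R -> R) : Prop :=
  continuous V /\
  forall j, V (y, j) @[y --> +oo%R] --> +oo%R /\
            V (y, j) @[y --> -oo%R] --> +oo%R.

(* The f-norm of the signed measure [P - Q].  If [g] has an infinite or
   undefined integral for [P] or for [Q], the absolute difference is +oo. *)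
Definition dist_fnorm (R : realType) (f : zzE R -> R)
    (P Q : probability (zzE R) R) : \bar R :=
  ereal_sup [set `| \int[P]_x (g x)%:E - \int[Q]_x (g x)%:E |%E | g in
    [set g : zzE R -> R | measurable_fun setT g /\
                          forall x, `|g x| <= f x]].

(* The oriented integral from 0 to [y], for [y] of any sign. *)
Definition integral_from0 (R : realType) (h : R -> R) (y : R) : R :=
  if 0 <= y then \int[lebesgue_measure]_(eta in `[0, y]) h eta
  else - \int[lebesgue_measure]_(eta in `[y, 0]) h eta.

Definition zz_potential (R : realType) (a : R) (lam : zzE R -> R) (y : R) : R :=
  a^-1 * integral_from0 (fun eta => lam (eta, true) - lam (eta, false)) y.

Section reference_measure.
Context (R : realType).

Definition dirac_pm : set bool -> \bar R :=
  measure_add (@dirac _ bool false R) (@dirac _ bool true R).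

HB.instance Definition _ := Measure.on dirac_pm.

Let dirac_pm_finite : fin_num_fun dirac_pm.
Proof.
move=> A _; rewrite /dirac_pm measure_addE /= !diracE.
by rewrite -EFinD.
Qed.

HB.instance Definition _ :=
  @Measure_isFinite.Build _ _ _ dirac_pm dirac_pm_finite.

End reference_measure.
Arguments dirac_pm : clear implicits.

Definition has_density_prop_to (R : realType) (mu : probability (zzE R) R)
    (h : zzE R -> R) : Prop :=
  exists2 c : R, 0 < c &
    forall A, measurable A ->
      mu A = (\int[@lebesgue_measure R \x dirac_pm R]_(x in A) (c * h x)%:E)%E.

Definition zz_invariant (R : realType) (a : R) (lam : zzE R -> R)
    (X : forall x, zigzag a lam x) (mu : probability (zzE R) R) : Prop :=
  forall t : R, 0 <= t -> forall A, measurable A ->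
    (\int[mu]_x zz_law (X x) t A)%E = mu A.

(* Main.v *)
Require Import Defs.
From HB Require Import structures.
From mathcomp Require Import all_boot all_order all_algebra.
From mathcomp Require Import all_classical all_reals all_analysis.
From mathcomp Require Import measurable_realfun.
From mathcomp Require Import ring lra.

Set Implicit Arguments.
Unset Strict Implicit.
Unset Printing Implicit Defensive.
Import Order.TTheory GRing.Theory Num.Theory.
Import numFieldNormedType.Exports.
Local Open Scope classical_set_scope.
Local Open Scope ring_scope.

(** Between jumps the process moves at constant speed, so everything about it
    is expressed through the flow [flow], the survival function [surv] of a
    leg and the reversed flow [turn]. The expectation of h after a time t,
    split according to the number of jumps, is the series [semi h]; it is the
    minimal solution of the renewal equation [semiE] obtained by conditioning
    on the first jump. Rates are bounded on bounded sets, so infinitely many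
    jumps do not accumulate in finite time ([iter_alive_cvg0]); hence bounded
    solutions are unique ([renewal_unique]), and [semi] is a conservative
    semigroup ([semi_cst1], [semiD]). A realization of the process has [semi]
    as its law ([integral_law]): the conditional survival probabilities
    determine the joint law of the state after n jumps and of the next waiting
    time ([disintegration]), and summing over the leg in progress at time t
    gives the series term by term. The remaining work is analysis of [semi].

    The density exp(-Psi) is the product over the two directions of the
    integrating factors of the rates ([exp_potentialE]). This gives the skew
    detailed balance identity [weight_surv]: a leg and the same leg travelled
    backwards have the same weight. One jump is therefore self-dual for a
    pairing that is a convolution in time, and moving all jumps from one
    argument to the other proves invariance ([semi_invariant]).

    Convergence follows from Harris' theorem. The function [lyap] grows
    exponentially in both directions and is larger by a factor th > 1 in the
    exponential of the side towards which the process moves. Far out, the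
    generator makes it decrease: a process that moves outwards turns at a rate
    at least m, one that moves inwards turns round at a rate at most M < m, and
    the exponents can be fitted into this gap ([drift]); [semi_lyapunov]
    integrates the drift. On a sublevel set, a path with one or two jumps
    reaches every point of [0, 1] with a density bounded below
    ([minorization]). In the form of Hairer and Mattingly
    ([harris_contraction]), drift and minorization make the semigroup a strict
    contraction for a weighted oscillation seminorm, and averaging over the
    invariant measure turns this into the exponential rate
    ([exponential_ergodicity]). *)

(** * Mixtures of measures, weighted images and affine substitution *)

Section mixture.
Local Open Scope ereal_scope.
Context d d' (X : measurableType d) (Y : measurableType d') (R : realType).
Variables (l : {measure set X -> \bar R}) (k : X -> {measure set Y -> \bar R}).
Hypothesis mk : forall A, measurable A -> measurable_fun setT (k ^~ A).

(** The measurability proof is an argument so that the measure structure can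
    be attached to the definition. *)
Definition mixture (_ : forall A, measurable A ->
    measurable_fun setT (k ^~ A)) (A : set Y) : \bar R :=
  \int[l]_x k x A.

Let mix0 : mixture mk set0 = 0.
Proof. by rewrite /mixture integral0_eq// => x _; rewrite measure0. Qed.

Let mix_ge0 A : 0 <= mixture mk A.
Proof. by rewrite /mixture; apply: integral_ge0. Qed.

Let mix_sigma_additive : semi_sigma_additive (mixture mk).
Proof.
move=> F mF tF mUF; rewrite [X in _ --> X](_ : _ =
    \int[l]_x (\sum_(0 <= i <oo) k x (F i))); last first.
  apply: eq_integral => x _; apply/esym/cvg_lim => //.
  exact: measure_semi_sigma_additive.
rewrite integral_nneseries//; last by move=> n; exact: mk.
by apply: is_cvg_nneseries => n _ _; apply: integral_ge0.
Qed.

HB.instance Definition _ := isMeasure.Build _ _ _ (mixture mk)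
  mix0 mix_ge0 mix_sigma_additive.

Import HBNNSimple.

Lemma measurable_integral_mixand (f : Y -> \bar R) :
  measurable_fun setT f -> (forall y, 0 <= f y) ->
  measurable_fun setT (fun x => \int[k x]_y f y).
Proof.
move=> mf f0; pose g := nnsfun_approx measurableT mf.
apply: (emeasurable_fun_cvg (fun n x => \int[k x]_y (g n y)%:E)).
  move=> n; under eq_fun do rewrite integralT_nnsfun sintegralE.
  by apply: emeasurable_fsum => //= r; apply: measurable_funeM; exact: mk.
move=> x _; rewrite (_ : \int[k x]_y f y =
    \int[k x]_y limn (fun n => (g n y)%:E)).
  apply: cvg_monotone_convergence => //.
  - by move=> n; exact/measurable_EFinP.
  - by move=> n y _; rewrite lee_fin.
  - by move=> y _ m n mn; rewrite lee_fin; exact/lefP/nd_nnsfun_approx.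
apply: eq_integral => y _; apply/esym/cvg_lim => //.
exact: cvg_nnsfun_approx.
Qed.

(** Monotone convergence from nonnegative simple functions. *)
Lemma ge0_integral_mixture (f : Y -> \bar R) :
  measurable_fun setT f -> (forall y, 0 <= f y) ->
  \int[mixture mk]_y f y = \int[l]_x \int[k x]_y f y.
Proof.
move=> mf f0; pose g := nnsfun_approx measurableT mf.
have mg n : measurable_fun setT (fun y => (g n y)%:E).
  exact/measurable_EFinP.
have g0 n y : 0 <= (g n y)%:E by rewrite lee_fin.
have ndg y : {homo (fun n => (g n y)%:E) : n m / (n <= m)%N >-> n <= m}.
  by move=> m n mn; rewrite lee_fin; exact/lefP/nd_nnsfun_approx.
have fE y : f y = limn (fun n => (g n y)%:E).
  by apply/esym/cvg_lim => //; exact: cvg_nnsfun_approx.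
transitivity (limn (fun n => \int[mixture mk]_y (g n y)%:E)).
  by rewrite -monotone_convergence//; apply: eq_integral => y _; exact: fE.
transitivity (limn (fun n => \int[l]_x \int[k x]_y (g n y)%:E)).
  congr (limn _); apply/funext => n.
  rewrite integralT_nnsfun sintegralE /= /mixture.
  under [RHS]eq_integral do rewrite integralT_nnsfun sintegralE.
  rewrite ge0_integral_fsum//; last 2 first.
    by move=> r; apply: measurable_funeM; exact: mk.
    by move=> r x _; exact: nnsfun_mulemu_ge0.
  apply: eq_fsbigr => r /[!inE] -[y _ <-].
  by rewrite ge0_integralZl//; exact: mk.
rewrite -monotone_convergence//; last 3 first.
- by move=> n; apply: measurable_integral_mixand => //; exact: mg.
- by move=> n x _; apply: integral_ge0 => y _; exact: g0.
- by move=> x _ m n mn; apply: ge0_le_integral => // y _; exact: ndg.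
apply: eq_integral => x _; rewrite -monotone_convergence//.
by apply: eq_integral => y _; rewrite fE.
Qed.

End mixture.

Section weighted_image.
Local Open Scope ereal_scope.
Context d d' (T : measurableType d) (Y : measurableType d') (R : realType).
Variables (m : {measure set T -> \bar R}) (q : T -> R) (g : T -> Y).
Hypotheses (q0 : forall x, (0 <= q x)%R) (mq : measurable_fun setT q).
Hypothesis mg : measurable_fun setT g.

Let atom (x : T) : {measure set Y -> \bar R} :=
  mscale (NngNum (q0 x)) (dirac (g x)).

Let matom A : measurable A -> measurable_fun setT (atom ^~ A).
Proof.
move=> mA; rewrite /atom /mscale/=; apply: emeasurable_funM.
  exact/measurable_EFinP.
have md : measurable_fun setT (fun y : Y => \d_y A : \bar R).
  exact: measurable_fun_dirac.
exact: (measurableT_comp md mg).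
Qed.

(** As a mixture of scaled Dirac masses it covers densities, image measures
    and joint laws by one integration formula. *)
Definition weighted_image : {measure set Y -> \bar R} := mixture m matom.

Lemma weighted_imageE A :
  weighted_image A = \int[m]_x (q x * \1_A (g x))%:E.
Proof. by []. Qed.

Lemma ge0_integral_weighted_image (f : Y -> \bar R) :
  measurable_fun setT f -> (forall x, 0 <= f x) ->
  \int[weighted_image]_x f x = \int[m]_x ((q x)%:E * f (g x)).
Proof.
move=> mf f0; rewrite /weighted_image/= ge0_integral_mixture//.
apply: eq_integral => x _.
rewrite ge0_integral_mscale// integral_dirac// diracE in_setT mul1e//.
Qed.

End weighted_image.

Section affine_substitution.
Local Open Scope ereal_scope.
Context {R : realType}.
Local Notation mu := (@lebesgue_measure R).

(** Both sides agree on half-open intervals; rescaling the pushforward avoids a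
    division in the extended reals. *)
Lemma lebesgue_measure_affine (c e : R)
    (f := (fun x => c * x + e)%R : measurableTypeR R -> measurableTypeR R) A :
  (c != 0)%R -> measurable A -> `|c|%:E * pushforward mu f A = mu A.
Proof.
move=> c0; have mf : measurable_fun setT f.
  by apply: measurable_funD => //; apply: measurable_funM.
pose m : {measure set (measurableTypeR R) -> \bar R} :=
  mscale (NngNum (normr_ge0 c)) (pushforward mu f).
move=> mA; apply/esym; rewrite -[RHS]/(m mf A).
apply: lebesgue_measure_unique => //= _ [[u v]] _ <-.
rewrite /m /mscale/= /pushforward/=.
move: c0; rewrite neq_lt => /orP[c0|c0].
  have -> : f @^-1` `]u, v]%classic = `[((v - e) / c)%R, ((u - e) / c)%R[%classic.
    by apply/seteqP; split => x/=; rewrite !in_itv/= /f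
      ler_ndivrMr// ltr_ndivlMr//; lra.
  rewrite !lebesgue_measure_itv/= !lte_fin ltr_nM2r ?invr_lt0// ltrD2r ltr0_norm//.
  by case: ifP => _; rewrite ?mule0// -!EFinB -EFinM; congr EFin; field; lra.
have -> : f @^-1` `]u, v]%classic = `]((u - e) / c)%R, ((v - e) / c)%R]%classic.
  by apply/seteqP; split => x/=; rewrite !in_itv/= /f
    ler_pdivlMr// ltr_pdivrMr//; lra.
rewrite !lebesgue_measure_itv/= !lte_fin ltr_pM2r ?invr_gt0// ltrD2r gtr0_norm//.
by case: ifP => _; rewrite ?mule0// -!EFinB -EFinM; congr EFin; field; lra.
Qed.

Lemma ge0_integral_affine (c e : R) (f : R -> \bar R) : (c != 0)%R ->
  measurable_fun setT f -> (forall x, 0 <= f x) ->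
  \int[mu]_x f x = `|c|%:E * \int[mu]_x f (c * x + e)%R.
Proof.
move=> c0 mf f0.
pose g := (fun x => c * x + e)%R : measurableTypeR R -> measurableTypeR R.
have mg : measurable_fun setT g.
  by apply: measurable_funD => //; apply: measurable_funM.
pose m : {measure set (measurableTypeR R) -> \bar R} :=
  mscale (NngNum (normr_ge0 c)) (pushforward mu g).
transitivity (\int[m mg]_x f x).
  apply: eq_measure_integral => /= A mA _.
  by rewrite -(@lebesgue_measure_affine c e).
rewrite ge0_integral_mscale//=; congr (_ * _).
by rewrite ge0_integral_pushforward.
Qed.

End affine_substitution.

(** * Calculus on the line *)

Section calculus.
Context {R : realType}.
Local Notation mu := (@lebesgue_measure R).

Lemma is_derive_continuous (f f' : R -> R) :
  (forall x : R, is_derive x 1 f (f' x)) -> continuous f.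
Proof.
move=> df x; apply/differentiable_continuous/derivable1_diffP.
exact: ex_derive.
Qed.

Lemma continuous_integrable_itv (f : R -> R) (b1 b2 : bool) (u v : R) :
  continuous f ->
  mu.-integrable [set` Interval (BSide b1 u) (BSide b2 v)] (EFin \o f).
Proof.
move=> cf; apply: (@integrableS _ _ _ mu `[u, v]) => //.
  by case: b1; case: b2 => x/=; rewrite !in_itv/= => /andP[]; lra.
apply: continuous_compact_integrable; first exact: segment_compact.
exact: continuous_subspaceT.
Qed.

Lemma ge0_integral_FTC (f F : R -> R) (u v : R) : u <= v -> continuous f ->
  (forall x : R, is_derive x 1 F (f x)) ->
  (\int[mu]_(x in `[u, v]) (f x)%:E = (F v - F u)%:E)%E.
Proof.
move=> uv cf dF; move: uv; rewrite le_eqVlt => /predU1P[->|uv].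
  by rewrite set_itv1 integral_set1 subrr.
have cF : continuous F := is_derive_continuous dF.
rewrite (@continuous_FTC2 _ f F)//.
- exact: continuous_subspaceT.
- split.
  + by move=> x _; exact: ex_derive.
  + by apply: cvg_at_right_filter; exact: cF.
  + by apply: cvg_at_left_filter; exact: cF.
- by move=> x _; rewrite derive1E derive_val.
Qed.

Lemma ge0_integral_FTCy (f F : R -> R) (u l : R) :
  (forall x, 0 <= f x) -> continuous f ->
  (forall x : R, is_derive x 1 F (f x)) -> F x @[x --> +oo] --> l ->
  (\int[mu]_(x in `[u, +oo[) (f x)%:E = (l - F u)%:E)%E.
Proof.
move=> f0 cf dF Fl; have cF : continuous F := is_derive_continuous dF.
rewrite (@ge0_continuous_FTC2y _ f F _ l)//.
- exact: continuous_subspaceT.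
- by apply: cvg_at_right_filter; exact: cF.
- by move=> x _; rewrite derive1E derive_val.
Qed.

Lemma integral_from0_shift (f : R -> R) (N y : R) : continuous f -> `|y| < N ->
  integral_from0 f y =
  \int[mu]_(t in `[- N, y]) f t - \int[mu]_(t in `[- N, 0]) f t.
Proof.
move=> cf; rewrite ltr_norml => /andP[Ny yN].
have N0 : 0 < N by lra.
rewrite /integral_from0; case: ifPn => y0.
  rewrite Rintegral_itvB ?bnd_simp//; [|exact: continuous_integrable_itv|lra].
  by rewrite Rintegral_itv_obnd_cbnd//; exact: continuous_integrable_itv.
rewrite -ltNge in y0; rewrite -[RHS]opprB; congr (- _).
rewrite Rintegral_itvB ?bnd_simp; try lra.
  by rewrite Rintegral_itv_obnd_cbnd//; exact: continuous_integrable_itv.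
exact: continuous_integrable_itv.
Qed.

(** Near a given point the oriented integral differs by a constant from an
    integral with a fixed lower end point. *)
Lemma is_derive_integral_from0 (f : R -> R) (y : R) : continuous f ->
  is_derive y 1 (integral_from0 f) (f y).
Proof.
move=> cf; pose N : R := `|y| + 1.
have yN : `|y| < N by rewrite /N; lra.
pose G (z : R) : R := \int[mu]_(t in `[- N, z]) f t.
have [dG G'] : derivable G y 1 /\ derive1 G y = f y.
  apply: (@continuous_FTC1_closed _ f (- N) y N) => //.
  - by move: yN; rewrite ltr_norml => /andP[].
  - exact: continuous_integrable_itv.
  - by move: yN; rewrite ltr_norml => /andP[].
  - exact: cf.
apply: (@near_eq_is_derive _ _ _ (fun z => G z - G 0)).
- near=> z; rewrite (@integral_from0_shift _ N)//.
  near: z; have /(_ y) := @norm_continuous R R.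
  by move=> /(@cvgr_lt R _ _ _ _ `|y|); apply.
- have : is_derive y 1 G (f y) by apply: DeriveDef; [exact: dG|rewrite -derive1E; exact: G'].
  move=> h; have := is_deriveB h (is_derive_cst (G 0) y (1:R)).
  by rewrite subr0.
Unshelve. all: by end_near. Qed.

Lemma integral_from0B (f g : R -> R) (y : R) : continuous f -> continuous g ->
  integral_from0 (fun x => f x - g x) y = integral_from0 f y - integral_from0 g y.
Proof.
move=> cf cg; rewrite /integral_from0; case: ifP => _;
  rewrite RintegralB//; try exact: continuous_integrable_itv.
by rewrite opprB opprK addrC.
Qed.

End calculus.

(** * Flow, survival and the integrating factor *)

Definition flow (R : realType) (a s : R) (x : zzE R) : zzE R :=
  (x.1 + a * dir R x.2 * s, x.2).

Definition flip (R : realType) (x : zzE R) : zzE R := (x.1, ~~ x.2).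

(** Flowing for a time s and then reversing is an involution; this is the
    reversal symmetry behind the invariant measure. *)
Definition turn (R : realType) (a s : R) (x : zzE R) : zzE R :=
  flip (flow a s x).

(** The integrating factor of the rate: along the flow its logarithmic
    derivative is minus the rate, so that survival along a leg is the ratio of
    its values at the two ends. *)
Definition factor (R : realType) (a : R) (lam : zzE R -> R) (x : zzE R) : R :=
  expR (- (dir R x.2 / a) * integral_from0 (fun y => lam (y, x.2)) x.1).

(** Defined for every real t, which makes [survD] unconditional. *)
Definition surv (R : realType) (a : R) (lam : zzE R -> R) (t : R) (x : zzE R) :
  R := factor a lam (flow a t x) / factor a lam x.

(** This is exp(-Psi), see [exp_potentialE]. *)
Definition weight (R : realType) (a : R) (lam : zzE R -> R) (x : zzE R) : R :=
  factor a lam (x.1, true) * factor a lam (x.1, false).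

Section zigzag_flow.
Context (R : realType) (a : R) (lam : zzE R -> R).
Hypotheses (a_gt0 : 0 < a) (lam_ge0 : forall x, 0 <= lam x).
Hypothesis (lam_cont : continuous lam).
Local Notation mu := (@lebesgue_measure R).
Local Notation flow := (flow a).
Local Notation turn := (turn a).
Local Notation factor := (factor a lam).
Local Notation surv := (surv a lam).
Local Notation weight := (weight a lam).

Lemma dirN j : dir R (~~ j) = - dir R j.
Proof. by case: j; rewrite /= ?opprK. Qed.

Lemma dir_sqr j : dir R j * dir R j = 1.
Proof. by case: j => /=; rewrite ?mulrNN mulr1. Qed.

Lemma flow0 x : flow 0 x = x.
Proof. by case: x => y j; rewrite /flow/= mulr0 addr0. Qed.

Lemma flowD s t x : flow (s + t) x = flow t (flow s x).
Proof. by rewrite /flow/=; congr pair; ring. Qed.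

Lemma flipK : involutive (@flip R).
Proof. by case=> y j; rewrite /flip/= negbK. Qed.

Lemma turnK s : involutive (turn s).
Proof.
by case=> y j; rewrite /turn /flip /flow/= negbK dirN; congr pair; ring.
Qed.

Lemma lam_cont_slice j : continuous (fun y => lam (y, j)).
Proof.
move=> y; apply: (@continuous_comp _ _ _ (fun y => (y, j)) lam).
  apply: (@cvg_pair _ _ _ _ (nbhs y) (nbhs j) _ _ _ id (cst j)).
    exact: cvg_id.
  exact: cvg_cst.
exact: lam_cont.
Qed.

Lemma flow_cont x : continuous (flow ^~ x).
Proof.
move=> s; pose f s := x.1 + a * dir R x.2 * s.
apply: (@cvg_pair _ _ _ _ (nbhs (f s)) (nbhs x.2) _ _ _ f (cst x.2)).
  apply: (@continuousD _ _ _ (fun=> x.1) (fun s => a * dir R x.2 * s)).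
    exact: cst_continuous.
  exact: mulrl_continuous.
exact: cvg_cst.
Qed.

Lemma lam_flow_cont x : continuous (fun s => lam (flow s x)).
Proof.
by move=> s; apply: (@continuous_comp _ _ _ (flow ^~ x) lam);
  [exact: flow_cont|exact: lam_cont].
Qed.

Lemma factor_gt0 x : 0 < factor x.
Proof. exact: expR_gt0. Qed.

Lemma is_derive_factor j (y : R) :
  is_derive y 1 (fun y => factor (y, j)) (- (dir R j / a) * lam (y, j) * factor (y, j)).
Proof.
pose k := - (dir R j / a).
have h : is_derive y 1 (fun y => k * integral_from0 (fun z => lam (z, j)) y) (k * lam (y, j)).
  have := is_deriveZ k (is_derive_integral_from0 y (@lam_cont_slice j)).
  by [].
have := is_derive1_comp (is_derive_expR _) h.
by rewrite /factor/= -/k mulrC.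
Qed.

Lemma is_derive_surv (s : R) x :
  is_derive s 1 (surv ^~ x) (- (lam (flow s x) * surv s x)).
Proof.
case: x => y j.
have h : is_derive s 1 (fun s => y + a * dir R j * s) (a * dir R j).
  have := is_deriveD (is_derive_cst y s (1:R)) (is_deriveZ (a * dir R j) (is_derive_id s (1:R))).
  by rewrite add0r scaler1.
have := @is_derive1_comp _ (fun y => factor (y, j)) (fun s => y + a * dir R j * s)
  s _ _ (is_derive_factor j (y + a * dir R j * s)) h.
move=> /(is_deriveZ (factor (y, j))^-1).
rewrite [X in is_derive _ _ X _](_ : _ = surv ^~ (y, j)); last first.
  by apply/funext => t; exact: mulrC.
move=> h'; apply: is_derive_eq h' _.
rewrite /surv /flow/= /GRing.scale/=.
have -> : - (dir R j / a) * lam (y + a * dir R j * s, j) *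
    factor (y + a * dir R j * s, j) * (a * dir R j) =
    - (lam (y + a * dir R j * s, j) * factor (y + a * dir R j * s, j))
     * (dir R j * dir R j) * (a / a) by ring.
rewrite dir_sqr divff ?lt0r_neq0//; ring.
Qed.

Lemma surv_gt0 t x : 0 < surv t x.
Proof. by rewrite divr_gt0// factor_gt0. Qed.

Lemma surv0 x : surv 0 x = 1.
Proof. by rewrite /surv flow0 divff// lt0r_neq0// factor_gt0. Qed.

Lemma survD t s x : surv (t + s) x = surv t x * surv s (flow t x).
Proof.
rewrite /surv flowD [RHS]mulrC mulrA mulfVK//.
by rewrite lt0r_neq0// factor_gt0.
Qed.

Lemma surv_cont x : continuous (surv ^~ x).
Proof. exact: is_derive_continuous (fun s => is_derive_surv s x). Qed.

Lemma hazard_cont x : continuous (fun s => lam (flow s x) * surv s x).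
Proof.
move=> s; apply: (@continuousM _ _ (fun s => lam (flow s x)) (surv ^~ x)).
  exact: lam_flow_cont.
exact: surv_cont.
Qed.

Lemma hazard_ge0 s x : 0 <= lam (flow s x) * surv s x.
Proof. by rewrite mulr_ge0// ltW// surv_gt0. Qed.

Lemma surv_le1 t x : 0 <= t -> surv t x <= 1.
Proof.
move=> t0; rewrite -(surv0 x); apply: (@ler0_derive1_nincry _ (surv ^~ x) 0) => //.
- by move=> s _; exact: (@ex_derive _ _ _ _ _ _ _ (is_derive_surv s x)).
- move=> s _; rewrite derive1E.
  by rewrite (@derive_val _ _ _ _ _ _ _ (is_derive_surv s x)) oppr_le0 hazard_ge0.
- exact/continuous_subspaceT/surv_cont.
Qed.

Lemma zz_survivalE t x : 0 <= t -> zz_survival a lam t x = surv t x.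
Proof.
move=> t0; rewrite /zz_survival.
have d (s : R) : is_derive s 1 (fun s => - ln (surv s x)) (lam (flow s x)).
  have h := @is_derive1_comp _ (@ln R) (surv ^~ x) s _ _
    (is_derive1_ln (surv_gt0 s x)) (is_derive_surv s x).
  have := is_deriveN h; move/(is_derive_eq); apply.
  by rewrite mulrN opprK mulrCA mulVf ?mulr1// lt0r_neq0// surv_gt0.
rewrite /Rintegral (@ge0_integral_FTC _ _ _ 0 t t0 (@lam_flow_cont x) d)/=.
by rewrite surv0 ln1 oppr0 subr0 opprK lnK// posrE surv_gt0.
Qed.

Lemma weightE y j : weight (y, j) = factor (y, j) * factor (y, ~~ j).
Proof. by case: j; [reflexivity|exact: mulrC]. Qed.

Lemma weight_flip x : weight (flip x) = weight x.
Proof. by []. Qed.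

Lemma weight_gt0 x : 0 < weight x.
Proof. by rewrite mulr_gt0// factor_gt0. Qed.

Lemma exp_potentialE (x : zzE R) : expR (- zz_potential a lam x.1) = weight x.
Proof.
rewrite /weight /factor -expRD /zz_potential integral_from0B; try exact: lam_cont_slice.
by congr expR => /=; ring.
Qed.

(** Skew detailed balance: both sides are the product of [factor] at [flip x]
    and at [flow s x], and [turn s] exchanges these two points. *)
Lemma weight_surv s x : weight x * surv s x = weight (turn s x) * surv s (turn s x).
Proof.
have E : flow s (turn s x) = flip x by rewrite -[LHS]flipK -/(turn _ _) turnK.
rewrite /surv E {E}; case: x => y j.
rewrite [weight (turn _ _)]weight_flip /turn /flip /flow/= !weightE.
move: (factor_gt0 (y, j)) (factor_gt0 (y + a * dir R j * s, ~~ j)).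
move: (factor (y, j)) (factor (y + a * dir R j * s, ~~ j)).
move: (factor (y, ~~ j)) (factor (y + a * dir R j * s, j)) => p q u v u0 v0; field.
by rewrite (lt0r_neq0 u0) (lt0r_neq0 v0).
Qed.

(** No leg lasts forever, so that waiting times are finite. *)
Definition tail_zero := forall x, surv t x @[t --> +oo] --> (0 : R).

Lemma integral_hazard_tail (st : tail_zero) (r : R) x :
  (\int[mu]_(s in `]r, +oo[) (lam (flow s x) * surv s x)%:E = (surv r x)%:E)%E.
Proof.
have d (s : R) : is_derive s 1 (fun s => - surv s x) (lam (flow s x) * surv s x).
  have := is_deriveN (is_derive_surv s x); rewrite opprK; exact.
rewrite integral_itv_obnd_cbnd; last first.
  apply/measurable_EFinP; apply: measurable_funTS.
  by apply: continuous_measurable_fun; exact: hazard_cont.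
have st' : - surv s x @[s --> +oo] --> (0 : R).
  by rewrite -oppr0; apply: cvgN; exact: st.
apply: etrans (ge0_integral_FTCy r (fun s => hazard_ge0 s x) (@hazard_cont x) d st') _.
by rewrite sub0r opprK.
Qed.

Lemma integral_hazard (t : R) x : 0 <= t ->
  (\int[mu]_(s in `[0%R, t]) (lam (flow s x) * surv s x)%:E = (1 - surv t x)%R%:E)%E.
Proof.
move=> t0.
have d (s : R) : is_derive s 1 (fun s => - surv s x) (lam (flow s x) * surv s x).
  have := is_deriveN (is_derive_surv s x); rewrite opprK; exact.
apply: etrans (ge0_integral_FTC t0 (@hazard_cont x) d) _.
by rewrite surv0 opprK addrC.
Qed.

End zigzag_flow.

(** * The jump operator and the renewal equation *)

(** The indicator makes this a density on the whole line; integrals over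
    waiting times then have no domain to keep track of. *)
Definition wait_density (R : realType) (a : R) (lam : zzE R -> R) (s : R)
    (x : zzE R) : R := (0 < s)%R%:R * (lam (flow a s x) * surv a lam s x).

(** A point of R * zzE R is a remaining time together with a state of the
    process. *)
Definition jump (R : realType) (a : R) (m : R * zzE R) (s : R) : R * zzE R :=
  (m.1 - s, turn a s m.2).

(** One-jump expectation. The next jump may come after the remaining time has
    run out; u is then evaluated at a negative time. *)
Definition jump_op (R : realType) (a : R) (lam : zzE R -> R)
    (u : R * zzE R -> \bar R) (m : R * zzE R) : \bar R :=
  (\int[@lebesgue_measure R]_s
    ((wait_density a lam s m.2)%:E * u (jump a m s)))%E.

Definition nojump (R : realType) (a : R) (lam : zzE R -> R)
    (h : zzE R -> \bar R) (m : R * zzE R) : \bar R :=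
  (((0 <= m.1)%R%:R * surv a lam m.1 m.2)%:E * h (flow a m.1 m.2))%E.

(** The expectation of h after a time m.1, summed over the number of jumps. It
    is defined without reference to a process, which gives meaning to all
    starting points and times at once. *)
Definition semi (R : realType) (a : R) (lam : zzE R -> R)
    (h : zzE R -> \bar R) (m : R * zzE R) : \bar R :=
  (\sum_(n <oo) iter n (jump_op a lam) (nojump a lam h) m)%E.

Section measurability.
Context (R : realType) (a : R) (lam : zzE R -> R).
Hypotheses (a_gt0 : 0 < a) (lam_ge0 : forall x, 0 <= lam x).
Hypothesis (lam_cont : continuous lam).
Context d (T : measurableType d).

Lemma measurable_zzE d' (U : measurableType d') (f : zzE R -> U) :
  (forall j, measurable_fun setT (fun y => f (y, j))) -> measurable_fun setT f.
Proof.
move=> mf; rewrite [f](_ : _ = fun x => if x.2 then f (x.1, true) else f (x.1, false)).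
  exact: (measurable_fun_if_pair (mf true) (mf false)).
by apply/funext => -[y []].
Qed.

Lemma measurable_lam : measurable_fun setT lam.
Proof.
apply: measurable_zzE => j; apply: continuous_measurable_fun.
exact: lam_cont_slice.
Qed.

Lemma measurable_factor : measurable_fun setT (factor a lam).
Proof.
apply: measurable_zzE => j; apply: continuous_measurable_fun.
exact: is_derive_continuous (is_derive_factor a lam_cont j).
Qed.

Lemma measurable_flow (s : T -> R) (x : T -> zzE R) :
  measurable_fun setT s -> measurable_fun setT x ->
  measurable_fun setT (fun z => flow a (s z) (x z)).
Proof.
move=> ms mx.
have md : measurable_fun setT (fun x : zzE R => dir R x.2) by exact: measurable_zzE.
have mx1 : measurable_fun setT (fun z => (x z).1) by exact: measurableT_comp.
have mx2 : measurable_fun setT (fun z => (x z).2) by exact: measurableT_comp.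
apply: measurable_fun_pair => //.
apply: measurable_funD => //; apply: measurable_funM => //.
apply: measurable_funM => //; exact: (measurableT_comp md mx).
Qed.

Lemma measurable_flip : measurable_fun setT (@flip R).
Proof.
apply: measurable_zzE => j.
exact: (measurable_fun_pair (f := id) (g := cst (~~ j))).
Qed.

Lemma measurable_turn (s : T -> R) (x : T -> zzE R) :
  measurable_fun setT s -> measurable_fun setT x ->
  measurable_fun setT (fun z => turn a (s z) (x z)).
Proof.
move=> ms mx; apply: (measurableT_comp measurable_flip); exact: measurable_flow.
Qed.

Lemma measurable_surv (s : T -> R) (x : T -> zzE R) :
  measurable_fun setT s -> measurable_fun setT x ->
  measurable_fun setT (fun z => surv a lam (s z) (x z)).
Proof.
move=> ms mx; apply: measurable_funM.
  by apply: (measurableT_comp measurable_factor); exact: measurable_flow.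
apply: (measurableT_comp (f := fun x => (factor a lam x)^-1)) => //.
apply: measurable_zzE => j; apply: continuous_measurable_fun => y.
apply: cvgV; first by rewrite lt0r_neq0// factor_gt0.
exact: is_derive_continuous (is_derive_factor a lam_cont j) _.
Qed.

Lemma measurable_jump (s : T -> R) (m : T -> R * zzE R) :
  measurable_fun setT s -> measurable_fun setT m ->
  measurable_fun setT (fun z => jump a (m z) (s z)).
Proof.
move=> ms mm; apply: measurable_fun_pair.
  by apply: measurable_funB => //; exact: measurableT_comp.
by apply: measurable_turn => //; exact: measurableT_comp.
Qed.

Lemma measurable_gt0 (s : T -> R) : measurable_fun setT s ->
  measurable_fun setT (fun z => (0 < s z)%R%:R : R).
Proof.
move=> ms.
have m0 : measurable_fun setT (\1_(`]0, +oo[) : R -> R) by exact: measurable_indic.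
apply: eq_measurable_fun (measurableT_comp m0 ms) => z _ /=.
by rewrite indicE mem_setE in_itv/= andbT.
Qed.

Lemma measurable_ge0 (s : T -> R) : measurable_fun setT s ->
  measurable_fun setT (fun z => (0 <= s z)%R%:R : R).
Proof.
move=> ms.
have m0 : measurable_fun setT (\1_(`[0, +oo[) : R -> R) by exact: measurable_indic.
apply: eq_measurable_fun (measurableT_comp m0 ms) => z _ /=.
by rewrite indicE mem_setE in_itv/= andbT.
Qed.

Lemma measurable_wait_density (s : T -> R) (x : T -> zzE R) :
  measurable_fun setT s -> measurable_fun setT x ->
  measurable_fun setT (fun z => wait_density a lam (s z) (x z)).
Proof.
move=> ms mx; apply: measurable_funM; first exact: measurable_gt0.
apply: measurable_funM; last exact: measurable_surv.
by apply: (measurableT_comp measurable_lam); exact: measurable_flow.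
Qed.

End measurability.

Section jump_operator.
Context (R : realType) (a : R) (lam : zzE R -> R).
Hypotheses (a_gt0 : 0 < a) (lam_ge0 : forall x, 0 <= lam x).
Hypothesis (lam_cont : continuous lam).
Local Notation mu := (@lebesgue_measure R).
Local Notation flow := (flow a).
Local Notation turn := (turn a).
Local Notation surv := (surv a lam).
Local Notation jump := (jump a).
Local Notation wait_density := (wait_density a lam).
Local Notation jump_op := (jump_op a lam).
Local Notation nojump := (nojump a lam).
Local Notation semi := (semi a lam).
Local Open Scope ereal_scope.
Implicit Types (u v : R * zzE R -> \bar R) (m : R * zzE R) (h : zzE R -> \bar R).

Lemma wait_density_ge0 s x : (0 <= wait_density s x)%R.
Proof. by rewrite mulr_ge0// hazard_ge0. Qed.

Lemma wait_density_le0 s x : (s <= 0)%R -> wait_density s x = 0%R.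
Proof. by move=> s0; rewrite /wait_density ltNge s0 mul0r. Qed.

Lemma wait_density_gt0 s x : (0 < s)%R ->
  wait_density s x = (lam (flow s x) * surv s x)%R.
Proof. by move=> s0; rewrite /wait_density s0 mul1r. Qed.

Lemma jump_op_ge0 u m : (forall m, 0 <= u m) -> 0 <= jump_op u m.
Proof.
by move=> u0; apply: integral_ge0 => s _; rewrite mule_ge0// lee_fin wait_density_ge0.
Qed.

Lemma measurable_jump_opand u : measurable_fun setT u ->
  measurable_fun setT (fun z : (R * zzE R) * R =>
    (wait_density z.2 z.1.2)%:E * u (jump z.1 z.2)).
Proof.
move=> mu_; apply: emeasurable_funM.
  apply/measurable_EFinP; apply: measurable_wait_density => //.
  exact: measurableT_comp.
by apply: (measurableT_comp mu_); exact: measurable_jump.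
Qed.

Lemma measurable_jump_opand1 u m : measurable_fun setT u ->
  measurable_fun setT (fun s : R => (wait_density s m.2)%:E * u (jump m s)).
Proof.
move=> /measurable_jump_opand mf.
exact: (measurableT_comp mf (measurable_pair1 m)).
Qed.

Lemma measurable_jump_op u : measurable_fun setT u -> (forall m, 0 <= u m) ->
  measurable_fun setT (jump_op u).
Proof.
move=> mu_ u0.
apply: (measurable_fun_fubini_tonelli_F (m2 := mu) _ (measurable_jump_opand mu_)).
by move=> z; rewrite mule_ge0// lee_fin wait_density_ge0.
Qed.

Lemma iter_jump_op_ge0 n u m : (forall m, 0 <= u m) -> 0 <= iter n jump_op u m.
Proof. by move=> u0; elim: n m => [//|n IH] m; apply: jump_op_ge0. Qed.

Lemma measurable_iter_jump_op n u : measurable_fun setT u -> (forall m, 0 <= u m) ->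
  measurable_fun setT (iter n jump_op u).
Proof.
move=> mu_ u0; elim: n => [//|n IH]; apply: measurable_jump_op => // m.
exact: iter_jump_op_ge0.
Qed.

Lemma le_jump_op u v m : measurable_fun setT u -> measurable_fun setT v ->
  (forall m, 0 <= u m) ->
  (forall s, (0 < s)%R -> u (jump m s) <= v (jump m s)) ->
  jump_op u m <= jump_op v m.
Proof.
move=> mu_ mv u0 uv; apply: ge0_le_integral => //.
- by move=> s _; rewrite mule_ge0// lee_fin wait_density_ge0.
- exact: measurable_jump_opand1.
- exact: measurable_jump_opand1.
- move=> s _; have [s0|s0] := ltP 0%R s.
    by rewrite lee_wpmul2l ?lee_fin ?wait_density_ge0// uv.
  by rewrite wait_density_le0// !mul0e.
Qed.

Lemma jump_opD u v m : measurable_fun setT u -> measurable_fun setT v ->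
  (forall m, 0 <= u m) -> (forall m, 0 <= v m) ->
  jump_op (fun m => u m + v m) m = jump_op u m + jump_op v m.
Proof.
move=> mu_ mv u0 v0; rewrite /jump_op -ge0_integralD//.
- by apply: eq_integral => s _; rewrite ge0_muleDr.
- by move=> s _; rewrite mule_ge0// lee_fin wait_density_ge0.
- exact: measurable_jump_opand1.
- by move=> s _; rewrite mule_ge0// lee_fin wait_density_ge0.
- exact: measurable_jump_opand1.
Qed.

Lemma jump_opZ (c : R) u m : measurable_fun setT u -> (forall m, 0 <= u m) ->
  (0 <= c)%R -> jump_op (fun m => c%:E * u m) m = c%:E * jump_op u m.
Proof.
move=> mu_ u0 c0; rewrite /jump_op -ge0_integralZl//.
- by apply: eq_integral => s _; rewrite muleCA.
- exact: measurable_jump_opand1.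
- by move=> s _; rewrite mule_ge0// lee_fin wait_density_ge0.
Qed.

Lemma jump_op_nneseries (u : nat -> R * zzE R -> \bar R) m :
  (forall n, measurable_fun setT (u n)) -> (forall n m, 0 <= u n m) ->
  jump_op (fun m => \sum_(n <oo) u n m) m = \sum_(n <oo) jump_op (u n) m.
Proof.
move=> mu_ u0; rewrite /jump_op -integral_nneseries//.
- apply: eq_integral => s _; rewrite nneseriesZl//.
- by move=> n; exact: measurable_jump_opand1.
- by move=> n s _; rewrite mule_ge0// lee_fin wait_density_ge0.
Qed.

Definition causal u := forall m, (m.1 < 0)%R -> u m = 0.

Lemma causal_jump_op u : causal u -> causal (jump_op u).
Proof.
move=> cu m m0; rewrite /jump_op integral0_eq// => s _.
have [s0|s0] := ltP 0%R s; last by rewrite wait_density_le0// !mul0e.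
by rewrite cu ?mule0//= subr_lt0 (lt_trans m0).
Qed.

Lemma causal_iter_jump_op n u : causal u -> causal (iter n jump_op u).
Proof. by move=> cu; elim: n => [//|n IH]; exact: causal_jump_op. Qed.

Lemma causal_nojump h : causal (nojump h).
Proof. by move=> m m0; rewrite /nojump leNgt m0 mul0r mul0e. Qed.

Lemma nojumpE h (t : R) x : (0 <= t)%R ->
  nojump h (t, x) = (surv t x)%:E * h (flow t x).
Proof. by move=> t0; rewrite /nojump /= t0 mul1r. Qed.

Lemma nojump_ge0 h m : (forall x, 0 <= h x) -> 0 <= nojump h m.
Proof. by move=> h0; rewrite mule_ge0// lee_fin mulr_ge0// ltW// surv_gt0. Qed.

Lemma measurable_nojump h : measurable_fun setT h -> measurable_fun setT (nojump h).
Proof.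
move=> mh; apply: emeasurable_funM.
  apply/measurable_EFinP; apply: measurable_funM; last exact: measurable_surv.
  exact: measurable_ge0.
by apply: (measurableT_comp mh); exact: measurable_flow.
Qed.

Lemma semi_ge0 h m : (forall x, 0 <= h x) -> 0 <= semi h m.
Proof.
move=> h0; apply: nneseries_ge0 => n _ _; apply: iter_jump_op_ge0 => m'.
exact: nojump_ge0.
Qed.

Lemma measurable_semi h : measurable_fun setT h -> (forall x, 0 <= h x) ->
  measurable_fun setT (semi h).
Proof.
move=> mh h0; apply: ge0_emeasurable_sum => [n m _ _|n _].
  by apply: iter_jump_op_ge0 => m'; exact: nojump_ge0.
apply: measurable_iter_jump_op; first exact: measurable_nojump.
by move=> m'; exact: nojump_ge0.
Qed.

(** Conditioning on the first jump shifts the series by one. *)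
Lemma semiE h m : measurable_fun setT h -> (forall x, 0 <= h x) ->
  semi h m = nojump h m + jump_op (semi h) m.
Proof.
move=> mh h0.
have q0 n m' : 0 <= iter n jump_op (nojump h) m'.
  by apply: iter_jump_op_ge0 => ?; exact: nojump_ge0.
rewrite {1}/semi (nneseries_split 0 1)//.
rewrite big_mkord big_ord1; congr (_ + _).
rewrite [RHS]jump_op_nneseries//; last first.
  move=> n; apply: measurable_iter_jump_op; first exact: measurable_nojump.
  by move=> m'; exact: nojump_ge0.
rewrite -(nneseries_addn (f := fun n => iter n jump_op (nojump h) m) 1)//.
by apply: eq_eseriesr => n _; rewrite addn1.
Qed.

Lemma jump_op_sum (u : nat -> R * zzE R -> \bar R) n m :
  (forall n, measurable_fun setT (u n)) -> (forall n m, 0 <= u n m) ->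
  jump_op (fun m => \sum_(i < n) u i m) m = \sum_(i < n) jump_op (u i) m.
Proof.
move=> mu_ u0; rewrite /jump_op -(big_mkord xpredT (fun i => jump_op (u i) m)).
rewrite -ge0_integral_sum//; last 2 first.
- by move=> k; exact: measurable_jump_opand1.
- by move=> k s _; rewrite mule_ge0// lee_fin wait_density_ge0.
apply: eq_integral => s _; rewrite -ge0_sume_distrr ?big_mkord//.
Qed.

Lemma sum_iter_jump_op u n m : measurable_fun setT u -> (forall m, 0 <= u m) ->
  \sum_(i < n.+1) iter i jump_op u m =
  u m + jump_op (fun m => \sum_(i < n) iter i jump_op u m) m.
Proof.
move=> mu_ u0; rewrite big_ord_recl/=; congr (_ + _).
rewrite [RHS](jump_op_sum (u := fun i => iter i jump_op u))//.
- by move=> i; exact: measurable_iter_jump_op.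
- by move=> i m'; exact: iter_jump_op_ge0.
Qed.

(** Picard iteration from below: a supersolution dominates every partial sum. *)
Lemma semi_le_supersolution h v : measurable_fun setT h -> (forall x, 0 <= h x) ->
  measurable_fun setT v ->
  (forall m, nojump h m + jump_op v m <= v m) -> (forall m, 0 <= v m) ->
  forall m, semi h m <= v m.
Proof.
move=> mh h0 mv hv v0 m.
have q0 m' : 0 <= nojump h m' by exact: nojump_ge0.
have mq := measurable_nojump mh.
apply: lime_le.
  by apply: is_cvg_nneseries => n _ _; apply: iter_jump_op_ge0.
apply: nearW => n; rewrite big_mkord.
elim: n m => [|n IH] m; first by rewrite big_ord0.
rewrite sum_iter_jump_op//; apply: le_trans (hv m); rewrite leeD2l//.
apply: le_jump_op => //.
- by apply: emeasurable_sum => i; exact: measurable_iter_jump_op.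
- by move=> m'; apply: sume_ge0 => i _; exact: iter_jump_op_ge0.
Qed.

Lemma renewal_iter g v n m : measurable_fun setT g -> (forall m, 0 <= g m) ->
  measurable_fun setT v -> (forall m, 0 <= v m) ->
  (forall m, v m = g m + jump_op v m) ->
  v m = \sum_(i < n) iter i jump_op g m + iter n jump_op v m.
Proof.
move=> mg g0 mv v0 vE; elim: n m => [|n IH] m; first by rewrite big_ord0 add0e.
rewrite sum_iter_jump_op// -addeA; rewrite [LHS]vE; congr (_ + _).
rewrite iterS -jump_opD.
- by congr jump_op; apply/funext => m'; exact: IH.
- by apply: emeasurable_sum => i; exact: measurable_iter_jump_op.
- exact: measurable_iter_jump_op.
- by move=> m'; apply: sume_ge0 => i _; exact: iter_jump_op_ge0.
- by move=> m'; exact: iter_jump_op_ge0.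
Qed.

Lemma jump_op_itv u (t : R) x : causal u -> measurable_fun setT u ->
  jump_op u (t, x) =
  \int[mu]_(s in `[0%R, t]) ((lam (flow s x) * surv s x)%:E * u (t - s, turn s x)%R).
Proof.
move=> cu mu_; rewrite -integral_itv_obnd_cbnd; last first.
  apply: measurable_funTS; apply: emeasurable_funM.
    apply/measurable_EFinP; apply: measurable_funM; last exact: measurable_surv.
    apply: (measurableT_comp (measurable_lam lam_cont)); exact: measurable_flow.
  apply: (measurableT_comp mu_).
  exact: (@measurable_jump _ _ _ _ id (cst (t, x))).
rewrite [RHS]integral_mkcond; apply: eq_integral => s _.
rewrite patchE mem_setE in_itv/=.
have [s0|s0]/= := ltP 0%R s; last by rewrite wait_density_le0// !mul0e.
have [st|st]/= := leP s t; first by rewrite wait_density_gt0.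
by rewrite /jump cu ?mule0//= subr_lt0.
Qed.

End jump_operator.

(** * Conservation of mass and the semigroup property *)

Section conservation.
Context (R : realType) (a : R) (lam : zzE R -> R).
Hypotheses (a_gt0 : 0 < a) (lam_ge0 : forall x, 0 <= lam x).
Hypothesis (lam_cont : continuous lam).
Local Notation mu := (@lebesgue_measure R).
Local Notation flow := (flow a).
Local Notation turn := (turn a).
Local Notation surv := (surv a lam).
Local Notation jump := (jump a).
Local Notation wait_density := (wait_density a lam).
Local Notation jump_op := (jump_op a lam).
Local Notation nojump := (nojump a lam).
Local Notation semi := (semi a lam).
Local Open Scope ereal_scope.
Implicit Types (u v : R * zzE R -> \bar R) (m : R * zzE R) (h : zzE R -> \bar R).

(** The causal version of the constant 1. *)
Definition alive (m : R * zzE R) : \bar R := ((0 <= m.1)%R%:R)%:E.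

Lemma alive_ge0 m : 0 <= alive m. Proof. by rewrite lee_fin. Qed.

Lemma aliveT (t : R) (x : zzE R) : (0 <= t)%R -> alive (t, x) = 1.
Proof. by move=> t0; rewrite /alive t0. Qed.

Lemma causal_alive : causal alive.
Proof. by move=> m m0; rewrite /alive leNgt m0. Qed.

Lemma measurable_alive : measurable_fun setT alive.
Proof. by apply/measurable_EFinP; exact: measurable_ge0. Qed.

Let measurable_hazard x : measurable_fun setT (fun s => (lam (flow s x) * surv s x)%:E).
Proof.
apply/measurable_EFinP; apply: continuous_measurable_fun.
exact: hazard_cont.
Qed.

Lemma alive_renewal m : alive m = nojump (cst 1) m + jump_op alive m.
Proof.
case: m => t x; have [t0|t0] := leP 0%R t; last first.
  rewrite causal_nojump// causal_alive// causal_jump_op ?adde0//.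
  exact: causal_alive.
rewrite (jump_op_itv a lam_cont _ _ causal_alive measurable_alive).
rewrite /nojump/= t0 mul1r mule1 aliveT//.
under eq_integral.
  move=> s; rewrite inE/= in_itv/= => /andP[_ st].
  rewrite aliveT ?subr_ge0// mule1; over.
by rewrite (integral_hazard a_gt0 lam_cont)// -EFinD addrC subrK.
Qed.

Lemma lam_bounded (D : R) : exists2 B : R, (0 < B)%R &
  forall x, (`|x.1| <= D)%R -> (lam x <= B)%R.
Proof.
have [D0|D0] := ltP D 0%R.
  by exists 1%R => // x; rewrite leNgt (lt_le_trans D0).
have bnd j : exists2 B : R, (0 <= B)%R & forall y, (`|y| <= D)%R -> (lam (y, j) <= B)%R.
  have [|c _ hc] := @EVT_max R (fun y => lam (y, j)) (- D) D _
    (continuous_subspaceT (@lam_cont_slice _ _ lam_cont j)).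
    by rewrite ge0_cp.
  exists (lam (c, j)) => // y yD; apply: hc.
  by rewrite in_itv/= -ler_norml.
have [B1 B10 h1] := bnd true; have [B2 B20 h2] := bnd false.
exists (B1 + B2 + 1)%R; first by lra.
by move=> [y []]/= yD; [have := h1 y yD|have := h2 y yD]; lra.
Qed.

Lemma flow_norm (t s D : R) x : (0 <= s)%R -> (`|x.1| + a * t <= D)%R ->
  (`|(flow s x).1| + a * (t - s) <= D)%R.
Proof.
move=> s0 xD; apply: le_trans xD; rewrite mulrBr.
have -> : (flow s x).1 = (x.1 + a * dir R x.2 * s)%R by [].
have : (`|x.1 + a * dir R x.2 * s| <= `|x.1| + a * s)%R.
  rewrite (le_trans (ler_normD _ _))// lerD2l !normrM.
  have -> : (`|dir R x.2| = 1)%R by case: (x.2); rewrite /= ?normrN1 ?normr1.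
  by rewrite mulr1 (gtr0_norm a_gt0) (ger0_norm s0).
by lra.
Qed.

(** With rates bounded by B along the path, each jump at most halves the
    function exp(2 B t): no explosion, uniformly on bounded sets. *)
Lemma iter_alive_le (B D : R) n t x : (0 < B)%R ->
  (forall x, (`|x.1| <= D)%R -> (lam x <= B)%R) ->
  (0 <= t)%R -> (`|x.1| + a * t <= D)%R ->
  iter n jump_op alive (t, x) <= (2^-1 ^+ n * expR (2 * B * t))%:E.
Proof.
move=> B0 hB; elim: n t x => [|n IH] t x t0 xD.
  rewrite /= aliveT// expr0 mul1r lee_fin -[leLHS]expR0 ler_expR.
  by rewrite !mulr_ge0// ltW.
rewrite iterS (jump_op_itv a lam_cont); last 2 first.
- by apply: causal_iter_jump_op => //; exact: causal_alive.
- by apply: measurable_iter_jump_op => //; [exact: measurable_alive|exact: alive_ge0].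
pose f s : R := (B * (2^-1 ^+ n * expR (2 * B * (t - s))))%R.
pose F s : R := (- (2^-1 ^+ n.+1 * expR (2 * B * (t - s))))%R.
have dF (s : R) : is_derive s (1%R : R) F (f s).
  have h : is_derive s (1%R : R) (fun s => 2 * B * (t - s))%R (- (2 * B))%R.
    have := is_deriveZ (2 * B)%R (is_deriveB (is_derive_cst t s (1%R : R)) (is_derive_id s (1%R : R))).
    by rewrite sub0r scalerN scaler1.
  have h2 := @is_derive1_comp _ expR (fun s => 2 * B * (t - s))%R s _ _ (is_derive_expR _) h.
  have := is_deriveN (is_deriveZ (2^-1 ^+ n.+1)%R h2).
  by move=> /is_derive_eq; apply; rewrite /f exprS /GRing.scale/=; field.
have cf : continuous f.
  have -> : f = ((- 2 * B)%R *: F)%R.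
    apply/funext => z; rewrite -[RHS]/((- 2 * B) * F z)%R /f /F exprS.
    by field.
  exact: is_derive_continuous (fun s => is_deriveZ (- 2 * B)%R (dF s)).
apply: (@le_trans _ _ (\int[mu]_(s in `[0%R, t]) (f s)%:E)).
  apply: ge0_le_integral => //.
  - move=> s _; rewrite mule_ge0//; first by rewrite lee_fin hazard_ge0.
    by apply: iter_jump_op_ge0 => //; exact: alive_ge0.
  - apply: measurable_funTS; apply: emeasurable_funM; first exact: measurable_hazard.
    have mj : measurable_fun setT (jump (t, x)).
      exact: (@measurable_jump _ _ _ _ id (cst (t, x))).
    exact: (measurableT_comp (measurable_iter_jump_op a lam_ge0 lam_cont n
      measurable_alive alive_ge0) mj).
  - by apply/measurable_EFinP; apply: measurable_funTS; exact: continuous_measurable_fun.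
  - move=> s /=; rewrite in_itv/= => /andP[s0 st].
    rewrite /f [leRHS]EFinM; apply: lee_pmul.
    + by rewrite lee_fin hazard_ge0.
    + by apply: iter_jump_op_ge0 => //; exact: alive_ge0.
    + rewrite lee_fin -[leRHS]mulr1; apply: ler_pM => //.
      * by rewrite ltW// surv_gt0.
      * apply: hB; have := flow_norm s0 xD.
        have : (0 <= a * (t - s))%R by rewrite mulr_ge0 ?subr_ge0// ltW.
        by lra.
      * exact: surv_le1.
    + by apply: IH; rewrite ?subr_ge0//; exact: (flow_norm s0 xD).
rewrite (ge0_integral_FTC t0 cf dF) lee_fin /F subrr mulr0 expR0 subr0.
by rewrite mulr1 opprK addrC gerBl//.
Qed.

Lemma iter_alive_cvg0 m : iter n jump_op alive m @[n --> \oo] --> 0.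
Proof.
case: m => t x; have [t0|t0] := leP 0%R t; last first.
  apply: cvg_near_cst; apply: nearW => n.
  by rewrite causal_iter_jump_op//; exact: causal_alive.
have [B B0 hB] := lam_bounded (`|x.1| + a * t)%R.
apply: (@squeeze_cvge _ _ _ _ (cst 0) _ (fun n => (2^-1 ^+ n * expR (2 * B * t))%:E)).
- apply: nearW => n; rewrite iter_jump_op_ge0//; last exact: alive_ge0.
  by rewrite (iter_alive_le _ B0 hB).
- exact: cvg_cst.
- apply: cvg_EFin; first exact: nearW.
  rewrite -(mul0r (expR (2 * B * t))%R); apply: cvgM; last exact: cvg_cst.
  by apply: cvg_expr; rewrite ger0_norm// invf_lt1// ltr1n.
Qed.

(** After n iterations a solution differs from the partial sum of the series
    by at most c times the probability of n jumps in time, which vanishes. *)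
Lemma renewal_unique g v (c : R) : measurable_fun setT g -> (forall m, 0 <= g m) ->
  measurable_fun setT v -> (forall m, 0 <= v m) -> (0 <= c)%R ->
  (forall m, v m <= c%:E * alive m) ->
  (forall m, v m = g m + jump_op v m) ->
  forall m, v m = \sum_(n <oo) iter n jump_op g m.
Proof.
move=> mg g0 mv v0 c0 vc vE m.
have Kv n m' : iter n jump_op v m' <= c%:E * iter n jump_op alive m'.
  elim: n m' => [|n IH] m'; first exact: vc.
  rewrite !iterS -jump_opZ//; last 2 first.
  - by apply: measurable_iter_jump_op => //; [exact: measurable_alive|exact: alive_ge0].
  - by move=> ?; apply: iter_jump_op_ge0 => //; exact: alive_ge0.
  apply: le_jump_op => //.
  - exact: measurable_iter_jump_op.
  - apply: measurable_funeM.
    by apply: measurable_iter_jump_op => //; [exact: measurable_alive|exact: alive_ge0].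
  - by move=> ?; exact: iter_jump_op_ge0.
have rem0 : iter n jump_op v m @[n --> \oo] --> 0.
  apply: (@squeeze_cvge _ _ _ _ (cst 0) _ (fun n => c%:E * iter n jump_op alive m)).
  - by apply: nearW => n; rewrite iter_jump_op_ge0// Kv.
  - exact: cvg_cst.
  - rewrite -[X in _ --> X](mule0 c%:E); apply: cvgeZl => //.
    exact: iter_alive_cvg0.
have S : \sum_(i < n) iter i jump_op g m @[n --> \oo] --> \sum_(n <oo) iter n jump_op g m.
  under eq_cvg do rewrite -(big_mkord xpredT (fun i => iter i jump_op g m)).
  by apply: is_cvg_nneseries => n _ _; exact: iter_jump_op_ge0.
have SR : \sum_(i < n) iter i jump_op g m + iter n jump_op v m @[n --> \oo] -->
    \sum_(n <oo) iter n jump_op g m + 0.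
  apply: cvgeD => //; rewrite ge0_adde_def ?inE//.
  by apply: nneseries_ge0 => n _ _; exact: iter_jump_op_ge0.
rewrite adde0 in SR; rewrite -[RHS](cvg_lim _ SR)//; apply/esym/cvg_lim => //.
apply: cvg_near_cst; apply: nearW => n.
by rewrite -(@renewal_iter _ _ _ lam_ge0 lam_cont g v).
Qed.

(** Mass is conserved because [alive] is itself a bounded solution. *)
Lemma semi_cst1 m : semi (cst 1) m = alive m.
Proof.
apply/esym; apply: (@renewal_unique (nojump (cst 1)) alive 1) => //.
- by apply: measurable_nojump => //; exact: measurable_cst.
- by move=> m'; exact: nojump_ge0.
- exact: measurable_alive.
- exact: alive_ge0.
- by move=> m'; rewrite mul1e.
- exact: alive_renewal.
Qed.

Lemma semi_le_cst h (c : R) m : measurable_fun setT h -> (forall x, 0 <= h x) ->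
  (0 <= c)%R -> (forall x, h x <= c%:E) -> semi h m <= c%:E * alive m.
Proof.
move=> mh h0 c0 hc; apply: (@semi_le_supersolution _ _ _ lam_ge0 lam_cont h (fun m => c%:E * alive m)) => //.
- by apply: measurable_funeM; exact: measurable_alive.
- move=> m'; rewrite jump_opZ//; [|exact: measurable_alive|exact: alive_ge0].
  have -> : c%:E * alive m' =
      c%:E * nojump (cst 1) m' + c%:E * jump_op alive m'.
    rewrite [in LHS]alive_renewal ge0_muleDr//; first exact: nojump_ge0.
    by apply: jump_op_ge0 => //; exact: alive_ge0.
  rewrite leeD2r// /nojump muleCA lee_wpmul2l ?mule1//.
  by rewrite lee_fin mulr_ge0// ltW// surv_gt0.
- by move=> m'; rewrite mule_ge0// alive_ge0.
Qed.

Lemma measurable_semi1 h t : measurable_fun setT h -> (forall x, 0 <= h x) ->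
  measurable_fun setT (fun x => semi h (t, x)).
Proof.
move=> mh h0; have ms := measurable_semi a lam_ge0 lam_cont mh h0.
exact: (measurableT_comp ms (measurable_pair1 t)).
Qed.

(** The time-shifted semigroup solves the renewal equation whose no-jump term
    starts from the semigroup at the intermediate time; a jump after time t is
    a jump of the process restarted at its position at time t. *)
Lemma semiD h (t s : R) x : measurable_fun setT h -> (forall x, 0 <= h x <= 1) ->
  (0 <= t)%R -> (0 <= s)%R ->
  semi h (t + s, x)%R = semi (fun z => semi h (s, z)) (t, x).
Proof.
move=> mh h01 t0 s0.
have h0 y : 0 <= h y by have /andP[] := h01 y.
have h1 y : h y <= 1 by have /andP[] := h01 y.
have u0 m : 0 <= semi h m by exact: semi_ge0.
have mu_ : measurable_fun setT (semi h) by exact: measurable_semi.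
pose v m := alive m * semi h (m.1 + s, m.2)%R.
have v0 m : 0 <= v m by rewrite mule_ge0// alive_ge0.
have mv : measurable_fun setT v.
  apply: emeasurable_funM; first exact: measurable_alive.
  apply: (measurableT_comp mu_); apply: measurable_fun_pair => //.
  exact: measurable_funD.
have vt m : (0 <= m.1)%R -> v m = semi h (m.1 + s, m.2)%R.
  by case: m => r y /= r0; rewrite /v aliveT// mul1e.
rewrite -[LHS](vt (t, x))//.
apply: (@renewal_unique (nojump (fun z => semi h (s, z))) v 1) => //.
- by apply: measurable_nojump => //; exact: measurable_semi1.
- by move=> m; exact: nojump_ge0.
- move=> m; rewrite mul1e /v -[leRHS]mule1 lee_wpmul2l ?alive_ge0//.
  apply: (le_trans (@semi_le_cst h 1 _ mh h0 _ h1)) => //.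
  by rewrite mul1e /alive lee_fin lern1 leq_b1.
move=> {t0 x} [r x]; have [r0|r0] := leP 0%R r; last first.
  rewrite /v causal_nojump// causal_alive// mul0e causal_jump_op ?add0e//.
  by move=> m m0; rewrite /v causal_alive// mul0e.
rewrite vt//= (semiE a lam_ge0 lam_cont _ mh h0)//.
have mf : measurable_fun setT (fun z : R =>
    (wait_density z x)%:E * semi h (jump (r + s, x)%R z)).
  exact: (@measurable_jump_opand1 _ a _ lam_cont _ (r + s, x)%R mu_).
have f0 z : 0 <= (wait_density z x)%:E * semi h (jump (r + s, x)%R z).
  by rewrite mule_ge0// lee_fin wait_density_ge0.
rewrite {1}/jump_op /= (_ : \int[mu]_z _ = jump_op v (r, x) +
    (surv r x)%:E * jump_op (semi h) (s, flow r x)); last first.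
  rewrite -(setUv `]-oo, r]) ge0_integral_setU//=; last 3 first.
  - exact: measurableC.
  - exact: measurable_funTS.
  - exact/disj_setPCl.
  congr (_ + _).
  - rewrite integral_mkcond; apply: eq_integral => z _; rewrite patchE mem_setE in_itv/=.
    have [zr|zr] := leP z r.
      by rewrite vt /= ?subr_ge0// addrAC.
    by rewrite /v causal_alive ?mul0e ?mule0//= subr_lt0.
  rewrite setCitvl integral_mkcond (@ge0_integral_affine _ 1 r)//; last 2 first.
  - apply/(measurable_restrictT _ _).1 => //; exact: measurable_funTS.
  - by move=> z; rewrite patchE; case: ifP.
  rewrite normr1 mul1e; transitivity (\int[mu]_z ((surv r x)%:E *
    ((wait_density z (flow r x))%:E * semi h (jump (s, flow r x) z)))); last first.
    have mg := @measurable_jump_opand1 _ a _ lam_cont _ (s, flow r x) mu_.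
    have g0 z (_ : setT z) : 0 <=
        (wait_density z (flow r x))%:E * semi h (jump (s, flow r x) z).
      by rewrite mule_ge0// lee_fin wait_density_ge0.
    have sr0 : 0 <= (surv r x)%:E by rewrite lee_fin ltW// surv_gt0.
    exact: (ge0_integralZl mu measurableT mg g0 sr0).
  apply: eq_integral => z _; rewrite patchE mem_setE in_itv/= andbT mul1r.
  rewrite ltrDr; have [z0|z0] := ltP 0%R z; last first.
    by rewrite [in RHS]wait_density_le0// mul0e mule0.
  rewrite !wait_density_gt0 ?ltr_wpDr// muleA -EFinM; congr (_%:E * semi h _).
    by rewrite (addrC z r) survD flowD mulrCA.
  rewrite /jump/= /turn (addrC z r) flowD; congr pair.
  by rewrite opprD addrA (addrC r s) addrK.
rewrite addeCA [RHS]addeC; congr (_ + _).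
rewrite [RHS]nojumpE// (semiE a lam_ge0 lam_cont (s, flow r x) mh h0).
rewrite [RHS]ge0_muleDr; [|exact: nojump_ge0|exact: jump_op_ge0].
have rs0 : (0 <= r + s)%R by rewrite addr_ge0.
by rewrite nojumpE// [in RHS]nojumpE// flowD survD muleA EFinM.
Qed.

End conservation.

(** * The law of the process *)

Section tail_uniqueness.
Local Open Scope ereal_scope.
Context (R : realType).
Variables m1 m2 : {measure set R -> \bar R}.

(** Half-lines are stable under intersection and generate the Borel sets. *)
Lemma measure_eq_tails : (forall r : R, m1 `]r, +oo[%classic = m2 `]r, +oo[%classic) ->
  (forall r : R, m1 `]r, +oo[%classic < +oo) ->
  forall B, measurable B -> m1 B = m2 B.
Proof.
move=> m12 fin B mB.
pose G : set (set R) := [set `]r, +oo[%classic | r in [set: R]].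
pose g (n : nat) : set R := `](- n%:R)%R, +oo[%classic.
apply: (@measure_unique _ R R G g) => //.
- apply: etrans (RGenOInfty.measurableE R) _; congr (<<s _ >>).
  by apply/seteqP; split => [_ [r ->]|_ [r _ <-]]; exists r.
- move=> _ _ [r _ <-] [s _ <-]; exists (Num.max r s) => //.
  by apply/seteqP; split => x /=; rewrite !in_itv/= !andbT gt_max => /andP.
- by move=> n; exists (- n%:R)%R.
- apply/seteqP; split => // x _; exists (Num.truncn `|x|).+1 => //=.
  rewrite /g/= in_itv/= andbT ltrNl; apply: le_lt_trans (ler_norm _) _.
  by rewrite normrN truncnS_gt.
- by move=> _ [r _ <-].
- by move=> n; exact: fin.
Qed.

End tail_uniqueness.

Section law.
Context (R : realType) (a : R) (lam : zzE R -> R).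
Hypotheses (a_gt0 : 0 < a) (lam_ge0 : forall x, 0 <= lam x).
Hypothesis (lam_cont : continuous lam).
Hypothesis tail : tail_zero a lam.
Variables (x0 : zzE R) (X : zigzag a lam x0) (t : R).
Local Notation mu := (@lebesgue_measure R).
Local Notation flow := (flow a).
Local Notation turn := (turn a).
Local Notation surv := (surv a lam).
Local Notation jump := (jump a).
Local Notation wait_density := (wait_density a lam).
Local Notation jump_op := (jump_op a lam).
Local Notation nojump := (nojump a lam).
Local Notation semi := (semi a lam).
Local Notation P := (zz_prob X).
Local Notation Z := (zz_Z X).
Local Notation T := (jump_time (zz_Z X)).
Local Open Scope ereal_scope.

(** The time t is fixed; seen from its n-th jump the process has this much
    time left, and [jump] is the transition map ([clockS]). *)
Definition clock (n : nat) (w : zz_space X) : R * zzE R :=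
  (t - T n w, zz_state X (T n w) w)%R.

Lemma clock0 w : clock 0 w = (t, x0).
Proof. by rewrite /clock /jump_time big_ord0 subr0 zz_start. Qed.

Lemma jump_timeS n w : T n.+1 w = (T n w + Z n w)%R.
Proof. by rewrite /jump_time big_ord_recr. Qed.

Lemma clockS n w : clock n.+1 w = jump (clock n w) (Z n w).
Proof.
have Z0 : (0 < Z n w)%R := zz_Z_gt0 n w.
rewrite /clock /jump/=; congr pair; first by rewrite jump_timeS opprD addrA.
rewrite [LHS]surjective_pairing (zz_dir_flip n w) (@zz_position _ _ _ _ X n w); last first.
  by rewrite lexx jump_timeS ltrDl Z0.
rewrite /turn /flip /flow/=; congr pair.
by rewrite jump_timeS addrAC subrr add0r (mulrC a).
Qed.

Lemma measurable_clock_comp d (S : measurableType d) (f : S -> zz_space X) n :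
  (forall k, (k < n)%N -> measurable_fun setT (Z k \o f)) ->
  measurable_fun setT (clock n \o f).
Proof.
elim: n => [|n IH] mZ.
  rewrite (_ : _ \o _ = cst (t, x0)); first exact: measurable_cst.
  by apply/funext => w /=; rewrite clock0.
rewrite (_ : _ \o _ = fun w => jump ((clock n \o f) w) ((Z n \o f) w)).
  by apply: measurable_jump; [exact: mZ|apply: IH => k kn; apply: mZ; exact: ltnW].
by apply/funext => w /=; rewrite clockS.
Qed.

Lemma measurable_clock n : measurable_fun setT (clock n).
Proof. by apply: (@measurable_clock_comp _ _ id) => k _; exact: measurable_funP. Qed.

(** The state at the n-th jump is a function of the first n waiting times, so
    that the conditional survival probabilities apply to its events. *)
Lemma past_clock n B : measurable B ->
  past (fun k => Z k : zz_space X -> R) n (clock n @^-1` B).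
Proof.
move=> mB.
pose G := \bigcup_(k in `I_n) preimage_set_system setT (Z k) measurable.
have := @measurable_clock_comp _ (g_sigma_algebraType G) id n.
move=> /(_ _ measurableT _ mB); rewrite setTI; apply => k kn _ C mC.
by apply: sub_sigma_algebra; exists k => //; exists C.
Qed.

(** The maximum with 0 covers negative r, since waiting times are positive. *)
Lemma clock_tail n B (r : R) : measurable B ->
  P (clock n @^-1` B `&` [set w | (r < Z n w)%R]) =
  \int[P]_(w in clock n @^-1` B) (surv (Num.max r 0) (clock n w).2)%:E.
Proof.
move=> mB.
have -> : [set w | (r < Z n w)%R] = [set w | (Num.max r 0 < Z n w)%R].
  by apply/seteqP; split => w /=; rewrite gt_max (zz_Z_gt0 n w) andbT.
rewrite (zz_cond _ (past_clock mB)) ?le_max ?lexx ?orbT//.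
by apply: eq_integral => w _; rewrite zz_survivalE// le_max lexx orbT.
Qed.

Lemma wait_density_tail (r : R) x :
  \int[mu]_s (wait_density s x * \1_(`]r, +oo[%classic) s)%:E =
  (surv (Num.max r 0) x)%:E.
Proof.
rewrite -(integral_hazard_tail a_gt0 lam_ge0 lam_cont tail).
rewrite [RHS]integral_mkcond; apply: eq_integral => s _.
rewrite patchE mem_setE in_itv/= andbT gt_max indicE mem_setE in_itv/= andbT.
have [s0|s0] := ltP 0%R s; last by rewrite andbF wait_density_le0// mul0r.
by rewrite andbT wait_density_gt0//; case: ifP => _; rewrite ?mulr1 ?mulr0.
Qed.

Lemma measurable_wait1 x : measurable_fun setT (wait_density ^~ x).
Proof.
by apply: (@measurable_wait_density R a lam lam_cont _ _ id (cst x)) => //; exact: measurable_cst.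
Qed.

Lemma measurable_wait_clock n :
  measurable_fun setT (fun z : zz_space X * R => wait_density z.2 (clock n z.1).2).
Proof.
have mc := measurable_clock n; apply: measurable_wait_density => //.
by apply: measurableT_comp => //; exact: measurableT_comp.
Qed.

Lemma measurable_clock_wait n :
  measurable_fun setT (fun w : zz_space X => (clock n w, Z n w)).
Proof. by apply: measurable_fun_pair => //; exact: measurable_clock. Qed.

(** As measures in B the two sides agree on half-lines, by [clock_tail]. *)
Lemma clock_wait_rectangle n A B : measurable A -> measurable B ->
  \int[P]_w (\1_A (clock n w) * \1_B (Z n w) : R)%:E =
  \int[P]_w \int[mu]_s
    (\1_A (clock n w) * wait_density s (clock n w).2 * \1_B s : R)%:E.
Proof.
move=> mA mB; have mc := measurable_clock n.
have q0 w : (0 <= \1_A (clock n w) :> R)%R by [].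
have mq : measurable_fun setT (fun w => \1_A (clock n w) : R).
  exact: (measurableT_comp (measurable_indic mA) mc).
have mZ : measurable_fun setT (Z n : _ -> R) by exact: measurable_funP.
have r0 w s : (0 <= \1_A (clock n w) * wait_density s (clock n w).2 :> R)%R.
  by rewrite mulr_ge0// wait_density_ge0.
have mr w : measurable_fun setT
    (fun s => \1_A (clock n w) * wait_density s (clock n w).2 : R)%R.
  by apply: measurable_funM => //; exact: measurable_wait1.
have mid : measurable_fun setT (@id R) by [].
pose k w := weighted_image mu (r0 w) (mr w) mid.
have mk C : measurable C -> measurable_fun setT (k ^~ C).
  move=> mC; have mf : measurable_fun setT (fun z : zz_space X * R =>
      (\1_A (clock n z.1) * wait_density z.2 (clock n z.1).2 * \1_C z.2 : R)%:E).
    apply/measurable_EFinP; apply: measurable_funM; last first.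
      exact: (measurableT_comp (measurable_indic mC) measurable_snd).
    apply: measurable_funM; last exact: measurable_wait_clock.
    exact: (measurableT_comp mq measurable_fst).
  apply: (measurable_fun_fubini_tonelli_F (m2 := mu) _ mf) => z.
  by rewrite lee_fin mulr_ge0.
rewrite -[LHS]/(weighted_image P q0 mq mZ B) -[RHS]/(mixture P mk B).
have mD (r : R) : measurable (clock n @^-1` A `&` [set w | (r < Z n w)%R]).
  apply: measurableI; first by rewrite -[X in measurable X]setTI; exact: mc.
  rewrite -[X in measurable X]setTI.
  have := mZ measurableT `]r, +oo[%classic (measurable_itv _).
  by under eq_set do rewrite /= in_itv/= andbT.
have n1E r : weighted_image P q0 mq mZ `]r, +oo[%classic =
    P (clock n @^-1` A `&` [set w | (r < Z n w)%R]).
  rewrite weighted_imageE -[in RHS](setIT (_ `&` _)) -integral_indic//.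
  apply: eq_integral => w _; congr EFin.
  rewrite !indicE in_setI -natrM mulnb; congr ((_ && _)%:R).
  by rewrite mem_setE in_itv/= andbT; apply/idP/idP; rewrite inE.
pose n1 : {measure set R -> \bar R} := weighted_image P q0 mq mZ.
pose n2 : {measure set R -> \bar R} := mixture P mk.
apply: (@measure_eq_tails R n1 n2 _ _ B mB) => r; last first.
  rewrite [X in (X < _)%E](n1E r).
  by apply: le_lt_trans (probability_le1 _ _) (ltry _); exact: mD.
rewrite [LHS]n1E clock_tail// integral_mkcond.
apply: eq_integral => w _; rewrite /k weighted_imageE patchE.
under eq_integral do rewrite -mulrA EFinM.
rewrite ge0_integralZl//; last 2 first.
- apply/measurable_EFinP; apply: measurable_funM; first exact: measurable_wait1.
  exact: measurable_indic.
- by move=> s _; rewrite lee_fin mulr_ge0// wait_density_ge0.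
rewrite wait_density_tail indicE -[w \in _]/(clock n w \in A).
by case: (_ \in _); rewrite ?mul1e ?mul0e.
Qed.

(** Rectangles generate the product sigma-algebra. Given the past, the n-th
    waiting time thus has the density attached to the state entered at the
    n-th jump. *)
Lemma disintegration n (G : (R * zzE R) * R -> \bar R) :
  measurable_fun setT G -> (forall z, 0 <= G z) ->
  \int[P]_w G (clock n w, Z n w) =
  \int[P]_w \int[mu]_s ((wait_density s (clock n w).2)%:E * G (clock n w, s)).
Proof.
move=> mG G0; have mc := measurable_clock n.
have q0 w s : (0 <= wait_density s (clock n w).2)%R by exact: wait_density_ge0.
have mq w : measurable_fun setT (fun s => wait_density s (clock n w).2).
  exact: measurable_wait1.
have mp w : measurable_fun setT (pair (clock n w) : R -> _).
  by apply: measurable_fun_pair => //; exact: measurable_cst.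
pose k w := weighted_image mu (q0 w) (mq w) (mp w).
have mk C : measurable C -> measurable_fun setT (k ^~ C).
  move=> mC; have mf : measurable_fun setT (fun z : zz_space X * R =>
      (wait_density z.2 (clock n z.1).2 * \1_C (clock n z.1, z.2) : R)%:E).
    apply/measurable_EFinP; apply: measurable_funM; first exact: measurable_wait_clock.
    apply: (measurableT_comp (measurable_indic mC)).
    apply: measurable_fun_pair => //; exact: (measurableT_comp mc measurable_fst).
  apply: (measurable_fun_fubini_tonelli_F (m2 := mu) _ mf) => z.
  by rewrite lee_fin mulr_ge0// wait_density_ge0.
have one0 (w : zz_space X) : (0 <= cst 1%R w :> R)%R by rewrite /=.
have m1 : measurable_fun setT (cst 1%R : zz_space X -> R) by exact: measurable_cst.
pose l1 := weighted_image P one0 m1 (measurable_clock_wait n).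
have l12 : forall C, measurable C -> l1 C = mixture P mk C.
  pose S : set (set ((R * zzE R) * R)) := [set A `*` B | A in measurable & B in measurable].
  apply: (@measure_unique _ R _ S (fun=> setT)) => //.
  - by rewrite measurable_prod_measurableType.
  - move=> _ _ [A mA [B mB <-]] [A' mA' [B' mB' <-]].
    exists (A `&` A'); first exact: measurableI.
    by exists (B `&` B'); [exact: measurableI|rewrite setXI].
  - by move=> _; exists setT => //; exists setT => //; rewrite setXTT.
  - by rewrite bigcup_const.
  - move=> _ [A mA [B mB <-]]; rewrite /l1 weighted_imageE.
    transitivity (\int[P]_w (\1_A (clock n w) * \1_B (Z n w) : R)%:E).
      apply: eq_integral => w _; congr EFin; rewrite mul1r !indicE in_setX.
      by rewrite -natrM mulnb.
    rewrite (clock_wait_rectangle n mA mB); apply: eq_integral => w _.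
    apply: eq_integral => s _; congr EFin; rewrite !indicE in_setX/=.
    by rewrite mulrAC mulrC -mulnb natrM.
  - move=> _; rewrite /l1 weighted_imageE (eq_integral (cst 1)); last first.
      by move=> w _; rewrite indicT mul1r.
    rewrite integral_cst// mul1e.
    exact: le_lt_trans (probability_le1 P measurableT) (ltry _).
transitivity (\int[l1]_z G z).
  rewrite /l1 ge0_integral_weighted_image//.
  by apply: eq_integral => w _; rewrite mul1e.
transitivity (\int[mixture P mk]_z G z).
  by apply: eq_measure_integral => C mC _; exact: l12.
rewrite ge0_integral_mixture//; apply: eq_integral => w _.
by rewrite /k ge0_integral_weighted_image.
Qed.

Lemma integral_clock n u : measurable_fun setT u -> (forall m, 0 <= u m) ->
  \int[P]_w u (clock n w) = iter n jump_op u (t, x0).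
Proof.
elim: n u => [|n IH] u mu_ u0.
  rewrite (eq_integral (cst (u (t, x0)))); last by move=> w _; rewrite clock0.
  by rewrite integral_cst// [X in _ * X]probability_setT mule1.
rewrite iterSr -IH; last 2 first.
- exact: measurable_jump_op.
- by move=> m; exact: jump_op_ge0.
rewrite -(@disintegration n (fun z => u (jump z.1 z.2)))//.
- by apply: eq_integral => w _; rewrite clockS.
- apply: (measurableT_comp mu_); exact: measurable_jump.
Qed.

Lemma jump_time0 w : T 0 w = 0%R.
Proof. by rewrite /jump_time big_ord0. Qed.

Lemma jump_time_lt n w : (T n w < T n.+1 w)%R.
Proof. by rewrite jump_timeS ltrDl; exact: (zz_Z_gt0 n w). Qed.

Lemma state_between n w : (T n w <= t < T n.+1 w)%R ->
  zz_state X t w = flow (t - T n w)%R (zz_state X (T n w) w).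
Proof.
move=> /andP[]; rewrite le_eqVlt => /predU1P[<- _|Tt tT].
  by rewrite subrr flow0.
rewrite [LHS]surjective_pairing (@zz_position _ _ _ _ X n w); last by rewrite Tt ltW.
rewrite (@zz_dir_const _ _ _ _ X n w); last by rewrite Tt.
by rewrite /flow/=; congr pair; rewrite (mulrC a).
Qed.

Lemma measurable_state (h : zzE R -> \bar R) : measurable_fun setT h ->
  measurable_fun setT (fun w => h (zz_state X t w)).
Proof. by move=> mh; exact: (measurableT_comp mh (measurable_funP _)). Qed.

Lemma measurable_jump_time n : measurable_fun setT (T n : zz_space X -> R).
Proof.
rewrite (_ : T n = fun w => t - (clock n w).1)%R; last first.
  by apply/funext => w; rewrite /clock/= subKr.
by apply: measurable_funB => //; apply: measurableT_comp => //; exact: measurable_clock.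
Qed.

Definition on_leg n w : \bar R := ((T n w <= t < T n.+1 w)%R%:R)%:E.

Lemma measurable_on_leg n : measurable_fun setT (on_leg n).
Proof.
apply/measurable_EFinP.
rewrite (_ : (fun w => _) = fun w => ((0 <= t - T n w)%R%:R * (0 < T n.+1 w - t)%R%:R)%R).
  apply: measurable_funM.
    by apply: measurable_ge0; apply: measurable_funB => //; exact: measurable_jump_time.
  by apply: measurable_gt0; apply: measurable_funB => //; exact: measurable_jump_time.
by apply/funext => w; rewrite subr_ge0 subr_gt0 -natrM mulnb.
Qed.

(** The leg in progress at time t is the n-th one when the n-th clock is still
    nonnegative and the next waiting time exceeds it; integrating out that
    waiting time leaves the survival probability. *)
Lemma integral_on_leg n (h : zzE R -> \bar R) : measurable_fun setT h -> (forall x, 0 <= h x) ->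
  \int[P]_w (on_leg n w * h (zz_state X t w)) =
  iter n jump_op (nojump h) (t, x0).
Proof.
move=> mh h0.
pose G (z : (R * zzE R) * R) : \bar R :=
  ((0 <= z.1.1)%R%:R * (0 < z.2 - z.1.1)%R%:R)%:E * h (flow z.1.1 z.1.2).
have m11 : measurable_fun setT (fun z : (R * zzE R) * R => z.1.1).
  exact: measurableT_comp.
have m12 : measurable_fun setT (fun z : (R * zzE R) * R => z.1.2).
  exact: measurableT_comp.
have mG : measurable_fun setT G.
  apply: emeasurable_funM.
    apply/measurable_EFinP; apply: measurable_funM; first exact: measurable_ge0.
    by apply: measurable_gt0; exact: measurable_funB.
  by apply: (measurableT_comp mh); exact: measurable_flow.
have G0 z : 0 <= G z by rewrite mule_ge0// lee_fin mulr_ge0.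
transitivity (\int[P]_w G (clock n w, Z n w)).
  apply: eq_integral => w _; rewrite /G/=.
  have -> : (Z n w - (t - T n w) = T n.+1 w - t)%R by rewrite jump_timeS opprB addrCA addrA.
  rewrite subr_ge0 subr_gt0 -natrM mulnb /on_leg.
  have [/state_between -> //|_] := boolP (T n w <= t < T n.+1 w)%R.
  by rewrite !mul0e.
rewrite disintegration//.
rewrite -(integral_clock n); last 2 first.
- exact: measurable_nojump.
- by move=> m; exact: nojump_ge0.
apply: eq_integral => w _; move: (clock n w) => [r x]/=; rewrite /G/=.
have [r0|r0] := leP 0%R r; last first.
  rewrite causal_nojump// integral0_eq// => s _.
  by rewrite mul0r mul0e mule0.
rewrite nojumpE// muleC.
have <- : \int[mu]_s (wait_density s x * \1_(`]r, +oo[%classic) s)%:E = (surv r x)%:E.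
  by rewrite wait_density_tail max_l.
rewrite -ge0_integralZl//; last 2 first.
- apply/measurable_EFinP; apply: measurable_funM; first exact: measurable_wait1.
  exact: measurable_indic.
- by move=> s _; rewrite lee_fin mulr_ge0// wait_density_ge0.
apply: eq_integral => s _; rewrite mul1r muleA -EFinM muleC subr_gt0.
by rewrite indicE mem_setE in_itv/= andbT.
Qed.

Hypothesis t_ge0 : (0 <= t)%R.

Lemma sum_on_leg n w : \sum_(i < n) on_leg i w = ((t < T n w)%R%:R)%:E.
Proof.
elim: n => [|n IH]; first by rewrite big_ord0 jump_time0 ltNge t_ge0.
rewrite big_ord_recr/= IH /on_leg -EFinD; congr EFin.
case: (ltP t (T n w)) => tT /=; last by rewrite add0r.
by rewrite addr0 (lt_trans tT (jump_time_lt n w)).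
Qed.

Lemma measurable_jumped n : measurable [set w | (T n w <= t)%R].
Proof.
rewrite -[X in measurable X]setTI.
have := @measurable_jump_time n measurableT `]-oo, t]%classic (measurable_itv _).
by under eq_set do rewrite /= in_itv/=.
Qed.

Lemma measurable_explosion : measurable [set w | forall n, (T n w <= t)%R].
Proof.
rewrite (_ : [set w | _] = \bigcap_n [set w | (T n w <= t)%R]).
  by apply: bigcapT_measurable => n; exact: measurable_jumped.
by apply/seteqP; split => w /= h n; [move=> _; exact: h|exact: h].
Qed.

(** Explosion before time t has probability at most that of any number of
    jumps by time t, which vanishes in the limit. *)
Lemma nonexplosion : P [set w | forall n, (T n w <= t)%R] = 0.
Proof.
have mT := measurable_jumped; have mN := measurable_explosion.
apply/eqP; rewrite eq_le measure_ge0 andbT.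
have := @iter_alive_cvg0 _ _ _ a_gt0 lam_ge0 lam_cont (t, x0).
move=> h; rewrite -(cvg_lim _ h)//; apply: lime_ge; first exact: cvgP h.
apply: nearW => n; rewrite -(integral_clock n (@measurable_alive R)); last exact: alive_ge0.
apply: (@le_trans _ _ (P [set w | (T n w <= t)%R])).
  by apply: le_measure; rewrite ?inE// => w h'; exact: h'.
rewrite -[X in P X]setIT -integral_indic//; apply: ge0_le_integral => //.
- by apply/measurable_EFinP; exact: measurable_indic.
- exact: (measurableT_comp (@measurable_alive R) (measurable_clock n)).
- by move=> w _; rewrite /alive/= subr_ge0 lee_fin indicE; case: (boolP (_ \in _)) => //; rewrite inE => /= ->.
Qed.

(** Almost surely exactly one leg is in progress at time t. *)
Lemma integral_law (h : zzE R -> \bar R) :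
  measurable_fun setT h -> (forall x, 0 <= h x) ->
  \int[zz_law X t]_z h z = semi h (t, x0).
Proof.
move=> mh h0; rewrite /zz_law ge0_integral_distribution//.
have f0 n w : 0 <= on_leg n w * h (zz_state X t w) by rewrite mule_ge0// lee_fin.
have mf n : measurable_fun setT (fun w => on_leg n w * h (zz_state X t w)).
  by apply: emeasurable_funM; [exact: measurable_on_leg|exact: measurable_state].
transitivity (\int[P]_w \sum_(n <oo) (on_leg n w * h (zz_state X t w))).
  apply: ge0_ae_eq_integral => //.
  - exact: measurable_state.
  - by apply: ge0_emeasurable_sum => // n w _ _; exact: f0.
  - by move=> w _; exact: h0.
  - by move=> w _; apply: nneseries_ge0 => n _ _; exact: f0.
  - exists [set w | forall n, (T n w <= t)%R].
    split; [exact: measurable_explosion|exact: nonexplosion|].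
    move=> w /= /not_implyP[_ hw] n; rewrite leNgt; apply/negP => tT; apply: hw.
    apply/esym/cvg_lim => //; apply: cvg_near_cst.
    exists n => // N /= nN; rewrite big_mkord -ge0_sume_distrl; last first.
      by move=> i _; rewrite lee_fin.
    have TN : (t < T N w)%R.
      apply: (lt_le_trans tT); apply: (@homo_leq _ (fun k => T k w) <=%R) nN => //.
        exact: le_trans.
      by move=> k; rewrite ltW// jump_time_lt.
    by rewrite sum_on_leg TN mul1e.
rewrite integral_nneseries//; apply: eq_eseriesr => n _.
exact: integral_on_leg.
Qed.

End law.

(** * Invariance of the weight *)

Section reference_measure.
Local Open Scope ereal_scope.
Context (R : realType).

(** The reference measure is named so that it can carry the sigma-finiteness
    that Fubini's theorem asks for. *)
Definition leb_pm : set (measurableTypeR R * bool) -> \bar R :=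
  @lebesgue_measure R \x dirac_pm R.

HB.instance Definition _ := Measure.on leb_pm.

Let leb_pm_sigma_finite : sigma_finite setT leb_pm.
Proof.
have [F FT Foo] := sigma_finiteT (@lebesgue_measure R).
exists (fun n => F n `*` setT) => [|n].
  apply/seteqP; split => // -[y j] _.
  have [k _ Fy] : (\bigcup_i F i) y by rewrite -FT.
  by exists k.
have [mF Fn] := Foo n; split; first exact: measurableX.
rewrite /leb_pm product_measure1E// lte_mul_pinfty// ?ge0_fin_numE//.
by rewrite -ge0_fin_numE// fin_num_measure.
Qed.

HB.instance Definition _ := Measure_isSigmaFinite.Build _ _ _ leb_pm
  leb_pm_sigma_finite.

End reference_measure.
Arguments leb_pm : clear implicits.

Section reference_integral.
Local Open Scope ereal_scope.
Context (R : realType) (a : R).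
Local Notation mu := (@lebesgue_measure R).
Local Notation ref := (leb_pm R).

Lemma integral_ref (f : zzE R -> \bar R) : measurable_fun setT f ->
  (forall x, 0 <= f x) ->
  \int[ref]_x f x = \int[mu]_y (f (y, false) + f (y, true)).
Proof.
move=> mf f0; rewrite fubini_tonelli1//; apply: eq_integral => y _.
rewrite /fubini_F /dirac_pm ge0_integral_measure_add//.
by rewrite !integral_dirac// !diracE !in_setT !mul1e.
Qed.

Lemma integral_translate (c : R) (f : R -> \bar R) : measurable_fun setT f ->
  (forall x, 0 <= f x) -> \int[mu]_x f (x + c)%R = \int[mu]_x f x.
Proof.
move=> mf f0; rewrite (@ge0_integral_affine _ 1 c f)// normr1 mul1e.
by apply: eq_integral => x _; rewrite mul1r.
Qed.

Lemma integral_reflect (c : R) (f : R -> \bar R) : measurable_fun setT f ->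
  (forall x, 0 <= f x) -> \int[mu]_x f (c - x)%R = \int[mu]_x f x.
Proof.
move=> mf f0; rewrite (@ge0_integral_affine _ (-1) c f)//.
by rewrite normrN1 mul1e; apply: eq_integral => x _; rewrite mulN1r addrC.
Qed.

(** On each of the two lines the turn is a translation onto the other one. *)
Lemma integral_turn (s : R) (f : zzE R -> \bar R) : measurable_fun setT f ->
  (forall x, 0 <= f x) -> \int[ref]_x f (turn a s x) = \int[ref]_x f x.
Proof.
move=> mf f0.
have mft : measurable_fun setT (fun x => f (turn a s x)).
  by apply: (measurableT_comp mf); exact: measurable_turn.
have mfj j : measurable_fun setT (fun y => f (y, j)).
  exact: (measurableT_comp mf (measurable_pair2 j)).
have mfc (c : R) j : measurable_fun setT (fun y : R => f (y + c, j)%R).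
  by apply: (measurableT_comp (mfj j)); exact: measurable_funD.
have split_dir (g1 g2 : R -> \bar R) : measurable_fun setT g1 -> measurable_fun setT g2 ->
    (forall y, 0 <= g1 y) -> (forall y, 0 <= g2 y) ->
    \int[mu]_y (g1 y + g2 y) = \int[mu]_y g1 y + \int[mu]_y g2 y.
  by move=> *; apply: ge0_integralD.
rewrite !integral_ref// [RHS]split_dir//.
rewrite (split_dir (fun y => f (y + a * dir R false * s, true)%R)
  (fun y => f (y + a * dir R true * s, false)%R))//.
rewrite (@integral_translate (a * dir R false * s) (fun y => f (y, true)))//.
rewrite (@integral_translate (a * dir R true * s) (fun y => f (y, false)))//.
by rewrite addeC.
Qed.

End reference_integral.

(** The factor is allowed to be infinite, unlike in [nneseriesZl]. *)
Lemma nneseries_mulel (R : realType) (k : \bar R) (f : nat -> \bar R) :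
  (0 <= k)%E -> (forall n, 0 <= f n)%E ->
  (\sum_(n <oo) (k * f n) = k * \sum_(n <oo) f n)%E.
Proof.
have ge_term (g : nat -> \bar R) n : (forall n, 0 <= g n)%E -> (g n <= \sum_(i <oo) g i)%E.
  move=> g0; apply: le_trans (nneseries_lim_ge n.+1 (fun i _ _ => g0 i)).
  by rewrite big_nat_recr//= leeDr// sume_ge0.
case: k => [r _ f0|_ f0|//]; first by rewrite nneseriesZl.
have [[n fn]|f_eq0] := pselect (exists n, f n != 0%E).
  have fn0 : (0 < f n)%E by rewrite lt_neqAle eq_sym fn f0.
  rewrite gt0_mulye ?(lt_le_trans fn0) ?ge_term//.
  apply/eqP; rewrite eq_le leey/= -[leLHS](gt0_mulye fn0).
  by apply: (ge_term (fun n => +oo * f n)%E) => m; rewrite mule_ge0.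
have fE n : f n = 0%E by apply/eqP/negPn/negP => h; apply: f_eq0; exists n.
by rewrite !eseries0 ?mule0// => n _ _; rewrite fE ?mule0.
Qed.

Section invariance.
Context (R : realType) (a : R) (lam : zzE R -> R).
Hypotheses (a_gt0 : 0 < a) (lam_ge0 : forall x, 0 <= lam x).
Hypothesis (lam_cont : continuous lam).
Local Notation mu := (@lebesgue_measure R).
Local Notation ref := (leb_pm R).
Local Notation flow := (flow a).
Local Notation turn := (turn a).
Local Notation surv := (surv a lam).
Local Notation jump := (jump a).
Local Notation wait_density := (wait_density a lam).
Local Notation jump_op := (jump_op a lam).
Local Notation nojump := (nojump a lam).
Local Notation semi := (semi a lam).
Local Notation weight := (weight a lam).
Local Open Scope ereal_scope.
Implicit Types (k u v : R * zzE R -> \bar R) (h : zzE R -> \bar R).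

(** The stationary rate of jumps that land at x. *)
Definition jump_flux (x : zzE R) : R := (lam (flip x) * weight x)%R.

(** A convolution in time, integrated against the stationary flux of jumps. *)
Definition conv_pairing (t : R) k v : \bar R :=
  \int[mu]_r \int[ref]_x ((jump_flux x)%:E * (k (r, x) * v (t - r, x)%R)).

Lemma jump_flux_ge0 x : (0 <= jump_flux x)%R.
Proof. by rewrite mulr_ge0// ltW// weight_gt0. Qed.

Lemma measurable_weight : measurable_fun setT weight.
Proof.
have mf j : measurable_fun setT (fun x : zzE R => factor a lam (x.1, j)).
  apply: (measurableT_comp (measurable_factor a lam_cont)).
  by apply: measurable_fun_pair => //; exact: measurable_cst.
exact: measurable_funM.
Qed.

Lemma measurable_jump_flux : measurable_fun setT jump_flux.
Proof.
apply: measurable_funM; last exact: measurable_weight.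
by apply: (measurableT_comp (measurable_lam lam_cont)); exact: measurable_flip.
Qed.

Lemma flip_turn s x : flip (turn s x) = flow s x.
Proof. exact: flipK. Qed.

Lemma flow_turn s x : flow s (turn s x) = flip x.
Proof. by rewrite -[LHS]flipK -/(turn _ _) turnK. Qed.

(** Skew detailed balance for the density of one jump at time s. *)
Lemma weight_wait_density s x :
  (weight (turn s x) * wait_density s (turn s x) =
   (0 < s)%R%:R * (jump_flux x * surv s x))%R.
Proof.
rewrite /wait_density flow_turn mulrCA; congr (_ * _)%R.
by rewrite mulrCA -weight_surv /jump_flux mulrA.
Qed.

Lemma jump_flux_wait_density s x :
  (jump_flux (turn s x) * wait_density s (turn s x) =
   jump_flux x * wait_density s x)%R.
Proof.
rewrite /jump_flux flip_turn -[LHS]mulrA [X in (_ * X)%R](weight_wait_density s x).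
by rewrite /jump_flux /wait_density; ring.
Qed.

(** Substituting [turn s x] for x and shifting the time by s moves the jump
    from one argument to the other; the flux is preserved by
    [jump_flux_wait_density]. *)
Lemma conv_pairing_sym t k v : measurable_fun setT k -> measurable_fun setT v ->
  (forall m, 0 <= k m) -> (forall m, 0 <= v m) ->
  conv_pairing t k (jump_op v) = conv_pairing t (jump_op k) v.
Proof.
move=> mk mv k0 v0.
pose Phi (r : R) (x : zzE R) (s : R) : \bar R :=
  (jump_flux x * wait_density s x)%:E * (k (r, x) * v (t - r - s, turn s x)%R).
have Phi0 r x s : 0 <= Phi r x s.
  by rewrite mule_ge0// ?mule_ge0// lee_fin mulr_ge0// ?jump_flux_ge0// wait_density_ge0.
have mPhi d (T : measurableType d) (r s : T -> R) (x : T -> zzE R) :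
    measurable_fun setT r -> measurable_fun setT s -> measurable_fun setT x ->
    measurable_fun setT (fun z => Phi (r z) (x z) (s z)).
  move=> mr ms mx; apply: emeasurable_funM.
    apply/measurable_EFinP; apply: measurable_funM.
      exact: (measurableT_comp measurable_jump_flux mx).
    exact: measurable_wait_density.
  apply: emeasurable_funM.
    by apply: (measurableT_comp mk); exact: measurable_fun_pair.
  apply: (measurableT_comp mv); apply: measurable_fun_pair.
    by do 2 apply: measurable_funB => //; exact: measurable_cst.
  exact: measurable_turn.
have xs r : \int[ref]_x \int[mu]_s Phi r x s = \int[mu]_s \int[ref]_x Phi r x s.
  have mf : measurable_fun setT (fun z : zzE R * R => Phi r z.1 z.2) by exact: mPhi.
  exact: (fubini_tonelli (m1 := ref) (m2 := mu) _ mf (fun z => Phi0 _ _ _)).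
transitivity (\int[mu]_r \int[mu]_s \int[ref]_x Phi r x s).
  apply: eq_integral => r _; rewrite -xs; apply: eq_integral => x _.
  rewrite /jump_op muleA -ge0_integralZl//; last 3 first.
  - exact: measurable_jump_opand1.
  - by move=> s _; rewrite mule_ge0// lee_fin wait_density_ge0.
  - by rewrite mule_ge0// lee_fin jump_flux_ge0.
  apply: eq_integral => s _; rewrite /Phi (EFinM (jump_flux x)) -!muleA; congr (_ * _).
  by rewrite muleCA.
transitivity (\int[mu]_r \int[mu]_s \int[ref]_x Phi r (turn s x) s).
  apply: eq_integral => r _; apply: eq_integral => s _.
  have mx : measurable_fun setT (fun x => Phi r x s).
    by apply: mPhi => //; exact: measurable_cst.
  exact/esym/(integral_turn a s mx (fun x => Phi0 r x s)).
have mI : measurable_fun setT (fun z : R * R => \int[ref]_x Phi z.1 (turn z.2 x) z.2).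
  apply: (measurable_fun_fubini_tonelli_F (m2 := ref)
    (fun z : (R * R) * zzE R => Phi z.1.1 (turn z.1.2 z.2) z.1.2)) => //.
  apply: mPhi; try exact: measurableT_comp.
  by apply: measurable_turn => //; exact: measurableT_comp.
have I0 (z : R * R) : 0 <= \int[ref]_x Phi z.1 (turn z.2 x) z.2 by exact: integral_ge0.
transitivity (\int[mu]_s \int[mu]_r \int[ref]_x Phi r (turn s x) s).
  exact: (fubini_tonelli (m1 := mu) (m2 := mu) _ mI I0).
transitivity (\int[mu]_s \int[mu]_r \int[ref]_x Phi (r - s)%R (turn s x) s).
  apply: eq_integral => s _.
  rewrite (@integral_translate _ (- s) (fun r => \int[ref]_x Phi r (turn s x) s))//.
    exact: (measurableT_comp mI (measurable_pair2 s)).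
  by move=> r; apply: integral_ge0.
have mJ : measurable_fun setT (fun z : R * R =>
    \int[ref]_x Phi (z.1 - z.2)%R (turn z.2 x) z.2).
  have mz : measurable_fun setT (fun z : R * R => (z.1 - z.2, z.2)%R).
    by apply: measurable_fun_pair => //; exact: measurable_funB.
  exact: (measurableT_comp mI mz).
have J0 (z : R * R) : 0 <= \int[ref]_x Phi (z.1 - z.2)%R (turn z.2 x) z.2.
  exact: integral_ge0.
transitivity (\int[mu]_r \int[mu]_s \int[ref]_x Phi (r - s)%R (turn s x) s).
  exact/esym/(fubini_tonelli (m1 := mu) (m2 := mu) _ mJ J0).
apply: eq_integral => r _.
have mL : measurable_fun setT (fun z : zzE R * R => Phi (r - z.2)%R (turn z.2 z.1) z.2).
  apply: mPhi => //; first by apply: measurable_funB => //; exact: measurable_cst.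
  exact: measurable_turn.
transitivity (\int[ref]_x \int[mu]_s Phi (r - s)%R (turn s x) s).
  exact/esym/(fubini_tonelli (m1 := ref) (m2 := mu) _ mL (fun z => Phi0 _ _ _)).
apply: eq_integral => x _.
rewrite [in RHS](muleC (jump_op k _)) muleA /jump_op -ge0_integralZl//; last 3 first.
- exact: measurable_jump_opand1.
- by move=> s _; rewrite mule_ge0// lee_fin wait_density_ge0.
- by rewrite mule_ge0// lee_fin jump_flux_ge0.
apply: eq_integral => s _; rewrite /Phi jump_flux_wait_density turnK.
have -> : (t - (r - s) - s = t - r)%R by ring.
rewrite (EFinM (jump_flux x)) -!muleA; congr (_ * _).
by rewrite [RHS]muleCA; congr (_ * _); rewrite muleC.
Qed.

Lemma integral_gt0_ge0 (f : R -> \bar R) : measurable_fun setT f ->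
  \int[mu]_s ((0 < s)%R%:R%:E * f s) = \int[mu]_s ((0 <= s)%R%:R%:E * f s).
Proof.
move=> mf; transitivity (\int[mu]_(s in `]0%R, +oo[) f s).
  rewrite [RHS]integral_mkcond; apply: eq_integral => s _.
  by rewrite patchE mem_setE in_itv/= andbT; case: ifP => _; rewrite ?mul1e ?mul0e.
rewrite integral_itv_obnd_cbnd; last exact: measurable_funTS.
rewrite integral_mkcond; apply: eq_integral => s _.
by rewrite patchE mem_setE in_itv/= andbT; case: ifP => _; rewrite ?mul1e ?mul0e.
Qed.

(** The substitution [turn s] turns the weight at the start of the first leg
    into the flux of jumps at its end. *)
Lemma integral_first_jump t v : measurable_fun setT v -> (forall m, 0 <= v m) ->
  \int[ref]_x ((weight x)%:E * jump_op v (t, x)) =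
  conv_pairing t (nojump (cst 1)) v.
Proof.
move=> mv v0.
pose Phi (s : R) (x : zzE R) := (weight x * wait_density s x)%:E * v (t - s, turn s x)%R.
have Phi0 s x : 0 <= Phi s x.
  by rewrite mule_ge0// lee_fin mulr_ge0// ?wait_density_ge0// ltW// weight_gt0.
have mPhi d (T : measurableType d) (s : T -> R) (x : T -> zzE R) :
    measurable_fun setT s -> measurable_fun setT x ->
    measurable_fun setT (fun z => Phi (s z) (x z)).
  move=> ms mx; apply: emeasurable_funM.
    apply/measurable_EFinP; apply: measurable_funM.
      exact: (measurableT_comp measurable_weight mx).
    exact: measurable_wait_density.
  apply: (measurableT_comp mv); apply: measurable_fun_pair.
    by apply: measurable_funB => //; exact: measurable_cst.
  exact: measurable_turn.
transitivity (\int[ref]_x \int[mu]_s Phi s x).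
  apply: eq_integral => x _; rewrite /jump_op -ge0_integralZl//; last 3 first.
  - exact: measurable_jump_opand1.
  - by move=> s _; rewrite mule_ge0// lee_fin wait_density_ge0.
  - by rewrite lee_fin ltW// weight_gt0.
  by apply: eq_integral => s _; rewrite /Phi (EFinM (weight x)) -!muleA.
have mf : measurable_fun setT (fun z : zzE R * R => Phi z.2 z.1) by exact: mPhi.
transitivity (\int[mu]_s \int[ref]_x Phi s x).
  exact: (fubini_tonelli (m1 := ref) (m2 := mu) _ mf (fun z => Phi0 _ _)).
pose g (s : R) : \bar R := \int[ref]_x
  ((jump_flux x * surv s x)%:E * v (t - s, x)%R).
have mgf : measurable_fun setT (fun z : R * zzE R =>
    (jump_flux z.2 * surv z.1 z.2)%:E * v (t - z.1, z.2)%R).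
  apply: emeasurable_funM.
    apply/measurable_EFinP; apply: measurable_funM; last exact: measurable_surv.
    exact: (measurableT_comp measurable_jump_flux measurable_snd).
  apply: (measurableT_comp mv); apply: measurable_fun_pair => //.
  by apply: measurable_funB => //; exact: measurable_cst.
have gf0 (z : R * zzE R) :
    0 <= (jump_flux z.2 * surv z.1 z.2)%:E * v (t - z.1, z.2)%R.
  by rewrite mule_ge0// lee_fin mulr_ge0// ?jump_flux_ge0// ltW// surv_gt0.
have mg : measurable_fun setT g.
  exact: (measurable_fun_fubini_tonelli_F (m2 := ref) _ mgf gf0).
have gZ (b : bool) s : b%:R%:E * g s = \int[ref]_x (b%:R%:E *
    ((jump_flux x * surv s x)%:E * v (t - s, x)%R)).
  rewrite ge0_integralZl//; first exact: (measurableT_comp mgf (measurable_pair1 s)).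
  by move=> x _; exact: (gf0 (s, x)).
transitivity (\int[mu]_s ((0 < s)%R%:R%:E * g s)).
  apply: eq_integral => s _; rewrite gZ.
  have mx : measurable_fun setT (Phi s) by apply: mPhi => //; exact: measurable_cst.
  transitivity (\int[ref]_x Phi s (turn s x)).
    exact/esym/(integral_turn a s mx (Phi0 s)).
  apply: eq_integral => x _; rewrite /Phi weight_wait_density turnK.
  by rewrite EFinM muleA.
rewrite integral_gt0_ge0//; apply: eq_integral => s _; rewrite gZ.
apply: eq_integral => x _; rewrite /nojump/= mule1 (EFinM (jump_flux x)) (EFinM (_ %:R)%R).
by rewrite -!muleA [LHS]muleCA.
Qed.

Lemma conv_pairing_iter t n k v : measurable_fun setT k -> measurable_fun setT v ->
  (forall m, 0 <= k m) -> (forall m, 0 <= v m) ->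
  conv_pairing t k (iter n jump_op v) = conv_pairing t (iter n jump_op k) v.
Proof.
move=> mk mv k0 v0; elim: n k mk k0 => [//|n IH] k mk k0.
have mi := measurable_iter_jump_op a lam_ge0 lam_cont n mv v0.
have i0 m : 0 <= iter n jump_op v m by exact: iter_jump_op_ge0.
rewrite iterS [LHS](conv_pairing_sym t mk mi k0 i0) iterSr.
apply: IH; first exact: measurable_jump_op.
by move=> m; exact: jump_op_ge0.
Qed.

(** For a final leg, the time of its initial jump integrates out: the hazard
    over a time t is one minus survival. *)
Lemma conv_pairing_alive t h : (0 <= t)%R -> measurable_fun setT h ->
  (forall x, 0 <= h x) ->
  conv_pairing t (@alive R) (nojump h) =
  \int[ref]_x ((weight x * (1 - surv t x))%:E * h (flip x)).
Proof.
move=> t0 mh h0.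
pose Phi (s : R) (x : zzE R) : \bar R :=
  (jump_flux x)%:E * (alive (t - s, x)%R * nojump h (s, x)).
have Phi0 s x : 0 <= Phi s x.
  rewrite mule_ge0//; first by rewrite lee_fin jump_flux_ge0.
  by rewrite mule_ge0 ?alive_ge0// nojump_ge0.
have mnh := measurable_nojump a lam_cont mh.
have mPhi d (T : measurableType d) (s : T -> R) (x : T -> zzE R) :
    measurable_fun setT s -> measurable_fun setT x ->
    measurable_fun setT (fun z => Phi (s z) (x z)).
  move=> ms mx; apply: emeasurable_funM.
    apply/measurable_EFinP; exact: (measurableT_comp measurable_jump_flux mx).
  apply: emeasurable_funM.
    apply: (measurableT_comp (@measurable_alive R)); apply: measurable_fun_pair => //.
    by apply: measurable_funB => //; exact: measurable_cst.
  by apply: (measurableT_comp mnh); exact: measurable_fun_pair.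
have mI : measurable_fun setT (fun s : R => \int[ref]_x Phi s x).
  have mf : measurable_fun setT (fun z : R * zzE R => Phi z.1 z.2) by exact: mPhi.
  exact: (measurable_fun_fubini_tonelli_F (m2 := ref) _ mf (fun z => Phi0 _ _)).
transitivity (\int[mu]_s \int[ref]_x Phi s x).
  have I0 (s : R) : 0 <= \int[ref]_x Phi s x by exact: integral_ge0.
  transitivity (\int[mu]_r \int[ref]_x Phi (t - r)%R x); last exact: (integral_reflect t mI I0).
  apply: eq_integral => r _; apply: eq_integral => x _.
  by rewrite /Phi subKr.
transitivity (\int[mu]_s \int[ref]_x Phi s (turn s x)).
  apply: eq_integral => s _.
  have mx : measurable_fun setT (Phi s) by apply: mPhi => //; exact: measurable_cst.
  exact/esym/(integral_turn a s mx (Phi0 s)).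
have mL : measurable_fun setT (fun z : R * zzE R => Phi z.1 (turn z.1 z.2)).
  by apply: mPhi => //; exact: measurable_turn.
transitivity (\int[ref]_x \int[mu]_s Phi s (turn s x)).
  exact: (fubini_tonelli (m1 := mu) (m2 := ref) _ mL (fun z => Phi0 _ _)).
apply: eq_integral => x _.
rewrite (EFinM (weight x)) muleAC -(integral_hazard a_gt0 lam_cont x t0).
rewrite -ge0_integralZl//; last 3 first.
- apply/measurable_EFinP; apply: measurable_funTS.
  by apply: continuous_measurable_fun; exact: hazard_cont.
- by move=> s _; rewrite lee_fin hazard_ge0.
- by rewrite mule_ge0// lee_fin ltW// weight_gt0.
rewrite [RHS]integral_mkcond; apply: eq_integral => s _.
rewrite patchE mem_setE in_itv/= /Phi /nojump /alive/= subr_ge0.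
case: (leP 0%R s) => s0; last by rewrite mul0r mul0e !mule0.
case: (leP s t) => st; last by rewrite mul0e !mule0.
rewrite mul1e mul1r flow_turn /jump_flux flip_turn muleA -EFinM.
by rewrite -mulrA -weight_surv [RHS]muleAC -EFinM mulrCA.
Qed.

Lemma pairing_nneseries (f : nat -> R * zzE R -> \bar R) :
  (forall n, measurable_fun setT (f n)) -> (forall n z, 0 <= f n z) ->
  \int[mu]_r \int[ref]_x (\sum_(n <oo) f n (r, x)) =
  \sum_(n <oo) \int[mu]_r \int[ref]_x f n (r, x).
Proof.
move=> mf f0; rewrite -integral_nneseries//; last 2 first.
- by move=> n; exact: (measurable_fun_fubini_tonelli_F (m2 := ref) _ (mf n)).
- by move=> n r _; exact: integral_ge0.
apply: eq_integral => r _; rewrite -integral_nneseries// => n.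
exact: (measurableT_comp (mf n) (measurable_pair1 r)).
Qed.

Lemma measurable_pairing t k v : measurable_fun setT k -> measurable_fun setT v ->
  measurable_fun setT (fun z : R * zzE R =>
    (jump_flux z.2)%:E * (k (z.1, z.2) * v (t - z.1, z.2)%R)).
Proof.
move=> mk mv; apply: emeasurable_funM.
  by apply/measurable_EFinP; exact: (measurableT_comp measurable_jump_flux).
apply: emeasurable_funM.
  by apply: (measurableT_comp mk); exact: measurable_fun_pair.
apply: (measurableT_comp mv); apply: measurable_fun_pair => //.
by apply: measurable_funB => //; exact: measurable_cst.
Qed.

(** By skew detailed balance one jump of the process is self-dual for the
    convolution pairing, so that all jumps can be moved to the left argument,
    where they sum to the conserved total mass; what is left is a process that
    makes its last jump and then flows, or makes no jump at all, and the
    probabilities of these two events add up to one. *)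
Lemma semi_invariant t h : (0 <= t)%R -> measurable_fun setT h ->
  (forall x, 0 <= h x) ->
  \int[ref]_x ((weight x)%:E * semi h (t, x)) = \int[ref]_x ((weight x)%:E * h x).
Proof.
move=> t0 mh h0.
have w0 x : 0 <= (weight x)%:E by rewrite lee_fin ltW// weight_gt0.
have mw : measurable_fun setT (fun x => (weight x)%:E).
  by apply/measurable_EFinP; exact: measurable_weight.
have mq := measurable_nojump a lam_cont mh.
have q0 m : 0 <= nojump h m by exact: nojump_ge0.
have m1 : measurable_fun setT (nojump (cst 1)).
  by apply: measurable_nojump => //; exact: measurable_cst.
have q1 m : 0 <= nojump (cst 1) m by exact: nojump_ge0.
have s0 m : 0 <= semi h m by exact: semi_ge0.
have ms : measurable_fun setT (semi h) by exact: measurable_semi.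
have mat (u : R * zzE R -> \bar R) : measurable_fun setT u ->
    measurable_fun setT (fun x => (weight x)%:E * u (t, x)).
  move=> mu_; apply: emeasurable_funM => //.
  exact: (measurableT_comp mu_ (measurable_pair1 t)).
transitivity (\int[ref]_x ((weight x)%:E * nojump h (t, x)) +
    \int[ref]_x ((weight x)%:E * jump_op (semi h) (t, x))).
  rewrite -ge0_integralD//; last 4 first.
  - by move=> x _; rewrite mule_ge0.
  - exact: mat.
  - by move=> x _; rewrite mule_ge0// jump_op_ge0.
  - by apply: mat; exact: measurable_jump_op.
  apply: eq_integral => x _; rewrite (semiE a lam_ge0 lam_cont _ mh h0).
  by rewrite [LHS]ge0_muleDr// jump_op_ge0.
rewrite (integral_first_jump t ms s0).
have i0 n m : 0 <= iter n jump_op (nojump h) m by exact: iter_jump_op_ge0.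
have i1 n m : 0 <= iter n jump_op (nojump (cst 1)) m by exact: iter_jump_op_ge0.
have mi0 n := measurable_iter_jump_op a lam_ge0 lam_cont n mq q0.
have mi1 n := measurable_iter_jump_op a lam_ge0 lam_cont n m1 q1.
have j0 x : 0 <= (jump_flux x)%:E by rewrite lee_fin jump_flux_ge0.
have -> : conv_pairing t (nojump (cst 1)) (semi h) = conv_pairing t (@alive R) (nojump h).
  transitivity (\sum_(n <oo) conv_pairing t (nojump (cst 1)) (iter n jump_op (nojump h))).
    have := @pairing_nneseries (fun n z => (jump_flux z.2)%:E *
       (nojump (cst 1) (z.1, z.2) * iter n jump_op (nojump h) (t - z.1, z.2)%R)).
    move=> <-; last 2 first.
    - by move=> n; exact: measurable_pairing (mi0 n).
    - by move=> n z; exact: mule_ge0 (j0 _) (mule_ge0 (q1 _) (i0 _ _)).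
    apply: eq_integral => r _; apply: eq_integral => x _.
    rewrite [RHS]nneseriesZl; last by move=> n _; exact: mule_ge0 (q1 _) (i0 _ _).
    by congr (_ * _); rewrite [RHS]nneseriesZl.
  transitivity (\sum_(n <oo) conv_pairing t (iter n jump_op (nojump (cst 1))) (nojump h)).
    by apply: eq_eseriesr => n _; exact: conv_pairing_iter.
  have := @pairing_nneseries (fun n z => (jump_flux z.2)%:E *
       (iter n jump_op (nojump (cst 1)) (z.1, z.2) * nojump h (t - z.1, z.2)%R)).
  move=> <-; last 2 first.
  - by move=> n; exact: measurable_pairing (mi1 n) mq.
  - by move=> n z; exact: mule_ge0 (j0 _) (mule_ge0 (i1 _ _) (q0 _)).
  apply: eq_integral => r _; apply: eq_integral => x _.
  rewrite [LHS]nneseriesZl; last by move=> n _; exact: mule_ge0 (i1 _ _) (q0 _).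
  congr (_ * _).
  under eq_eseriesr do rewrite muleC.
  rewrite [LHS]nneseries_mulel; [|exact: q0|by move=> n; exact: i1].
  by rewrite muleC -(semi_cst1 a_gt0 lam_ge0 lam_cont).
rewrite conv_pairing_alive//.
have mhf : measurable_fun setT (fun x => h (flip x)).
  by apply: (measurableT_comp mh); exact: measurable_flip.
have mst : measurable_fun setT (surv t).
  by apply: measurable_surv => //; exact: measurable_cst.
have st0 x : (0 <= 1 - surv t x)%R by rewrite subr_ge0 surv_le1.
have ww x : (0 <= weight x)%R by rewrite ltW// weight_gt0.
pose A x := (weight x * surv t x)%:E * h (flip x).
pose B x := (weight x * (1 - surv t x))%:E * h (flip x).
have A0 x : 0 <= A x.
  by apply: mule_ge0 => //; rewrite lee_fin mulr_ge0// ltW// surv_gt0.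
have B0 x : 0 <= B x by apply: mule_ge0 => //; rewrite lee_fin mulr_ge0.
have mA : measurable_fun setT A.
  apply: emeasurable_funM => //; apply/measurable_EFinP.
  exact: (measurable_funM measurable_weight mst).
have mB : measurable_fun setT B.
  apply: emeasurable_funM => //; apply/measurable_EFinP.
  apply: (measurable_funM measurable_weight).
  by apply: measurable_funB => //; exact: measurable_cst.
have AE : \int[ref]_x ((weight x)%:E * nojump h (t, x)) = \int[ref]_x A x.
  transitivity (\int[ref]_x ((weight (turn t x))%:E * nojump h (t, turn t x))).
    exact/esym/(integral_turn a t (mat _ mq) (fun x => mule_ge0 (w0 x) (q0 (t, x)))).
  have E x : (weight x * surv t x)%R = (weight (turn t x) * surv t (turn t x))%R.
    exact: weight_surv.
  by apply: eq_integral => x _; rewrite nojumpE// flow_turn /A E EFinM muleA.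
transitivity (\int[ref]_x A x + \int[ref]_x B x); first by rewrite AE.
transitivity (\int[ref]_x (A x + B x)).
  exact/esym/(ge0_integralD ref measurableT (fun x _ => A0 x) mA (fun x _ => B0 x) mB).
have mwh : measurable_fun setT (fun x => (weight x)%:E * h x) by exact: emeasurable_funM.
transitivity (\int[ref]_x ((weight (turn 0 x))%:E * h (turn 0 x))).
  apply: eq_integral => x _; rewrite /turn flow0 weight_flip /A /B -ge0_muleDl.
  - by congr (_ * _); rewrite -EFinD; congr EFin; ring.
  - by rewrite lee_fin mulr_ge0// ltW// surv_gt0.
  - by rewrite lee_fin mulr_ge0.
exact: (integral_turn a 0 mwh (fun x => mule_ge0 (w0 x) (h0 x))).
Qed.

End invariance.

(** * Lyapunov functions *)

Section lyapunov.
Context (R : realType) (a : R) (lam : zzE R -> R).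
Hypotheses (a_gt0 : 0 < a) (lam_ge0 : forall x, 0 <= lam x).
Hypothesis (lam_cont : continuous lam).
Local Notation mu := (@lebesgue_measure R).
Local Notation flow := (flow a).
Local Notation turn := (turn a).
Local Notation surv := (surv a lam).
Local Notation jump := (jump a).
Local Notation jump_op := (jump_op a lam).
Local Notation nojump := (nojump a lam).
Local Notation semi := (semi a lam).

Variables (V dV : zzE R -> R) (c K : R).
Hypotheses (V_ge0 : forall x, 0 <= V x)
  (dVE : forall j (y : R), is_derive y 1 (fun y => V (y, j)) (dV (y, j)))
  (dV_cont : forall j, continuous (fun y => dV (y, j)))
  (c_gt0 : 0 < c) (K_ge0 : 0 <= K).
Hypothesis drift : forall x,
  a * dir R x.2 * dV x + lam x * (V (flip x) - V x) <= - c * V x + K.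

(** The solution of u' = - c u + K with initial value V x. *)
Let bound (t : R) (x : zzE R) : R :=
  expR (- c * t) * V x + K / c * (1 - expR (- c * t)).

Let bound_ge0 t x : 0 <= t -> 0 <= bound t x.
Proof.
move=> t0; rewrite addr_ge0// mulr_ge0 ?expR_ge0// ?divr_ge0// ?(ltW c_gt0)//.
by rewrite subr_ge0 -[leRHS]expR0 ler_expR mulNr oppr_le0 mulr_ge0// ltW.
Qed.

Lemma measurable_V : measurable_fun setT V.
Proof.
apply: measurable_zzE => j; apply: continuous_measurable_fun.
exact: is_derive_continuous (dVE j).
Qed.

Let is_derive_flow j (y s : R) :
  is_derive s (1 : R) (fun s => y + a * dir R j * s) (a * dir R j).
Proof.
have := is_deriveD (is_derive_cst y s (1:R)) (is_deriveZ (a * dir R j) (is_derive_id s (1:R))).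
by rewrite add0r scaler1.
Qed.

Let is_derive_V_flow (x : zzE R) (s : R) :
  is_derive s (1 : R) (fun s => V (flow s x)) (dV (flow s x) * (a * dir R x.2)).
Proof.
case: x => y j; exact: (@is_derive1_comp _ (fun y => V (y, j))
  (fun s => y + a * dir R j * s) s _ _ (dVE j _) (is_derive_flow j y s)).
Qed.

Let is_derive_decay (t s : R) :
  is_derive s (1 : R) (fun s => expR (- c * (t - s))) (c * expR (- c * (t - s))).
Proof.
have h : is_derive s (1 : R) (fun s => - c * (t - s)) c.
  have := is_deriveZ (- c) (is_deriveB (is_derive_cst t s (1 : R)) (is_derive_id s (1 : R))).
  by rewrite sub0r scalerN scaler1 opprK.
have := @is_derive1_comp _ expR (fun s => - c * (t - s)) s _ _ (is_derive_expR _) h.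
by rewrite mulrC.
Qed.

Let dbound (t s : R) (x : zzE R) : R := expR (- c * (t - s)) *
  (c * V (flow s x) + dV (flow s x) * (a * dir R x.2) - K).

Let is_derive_bound (t s : R) (x : zzE R) :
  is_derive s (1 : R) (fun s => bound (t - s) (flow s x)) (dbound t s x).
Proof.
have h1 := is_deriveM (is_derive_decay t s) (is_derive_V_flow x s).
have h2 := is_deriveZ (K / c)
  (is_deriveB (is_derive_cst (1 : R) s (1 : R)) (is_derive_decay t s)).
have := is_deriveD h1 h2; move=> /is_derive_eq; apply.
rewrite /dbound /GRing.scale/= sub0r.
by field; rewrite lt0r_neq0.
Qed.

Let dbound_cont (t : R) (x : zzE R) : continuous (fun s => dbound t s x).
Proof.
have c1 : continuous (fun s => expR (- c * (t - s))).
  exact: is_derive_continuous (is_derive_decay t).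
have c2 : continuous (fun s => V (flow s x)).
  exact: is_derive_continuous (is_derive_V_flow x).
have c3 : continuous (fun s => dV (flow s x)).
  case: x {c2} => y j s; apply: (@continuous_comp _ _ _ (fun s => y + a * dir R j * s)
    (fun y => dV (y, j))); last exact: dV_cont.
  exact: (is_derive_continuous (is_derive_flow j y)).
move=> s; apply: (@continuousM _ _ (fun s => expR (- c * (t - s)))); first exact: c1.
apply: continuousB; last exact: cst_continuous.
apply: continuousD.
  by apply: (@continuousM _ _ (cst c)); [exact: cst_continuous|exact: c2].
by apply: (@continuousM _ _ _ (cst (a * dir R x.2))); [exact: c3|exact: cst_continuous].
Qed.

(** The bound is a supersolution of the renewal equation, by Dynkin's formula
    along one leg of the path. *)
Lemma semi_lyapunov t x : 0 <= t ->
  (semi (EFin \o V) (t, x) <= (expR (- c * t) * V x + K / c)%:E)%E.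
Proof.
move=> t0.
pose v (m : R * zzE R) : \bar R := (alive m * (bound m.1 m.2)%:E)%E.
have vE r y : 0 <= r -> v (r, y) = (bound r y)%:E.
  by move=> r0; rewrite /v aliveT// mul1e.
have cv : causal v by move=> m m0; rewrite /v causal_alive// mul0e.
have v0 m : (0 <= v m)%E.
  case: m => r y; have [r0|r0] := leP 0 r; last by rewrite cv.
  by rewrite vE// lee_fin bound_ge0.
have mexp : measurable_fun setT (fun m : R * zzE R => expR (- c * m.1)).
  apply: (measurableT_comp (@measurable_expR R)).
  by apply: measurable_funM => //; exact: measurable_cst.
have mv : measurable_fun setT v.
  apply: emeasurable_funM; first exact: measurable_alive.
  apply/measurable_EFinP; apply: measurable_funD.
    by apply: measurable_funM => //; exact: (measurableT_comp measurable_V).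
  apply: measurable_funM; first exact: measurable_cst.
  by apply: measurable_funB => //; exact: measurable_cst.
apply: (@le_trans _ _ (v (t, x))); last first.
  rewrite vE// lee_fin /bound lerD2l; apply: ler_piMr.
    by rewrite divr_ge0// ltW.
  by rewrite gerBl expR_ge0.
have mV : measurable_fun setT (EFin \o V).
  by apply/measurable_EFinP; exact: measurable_V.
have V0 x' : (0 <= (EFin \o V) x')%E by rewrite /= lee_fin.
apply: (@semi_le_supersolution _ a lam lam_ge0 lam_cont _ v mV V0 mv _ v0).
move=> {t t0 x} [t x]; have [t0|t0] := leP 0 t; last first.
  by rewrite causal_nojump// causal_jump_op// adde0.
rewrite vE// nojumpE//= (jump_op_itv a lam_cont _ _ cv mv).
pose f s := lam (flow s x) * surv s x * bound (t - s) (flow s x) - surv s x * dbound t s x.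
pose F s := - (surv s x * bound (t - s) (flow s x)).
have dF (s : R) : is_derive s (1 : R) F (f s).
  have := is_deriveN (is_deriveM (is_derive_surv a_gt0 lam_cont s x) (is_derive_bound t s x)).
  move=> /is_derive_eq; apply.
  by rewrite /f /GRing.scale/=; ring.
have cf : continuous f.
  move=> s; apply: (@continuousB _ _ _ (fun s => lam (flow s x) * surv s x * bound (t - s) (flow s x))).
    apply: (@continuousM _ _ (fun s => lam (flow s x) * surv s x)).
      exact: hazard_cont.
    exact: (is_derive_continuous (fun s => is_derive_bound t s x)).
  apply: (@continuousM _ _ (surv ^~ x)); first exact: surv_cont.
  exact: dbound_cont.
have key s : 0 <= s <= t ->
    lam (flow s x) * surv s x * bound (t - s) (turn s x) <= f s.
  move=> /andP[s0 st]; rewrite -subr_ge0 /f /bound /dbound.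
  have -> : (lam (flow s x) * surv s x *
      (expR (- c * (t - s)) * V (flow s x) + K / c * (1 - expR (- c * (t - s)))) -
      surv s x * (expR (- c * (t - s)) *
      (c * V (flow s x) + dV (flow s x) * (a * dir R x.2) - K)) -
      lam (flow s x) * surv s x *
      (expR (- c * (t - s)) * V (turn s x) + K / c * (1 - expR (- c * (t - s))))) =
    surv s x * expR (- c * (t - s)) * ((- c * V (flow s x) + K) -
      (a * dir R (flow s x).2 * dV (flow s x) +
       lam (flow s x) * (V (flip (flow s x)) - V (flow s x)))).
    by rewrite /turn /=; ring.
  by rewrite mulr_ge0 ?subr_ge0 ?drift// mulr_ge0 ?expR_ge0// ltW// surv_gt0.
apply: (@le_trans _ _ ((surv t x)%:E * (V (flow t x))%:E + \int[mu]_(s in `[0%R, t]) (f s)%:E)%E).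
  rewrite leeD2l//; apply: ge0_le_integral => //.
  - by move=> s _; rewrite mule_ge0// lee_fin hazard_ge0.
  - apply: measurable_funTS; apply: emeasurable_funM.
      apply/measurable_EFinP; apply: continuous_measurable_fun; exact: hazard_cont.
    have mj : measurable_fun setT (jump (t, x)).
      exact: (@measurable_jump _ _ _ _ id (cst (t, x))).
    exact: (measurableT_comp mv mj).
  - apply/measurable_EFinP; apply: measurable_funTS; exact: continuous_measurable_fun.
  - move=> s /=; rewrite in_itv/= => st; rewrite vE; last by rewrite subr_ge0; case/andP: st.
    by rewrite -EFinM lee_fin key.
rewrite (ge0_integral_FTC t0 cf dF) -EFinM -EFinD lee_fin /F.
rewrite subrr subr0 surv0 flow0 mul1r /bound !mulr0 expR0 subrr mulr0 addr0 mul1r opprK.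
by rewrite addrA addrN add0r.
Qed.

End lyapunov.

(** * Exponential decay far from the origin *)

Section decay.
Context (R : realType).

(** Gronwall: f(y) exp(k y) is nonincreasing. *)
Lemma exp_decay (f f' : R -> R) (k y0 : R) :
  (forall y : R, is_derive y (1 : R) f (f' y)) ->
  (forall y, y0 <= y -> f' y <= - k * f y) ->
  forall y, y0 <= y -> f y <= f y0 * expR (- k * (y - y0)).
Proof.
move=> df hf y y0y.
pose g y := f y * expR (k * y).
have dg (z : R) : is_derive z (1 : R) g ((f' z + k * f z) * expR (k * z)).
  have h : is_derive z (1 : R) (fun z => k * z) k.
    by have := is_deriveZ k (is_derive_id z (1 : R)); rewrite scaler1.
  have h2 := @is_derive1_comp _ expR (fun z => k * z) z _ _ (is_derive_expR _) h.
  have := is_deriveM (df z) h2; move=> /is_derive_eq; apply.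
  by rewrite /GRing.scale/=; ring.
have gy : g y <= g y0.
  apply: (@ler0_derive1_nincry _ g y0) => //.
  - move=> z; rewrite in_itv/= andbT => y0z; rewrite derive1E.
    rewrite (@derive_val _ _ _ _ _ _ _ (dg z)) mulr_le0_ge0 ?expR_ge0//.
    by have := hf z (ltW y0z); lra.
  - by apply: continuous_subspaceT; exact: is_derive_continuous dg.
have -> : f y = g y * expR (- k * y).
  by rewrite /g -mulrA -expRD mulNr subrr expR0 mulr1.
have -> : expR (- k * (y - y0)) = expR (k * y0) * expR (- k * y).
  by rewrite -expRD; congr expR; ring.
by rewrite mulrA ler_pM2r ?expR_gt0.
Qed.

End decay.

Section tails.
Context (R : realType) (a : R) (lam : zzE R -> R).
Hypotheses (a_gt0 : 0 < a) (lam_ge0 : forall x, 0 <= lam x).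
Hypothesis (lam_cont : continuous lam).
Variables (y0 M1 m1 M2 m2 : R).
Hypotheses (y0_gt0 : 0 < y0) (M1_ge0 : 0 <= M1) (M2_ge0 : 0 <= M2).
Hypotheses (Mm1 : M1 < m1) (Mm2 : M2 < m2).
Hypotheses (lam_right_minus : forall y, y0 <= y -> lam (y, false) <= M1)
  (lam_right_plus : forall y, y0 <= y -> m1 <= lam (y, true))
  (lam_left_plus : forall y, y <= - y0 -> lam (y, true) <= M2)
  (lam_left_minus : forall y, y <= - y0 -> m2 <= lam (y, false)).
Local Notation mu := (@lebesgue_measure R).
Local Notation factor := (factor a lam).
Local Notation surv := (surv a lam).
Local Notation weight := (weight a lam).

Lemma is_derive_opp (f : R -> R) (df y : R) :
  is_derive (- y) (1 : R) f df -> is_derive y (1 : R) (fun y => f (- y)) (- df).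
Proof.
move=> h; have h2 := is_deriveN (is_derive_id y (1 : R)).
have := @is_derive1_comp _ f (fun y => - y) y _ _ h h2.
by rewrite mulrN1.
Qed.

(** Moving outwards, the rate is eventually bounded below by the smaller of m1
    and m2, so that [factor] decays exponentially. *)
Lemma tail_zero_of_rates : tail_zero a lam.
Proof.
move=> [y j].
have hE t : y0 <= dir R j * y + a * t ->
    factor (flow a t (y, j)) <=
    factor (dir R j * y0, j) * expR (- (Num.min m1 m2 / a) * (dir R j * y + a * t - y0)).
  have [mm1 mm2] : Num.min m1 m2 <= m1 /\ Num.min m1 m2 <= m2.
    by split; rewrite ge_min lexx ?orbT.
  case: j => /=; rewrite ?mul1r ?mulN1r => h.
    have -> : flow a t (y, true) = (y + a * t, true) by rewrite /flow/= mulr1.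
    apply: (exp_decay (f := fun y => factor (y, true))); last exact: h.
      exact: is_derive_factor.
    move=> z y0z; rewrite ler_pM2r ?factor_gt0//= mul1r.
    by rewrite mulNr lerN2 [leRHS]mulrC ler_pM2r ?invr_gt0// (le_trans mm1)// lam_right_plus.
  have -> : flow a t (y, false) = (- (- y + a * t), false).
    by rewrite /flow/=; congr pair; ring.
  apply: (exp_decay (f := fun y => factor (- y, false))); last exact: h.
    by move=> z; apply: (is_derive_opp (f := fun y => factor (y, false))); exact: is_derive_factor.
  move=> z y0z /=; rewrite -mulNr ler_pM2r ?factor_gt0//.
  rewrite !mulNr !opprK mul1r lerN2 [leRHS]mulrC ler_pM2r ?invr_gt0// (le_trans mm2)//.
  by rewrite lam_left_minus// lerN2.
pose C := factor (dir R j * y0, j) / factor (y, j).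
pose k := Num.min m1 m2.
have k0 : 0 < k by rewrite lt_min (le_lt_trans M1_ge0)// (le_lt_trans M2_ge0).
pose D := expR (- (k / a * (dir R j * y - y0))).
apply: (@squeeze_cvgr _ _ _ _ (cst 0) (fun t => C * D * expR (- (k * t)))).
- near=> t.
  have ht : y0 <= dir R j * y + a * t.
    rewrite -lerBlDl (mulrC a) -ler_pdivrMr//; near: t; exact: nbhs_pinfty_ge.
  rewrite ltW ?surv_gt0//= /surv -mulrA /C mulrAC ler_pM2r ?invr_gt0 ?factor_gt0//.
  apply: (le_trans (hE t ht)); rewrite ler_pM2l ?factor_gt0// /D -expRD ler_expR -/k.
  by rewrite le_eqVlt; apply/orP; left; apply/eqP; field; exact: lt0r_neq0.
- exact: cvg_cst.
- rewrite -(mulr0 (C * D)); apply: cvgMr.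
  apply: (cvg_comp (fun t => k * t) (fun u => expR (- u)) _ (@cvgr_expR R)).
  exact: (gt0_cvgMry k0 cvg_id).
Unshelve. all: by end_near.
Qed.

End tails.

(** * A Lyapunov function and its drift *)

(** The exponential of the side towards which the process moves is multiplied
    by th > 1: turning back is then a gain, and far out it happens at a higher
    rate than turning away. *)
Definition lyap (R : realType) (th al1 al2 : R) (x : zzE R) : R :=
  if x.2 then th * expR (al1 * x.1) + expR (- al2 * x.1)
  else expR (al1 * x.1) + th * expR (- al2 * x.1).

Definition dlyap (R : realType) (th al1 al2 : R) (x : zzE R) : R :=
  if x.2 then th * (al1 * expR (al1 * x.1)) - al2 * expR (- al2 * x.1)
  else al1 * expR (al1 * x.1) - th * (al2 * expR (- al2 * x.1)).

Section lyap_function.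
Context (R : realType) (th al1 al2 : R).
Hypotheses (th_gt1 : 1 < th) (al1_gt0 : 0 < al1) (al2_gt0 : 0 < al2).
Local Notation V := (lyap th al1 al2).
Local Notation dV := (dlyap th al1 al2).

Lemma is_derive_expM (k y : R) :
  is_derive y (1 : R) (fun y => expR (k * y)) (k * expR (k * y)).
Proof.
have h : is_derive y (1 : R) (fun z => k * z) k.
  by have := is_deriveZ k (is_derive_id y (1 : R)); rewrite scaler1.
have := @is_derive1_comp _ expR (fun z => k * z) y _ _ (is_derive_expR _) h.
by rewrite mulrC.
Qed.

Lemma is_derive_lyap j (y : R) :
  is_derive y (1 : R) (fun y => V (y, j)) (dV (y, j)).
Proof.
have h1 := is_derive_expM al1 y; have h2 := is_derive_expM (- al2) y.
case: j; rewrite /lyap /dlyap/=.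
  by have := is_deriveD (is_deriveZ th h1) h2; move=> /is_derive_eq; apply; rewrite /GRing.scale/=; ring.
by have := is_deriveD h1 (is_deriveZ th h2); move=> /is_derive_eq; apply; rewrite /GRing.scale/=; ring.
Qed.

Lemma dlyap_cont j : continuous (fun y => dV (y, j)).
Proof.
have h (p q : R) : continuous (fun y => p * expR (al1 * y) + q * expR (- al2 * y)).
  apply: (@is_derive_continuous _ _ (fun y => p * (al1 * expR (al1 * y)) + q * (- al2 * expR (- al2 * y)))).
  move=> y; exact: (is_deriveD (is_deriveZ p (is_derive_expM al1 y)) (is_deriveZ q (is_derive_expM (- al2) y))).
case: j; rewrite /dlyap/=.
  rewrite (_ : (fun y => _) = (fun y => (th * al1) * expR (al1 * y) + (- al2) * expR (- al2 * y))) //.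
  by apply/funext => y; ring.
rewrite (_ : (fun y => _) = (fun y => al1 * expR (al1 * y) + (- (th * al2)) * expR (- al2 * y))) //.
by apply/funext => y; ring.
Qed.

Lemma lyap_lower x : expR (al1 * x.1) + expR (- al2 * x.1) <= V x.
Proof.
rewrite /lyap; have := expR_ge0 (al1 * x.1); have := expR_ge0 (- al2 * x.1).
by case: (x.2) => q0 p0; [rewrite lerD2r ler_peMl// ltW|rewrite lerD2l ler_peMl// ltW].
Qed.

Lemma lyap_upper x : V x <= th * (expR (al1 * x.1) + expR (- al2 * x.1)).
Proof.
rewrite /lyap mulrDr; have := expR_ge0 (al1 * x.1); have := expR_ge0 (- al2 * x.1).
by case: (x.2) => q0 p0; [rewrite lerD2l ler_peMl// ltW|rewrite lerD2r ler_peMl// ltW].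
Qed.

Lemma lyap_ge0 x : 0 <= V x.
Proof. by apply: le_trans (lyap_lower x); rewrite addr_ge0 ?expR_ge0. Qed.

Lemma lyap_cont : continuous V.
Proof.
have cj j : continuous (fun y => V (y, j)) := is_derive_continuous (is_derive_lyap j).
move=> [y j] A /(cj j y) hA.
exists ([set y' | A (V (y', j))], [set j]) => /=.
  by split; [exact: hA|exact: discrete_set1].
by move=> [y' j'] /= [Ay ->].
Qed.

(** Sublevel sets are bounded because exp u >= 1 + u. *)
Lemma lyap_proper x : `|x.1| <= V x * (al1^-1 + al2^-1).
Proof.
have hV := lyap_lower x.
have e1 := expR_ge1Dx (al1 * x.1); have e2 := expR_ge1Dx (- al2 * x.1).
have p0 := expR_ge0 (al1 * x.1); have q0 := expR_ge0 (- al2 * x.1).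
have V0 := lyap_ge0 x.
rewrite mulrDr ler_norml; apply/andP; split.
  have : - x.1 <= V x / al2.
    by rewrite ler_pdivlMr//; nra.
  have : 0 <= V x / al1 by rewrite divr_ge0// ltW.
  by lra.
have : x.1 <= V x / al1 by rewrite ler_pdivlMr//; nra.
have : 0 <= V x / al2 by rewrite divr_ge0// ltW.
by lra.
Qed.

Lemma lyap_norm_like : norm_like V.
Proof.
split; first exact: lyap_cont.
pose k := al1^-1 + al2^-1.
have k0 : 0 < k by rewrite addr_gt0// invr_gt0.
have hV y j : `|y| / k <= V (y, j).
  by rewrite ler_pdivrMr//; exact: (lyap_proper (y, j)).
move=> j; split; apply/cvgryPge => A.
  near=> y; apply: le_trans (hV y j); rewrite ler_pdivlMr//.
  apply: le_trans (ler_norm y); near: y; apply: nbhs_pinfty_ge; exact: num_real.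
near=> y; apply: le_trans (hV y j); rewrite ler_pdivlMr//.
have : y <= - (A * k) by near: y; apply: nbhs_ninfty_le; exact: num_real.
by rewrite lerNr => h; apply: (le_trans h); rewrite -normrN ler_norm.
Unshelve. all: by end_near. Qed.

End lyap_function.

Section exponential_tails.
Context (R : realType).
Local Notation mu := (@lebesgue_measure R).

(** By [exp_decay] on both sides f is at most a multiple of exp (- k |y|), that
    is, of an exponential density plus its mirror image. *)
Lemma integral_fin_of_log_derivative (f f' : R -> R) (k y0 : R) : 0 < k ->
  0 <= y0 ->
  (forall y : R, is_derive y (1 : R) f (f' y)) -> (forall y, 0 <= f y) ->
  (forall y, y0 <= y -> f' y <= - k * f y) ->
  (forall y, y <= - y0 -> k * f y <= f' y) ->
  (\int[mu]_y (f y)%:E < +oo)%E.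
Proof.
move=> k0 y00 df f0 hr hl.
have cf := is_derive_continuous df.
have [B B0 hB] : exists2 B : R, 0 <= B & forall y, `|y| <= y0 -> f y <= B.
  have [|c _ hc] := @EVT_max R f (- y0) y0 _ (continuous_subspaceT cf).
    by rewrite ge0_cp.
  by exists (f c) => // y yD; apply: hc; rewrite in_itv/= -ler_norml.
pose C := B * expR (k * y0).
have hf y : f y <= C * expR (- k * `|y|).
  have E z : C * expR (- k * z) = B * expR (- k * (z - y0)).
    by rewrite /C -mulrA -expRD; congr (_ * expR _); ring.
  rewrite E; have [yy0|yy0] := leP `|y| y0.
    apply: (le_trans (hB y yy0)); rewrite ler_peMr// -expR0 ler_expR.
    by rewrite mulNr oppr_ge0 pmulr_rle0// subr_le0.
  have [y1|y1] := leP 0 y.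
    rewrite ger0_norm// in yy0 *.
    apply: (le_trans (exp_decay df hr (ltW yy0))).
    by rewrite ler_pM2r ?expR_gt0// hB// ger0_norm.
  rewrite ltr0_norm// in yy0 *.
  have hl' z : y0 <= z -> - f' (- z) <= - k * f (- z).
    by move=> zy; rewrite mulNr lerN2; apply: hl; rewrite lerN2.
  have := exp_decay (fun z => is_derive_opp (df (- z))) hl' (ltW yy0).
  rewrite opprK => /le_trans; apply.
  by rewrite ler_pM2r ?expR_gt0// hB// normrN ger0_norm.
have C0 : 0 <= C by rewrite mulr_ge0// expR_ge0.
move: C C0 hf => C C0 hf.
pose e : R -> R := exponential_pdf k.
have e0 y : (0 <= (e y)%:E)%E by rewrite lee_fin exponential_pdf_ge0// ltW.
have me : measurable_fun setT (fun y => (e y)%:E).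
  by apply/measurable_EFinP; exact: measurable_exponential_pdf.
have me' : measurable_fun setT (fun y : R => (e (0 - y)%R)%:E).
  apply: (measurableT_comp me); exact: measurable_funB.
have Ck0 : 0 <= C / k by rewrite divr_ge0 ?(ltW k0).
apply: (@le_lt_trans _ _ (\int[mu]_y ((C / k)%:E * ((e y)%:E + (e (0 - y)%R)%:E)))%E).
  apply: ge0_le_integral => //.
  - by move=> y _; rewrite lee_fin.
  - by apply/measurable_EFinP; exact: continuous_measurable_fun.
  - by apply: measurable_funeM; exact: emeasurable_funD.
  move=> y _; rewrite -EFinD -EFinM lee_fin; apply: (le_trans (hf y)).
  rewrite -mulrA ler_wpM2l// [leRHS]mulrC ler_pdivlMr// [leLHS]mulrC.
  have pe z : 0 <= z -> e z = k * expR (- k * z).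
    by move=> z0; rewrite /e /exponential_pdf patchE mem_setE in_itv/= z0.
  have e0' z : 0 <= e z by rewrite -lee_fin.
  have [y1|y1] := leP 0 y.
    by rewrite ger0_norm// (pe y)// lerDl.
  by rewrite ltr0_norm// sub0r (pe (- y)) ?lerDr// oppr_ge0 ltW.
rewrite ge0_integralZl//; last 2 first.
- exact: emeasurable_funD.
- by move=> y _; rewrite adde_ge0.
rewrite ge0_integralD// (integral_reflect 0 me)//.
by rewrite integral_exponential_pdf// -EFinD -EFinM ltry.
Qed.

End exponential_tails.

Section tail_drift.
Context (R : realDomainType).
Implicit Types (p q L k M m d C : R).

Lemma tail_drift_outgoing p q L k k' m d C : 0 < p -> 0 < q -> q <= p -> m <= L ->
  d <= m - k -> m - k' <= C ->
  k * p - k' * q + L * (q - p) <= - d * p + C * q.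
Proof.
move=> p0 q0 qp mL dm mC.
have h1 : (L - m) * (q - p) <= 0 by rewrite mulr_ge0_le0 ?subr_ge0 ?subr_le0.
have h2 : 0 <= (m - k - d) * p by rewrite mulr_ge0 ?subr_ge0// ltW.
have h3 : 0 <= (C - (m - k')) * q by rewrite mulr_ge0 ?subr_ge0// ltW.
by lra.
Qed.

Lemma tail_drift_incoming p q L k k' M d C : 0 < p -> 0 < q -> q <= p -> L <= M ->
  d <= k - M -> k' - M <= C ->
  - (k * p) + k' * q + L * (p - q) <= - d * p + C * q.
Proof.
move=> p0 q0 qp LM dk kC.
have h1 : (L - M) * (p - q) <= 0 by rewrite mulr_le0_ge0 ?subr_ge0 ?subr_le0.
have h2 : 0 <= (k - M - d) * p by rewrite mulr_ge0 ?subr_ge0// ltW.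
have h3 : 0 <= (C - (k' - M)) * q by rewrite mulr_ge0 ?subr_ge0// ltW.
by lra.
Qed.

Lemma compact_drift p q L k k' (P Q B : R) : 0 < p -> 0 < q -> 0 <= L ->
  p <= P -> q <= Q -> L <= B -> 0 <= k -> 0 <= k' ->
  k * p + k' * q + L * (p + q) <= k * P + k' * Q + B * (P + Q).
Proof.
move=> p0 q0 L0 pP qQ LB k0 k0'.
have h1 : L * (p + q) <= B * (P + Q).
  by apply: ler_pM => //; rewrite ?lerD ?addr_ge0// ltW.
have h2 : k * p <= k * P by rewrite ler_wpM2l.
have h3 : k' * q <= k' * Q by rewrite ler_wpM2l.
by lra.
Qed.

End tail_drift.

Section drift.
Context (R : realType) (a : R) (lam : zzE R -> R).
Hypotheses (a_gt0 : 0 < a) (lam_ge0 : forall x, 0 <= lam x).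
Hypothesis (lam_cont : continuous lam).
Variables (y0 M1 m1 M2 m2 : R).
Hypotheses (y0_gt0 : 0 < y0) (M1_ge0 : 0 <= M1) (M2_ge0 : 0 <= M2).
Hypotheses (Mm1 : M1 < m1) (Mm2 : M2 < m2).
Hypotheses (lam_right_minus : forall y, y0 <= y -> lam (y, false) <= M1)
  (lam_right_plus : forall y, y0 <= y -> m1 <= lam (y, true))
  (lam_left_plus : forall y, y <= - y0 -> lam (y, true) <= M2)
  (lam_left_minus : forall y, y <= - y0 -> m2 <= lam (y, false)).
Local Notation mu := (@lebesgue_measure R).
Local Notation weight := (weight a lam).

Variables (k1 k2 th : R).
Hypotheses (th_gt1 : 1 < th) (Mk1 : M1 < k1) (Mk2 : M2 < k2)
  (km1 : k1 * th < m1) (km2 : k2 * th < m2).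
Let al1 := k1 * (th - 1) / a.
Let al2 := k2 * (th - 1) / a.
Local Notation V := (lyap th al1 al2).
Local Notation dV := (dlyap th al1 al2).

Let th0 : 0 < th. Proof. exact: lt_trans th_gt1. Qed.
Let k1_gt0 : 0 < k1. Proof. exact: le_lt_trans Mk1. Qed.
Let k2_gt0 : 0 < k2. Proof. exact: le_lt_trans Mk2. Qed.
Let al1_gt0 : 0 < al1. Proof. by rewrite divr_gt0// mulr_gt0// subr_gt0. Qed.
Let al2_gt0 : 0 < al2. Proof. by rewrite divr_gt0// mulr_gt0// subr_gt0. Qed.

(** Let p and q be the two exponentials. As a * al1 = k1 * (th - 1), the
    generator applied to V is (th - 1) * D with D linear in p and q. Far to the
    right p dominates, and its coefficient is at most - d in both directions:
    it is k1 * th - lam on the way out and lam - k1 on the way back. *)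
Lemma drift : exists c K : R, [/\ 0 < c, 0 <= K &
  forall x, a * dir R x.2 * dV x + lam x * (V (flip x) - V x) <= - c * V x + K].
Proof.
have Y0 : 0 < y0 := y0_gt0. have N1 : 0 <= M1 := M1_ge0. have N2 : 0 <= M2 := M2_ge0.
have T1 : 1 < th := th_gt1. have n1 : M1 < m1 := Mm1. have n2 : M2 < m2 := Mm2.
have l1 : M1 < k1 := Mk1. have l2 : M2 < k2 := Mk2.
have l3 : k1 * th < m1 := km1. have l4 : k2 * th < m2 := km2.
have [B B0 hB] := lam_bounded lam_ge0 lam_cont y0.
pose d := Num.min (Num.min (m1 - k1 * th) (k1 - M1)) (Num.min (m2 - k2 * th) (k2 - M2)).
have d0 : 0 < d by rewrite !lt_min !subr_gt0 km1 km2 Mk1 Mk2.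
have [d1 d2 d3 d4] : [/\ d <= m1 - k1 * th, d <= k1 - M1, d <= m2 - k2 * th & d <= k2 - M2].
  by split; rewrite !ge_min lexx ?orbT.
pose C := m1 + m2 + k1 * th + k2 * th.
have k1t : 0 < k1 * th by rewrite mulr_gt0.
have k2t : 0 < k2 * th by rewrite mulr_gt0.
have [C1 C2 C3 C4] : [/\ m1 - k2 <= C, k2 * th - M1 <= C, k1 * th - M2 <= C & m2 - k1 <= C].
  by split; rewrite /C; lra.
have C0 : 0 <= C by rewrite /C; lra.
pose P0 := expR (al1 * y0); pose Q0 := expR (al2 * y0).
have P00 : 0 < P0 := expR_gt0 _; have Q00 : 0 < Q0 := expR_gt0 _.
pose S := k1 * th * P0 + k2 * th * Q0 + B * (P0 + Q0) + d * (P0 + Q0).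
have S0 : 0 < S by rewrite !addr_gt0 ?mulr_gt0 ?addr_gt0.
pose K' := d + C + S.
have K'0 : 0 <= K' := addr_ge0 (addr_ge0 (ltW d0) C0) (ltW S0).
exists ((th - 1) * d / th), ((th - 1) * K'); split.
- by rewrite divr_gt0// mulr_gt0// subr_gt0.
- by rewrite mulr_ge0// subr_ge0 ltW.
move=> [y j].
set p := expR (al1 * y); set q := expR (- al2 * y).
have p0 : 0 < p := expR_gt0 _; have q0 : 0 < q := expR_gt0 _.
pose D := if j then k1 * th * p - k2 * q + lam (y, j) * (q - p)
          else - (k1 * p) + k2 * th * q + lam (y, j) * (p - q).
have -> : a * dir R j * dV (y, j) + lam (y, j) * (V (flip (y, j)) - V (y, j)) =
    (th - 1) * D.
  have E1 : a * al1 = k1 * (th - 1) by rewrite /al1 mulrC mulfVK// lt0r_neq0.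
  have E2 : a * al2 = k2 * (th - 1) by rewrite /al2 mulrC mulfVK// lt0r_neq0.
  rewrite {}/D /lyap /dlyap /flip; case: j => /=; rewrite -/p -/q.
    transitivity (th * (a * al1) * p - (a * al2) * q +
      lam (y, true) * (p + th * q - (th * p + q))); first by ring.
    by rewrite E1 E2; ring.
  transitivity (- (a * al1 * p - th * (a * al2) * q) +
      lam (y, false) * (th * p + q - (p + th * q))); first by ring.
  by rewrite E1 E2; ring.
have hV : - ((th - 1) * d * (p + q)) <= - ((th - 1) * d / th) * V (y, j).
  rewrite mulNr lerN2 mulrAC ler_pdivrMr// -!mulrA !ler_pM2l ?subr_gt0//.
  by rewrite mulrC; exact: (@lyap_upper _ _ al1 al2 th_gt1 (y, j)).
rewrite -lerBlDr; apply: le_trans hV.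
rewrite -mulrBr -mulrA -mulrN ler_pM2l ?subr_gt0//.
rewrite lerBlDr.
(* far to the right p dominates, far to the left q does *)
have tail (u v : R) : 0 < v -> v <= 1 -> D <= - d * u + C * v -> D <= - (d * (u + v)) + K'.
  move=> v0 v1 /le_trans; apply.
  have : (d + C) * v <= d + C by rewrite ler_piMr// (addr_ge0 (ltW d0) C0).
  by rewrite /K'; move: S0; lra.
have [yr|yr] := leP y0 y.
  have y1 : 0 <= y := le_trans (ltW y0_gt0) yr.
  have p1 : 1 <= p by rewrite /p -expR0 ler_expR mulr_ge0// ltW.
  have q1 : q <= 1 by rewrite /q -expR0 ler_expR mulNr oppr_le0 mulr_ge0// ltW.
  have qp := le_trans q1 p1.
  apply: tail => //; rewrite {}/D; case: j.
    exact: (tail_drift_outgoing p0 q0 qp (lam_right_plus yr) d1 C1).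
  exact: (tail_drift_incoming p0 q0 qp (lam_right_minus yr) d2 C2).
have [yl|yl] := leP y (- y0).
  have y1 : y <= 0 by rewrite (le_trans yl)// oppr_le0 ltW.
  have q1 : 1 <= q by rewrite /q -expR0 ler_expR mulNr oppr_ge0 pmulr_rle0.
  have p1 : p <= 1 by rewrite /p -expR0 ler_expR pmulr_rle0.
  have pq := le_trans p1 q1.
  rewrite (addrC p); apply: tail => //; rewrite {}/D; case: j.
    rewrite (addrC (k1 * th * p)).
    exact: (tail_drift_incoming q0 p0 pq (lam_left_plus yl) d4 C3).
  rewrite (addrC (- _)).
  exact: (tail_drift_outgoing q0 p0 pq (lam_left_minus yl) d3 C4).
have pP : p <= P0 by rewrite /p /P0 ler_expR ler_pM2l// ltW.
have qQ : q <= Q0 by rewrite /q /Q0 ler_expR mulNr -mulrN ler_pM2l// lerNl ltW.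
have L0 := lam_ge0 (y, j).
have LB : lam (y, j) <= B by apply: hB; rewrite /= ler_norml !ltW.
have h1 := compact_drift p0 q0 L0 pP qQ LB (ltW k1t) (ltW k2t).
have h2 : d * (p + q) <= d * (P0 + Q0) by rewrite ler_pM2l// lerD.
have h3 : D <= k1 * th * p + k2 * th * q + lam (y, j) * (p + q).
  clear tail LB h1; rewrite {}/D; have : 0 <= k1 * p by rewrite mulr_ge0// ltW.
  have : 0 <= k2 * q by rewrite mulr_ge0// ltW.
  have : 0 <= lam (y, j) * p by rewrite mulr_ge0 ?(ltW p0).
  have : 0 <= lam (y, j) * q by rewrite mulr_ge0 ?(ltW q0).
  have : 0 <= k1 * th * p by rewrite mulr_ge0// ltW.
  have : 0 <= k2 * th * q by rewrite mulr_ge0// ltW.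
  by move: (lam (y, j)) {L0} => L; case: j; lra.
apply: (le_trans h3); apply: (le_trans h1).
by rewrite /K' /S; move: d0 C0 h2; lra.
Qed.

Lemma is_derive_weight j (y : R) : is_derive y (1 : R) (fun y => weight (y, j))
  (- ((lam (y, true) - lam (y, false)) / a * weight (y, j))).
Proof.
have := is_deriveM (is_derive_factor a lam_cont true y) (is_derive_factor a lam_cont false y).
move=> /is_derive_eq; apply; rewrite /GRing.scale/= /weight/=.
move: (factor a lam (y, true)) (factor a lam (y, false)) => u v; ring.
Qed.

Hypotheses (gap1 : k1 * (th - 1) < m1 - M1) (gap2 : k2 * (th - 1) < m2 - M2).

(** To the right the logarithmic derivative of the weight is at most
    - (m1 - M1) / a, which beats the growth rate al1 of V, and similarly to
    the left. *)
Lemma lyap_weight_fin :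
  (\int[leb_pm R]_x ((weight x)%:E * (1 + V x)%:E) < +oo)%E.
Proof.
have Y0 : 0 < y0 := y0_gt0. have N1 : 0 <= M1 := M1_ge0. have N2 : 0 <= M2 := M2_ge0.
have T1 : 1 < th := th_gt1. have n1 : M1 < m1 := Mm1. have n2 : M2 < m2 := Mm2.
have l1 : M1 < k1 := Mk1. have l2 : M2 < k2 := Mk2.
have l3 : k1 * th < m1 := km1. have l4 : k2 * th < m2 := km2.
have l5 : k1 * (th - 1) < m1 - M1 := gap1. have l6 : k2 * (th - 1) < m2 - M2 := gap2.
have cV : continuous V by exact: lyap_cont.
have mV : measurable_fun setT V.
  by apply: (@measurable_V _ V dV) => j y; exact: is_derive_lyap.
have V0 := @lyap_ge0 _ th al1 al2 th_gt1.
pose f y := weight (y, true) * (expR (al1 * y) + expR (- al2 * y)).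
have df (y : R) : is_derive y (1 : R) f
    (weight (y, true) * (al1 * expR (al1 * y) - al2 * expR (- al2 * y))
     - (lam (y, true) - lam (y, false)) / a * f y).
  have h : is_derive y (1 : R) (fun y => expR (al1 * y) + expR (- al2 * y))
      (al1 * expR (al1 * y) + - al2 * expR (- al2 * y)).
    exact: is_deriveD (is_derive_expM al1 y) (is_derive_expM (- al2) y).
  have := is_deriveM (is_derive_weight true y) h.
  by move=> /is_derive_eq; apply; rewrite /GRing.scale/= /f; ring.
have f0 y : 0 <= f y by rewrite mulr_ge0 ?addr_ge0 ?expR_ge0// ltW// weight_gt0.
have mf : measurable_fun setT f.
  by apply: continuous_measurable_fun; exact: is_derive_continuous df.
pose k := Num.min ((m1 - M1) / a - al1) ((m2 - M2) / a - al2).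
have k0 : 0 < k.
  by rewrite lt_min -!mulrBl !divr_gt0//; lra.
have [kr kl] : k <= (m1 - M1) / a - al1 /\ k <= (m2 - M2) / a - al2.
  by split; rewrite ge_min lexx ?orbT.
have fin : (\int[mu]_y (f y)%:E < +oo)%E.
  apply: (integral_fin_of_log_derivative k0 (ltW y0_gt0) df f0) => y yy.
    have h : (m1 - M1) / a <= (lam (y, true) - lam (y, false)) / a.
      rewrite ler_pM2r ?invr_gt0//.
      by have := lam_right_plus yy; have := lam_right_minus yy; lra.
    have h1 : weight (y, true) * (al1 * expR (al1 * y) - al2 * expR (- al2 * y)) <= al1 * f y.
      rewrite /f mulrCA ler_pM2l ?weight_gt0// mulrDr lerD2l.
      have q0 := expR_ge0 (- al2 * y).
      have : 0 <= al2 * expR (- al2 * y) by rewrite mulr_ge0// ltW.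
      have : 0 <= al1 * expR (- al2 * y) by rewrite mulr_ge0// ltW.
      by lra.
    have := f0 y; move: (f y) h1 => F h1 F0.
    have h2 : (k + al1) * F <= (lam (y, true) - lam (y, false)) / a * F.
      by rewrite ler_wpM2r//; lra.
    by lra.
  have h : (m2 - M2) / a <= - ((lam (y, true) - lam (y, false)) / a).
    rewrite -mulNr ler_pM2r ?invr_gt0//.
    by have := lam_left_plus yy; have := lam_left_minus yy; lra.
  have h1 : - (al2 * f y) <= weight (y, true) * (al1 * expR (al1 * y) - al2 * expR (- al2 * y)).
    rewrite /f mulrCA -mulrN ler_pM2l ?weight_gt0// mulrDr.
    have p0 := expR_ge0 (al1 * y).
    have : 0 <= al2 * expR (al1 * y) by rewrite mulr_ge0// ltW.
    have : 0 <= al1 * expR (al1 * y) by rewrite mulr_ge0// ltW.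
    by lra.
  have := f0 y; move: (f y) h1 => F h1 F0.
  have h2 : (k + al2) * F <= - ((lam (y, true) - lam (y, false)) / a) * F.
    by rewrite ler_wpM2r//; lra.
  by lra.
have mw := measurable_weight a lam_cont.
have mfx : measurable_fun setT (fun x : zzE R => (f x.1)%:E).
  by apply/measurable_EFinP; exact: (measurableT_comp mf).
have V1 x : 1 <= V x.
  rewrite (le_trans _ (@lyap_lower _ _ al1 al2 th_gt1 x))//.
  have [y1|y1] := leP 0 x.1.
    have : 1 <= expR (al1 * x.1) by rewrite -[leLHS]expR0 ler_expR mulr_ge0// ltW.
    by have := expR_ge0 (- al2 * x.1); lra.
  have : 1 <= expR (- al2 * x.1) by rewrite -[leLHS]expR0 ler_expR mulNr oppr_ge0 pmulr_rle0// ltW.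
  by have := expR_ge0 (al1 * x.1); lra.
apply: (@le_lt_trans _ _ (\int[leb_pm R]_x ((2 * th)%:E * (f x.1)%:E))%E).
  apply: ge0_le_integral => //.
  - by move=> x _; rewrite -EFinM lee_fin mulr_ge0 ?addr_ge0// ltW// weight_gt0.
  - apply: emeasurable_funM; first exact/measurable_EFinP.
    by apply/measurable_EFinP; exact: measurable_funD.
  - exact: measurable_funeM.
  move=> x _; rewrite -!EFinM lee_fin /f.
  have -> : weight (x.1, true) = weight x by [].
  rewrite mulrCA ler_pM2l ?weight_gt0//.
  by have := @lyap_upper _ th al1 al2 th_gt1 x; have := V1 x; lra.
rewrite ge0_integralZl//; last 2 first.
- by move=> x _; rewrite lee_fin.
- by rewrite lee_fin; lra.
have -> : (\int[leb_pm R]_x (f x.1)%:E = \int[mu]_y (f y)%:E + \int[mu]_y (f y)%:E)%E.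
  rewrite integral_ref//=; last by move=> x; rewrite lee_fin.
  by rewrite ge0_integralD//; first [by move=> x _; rewrite lee_fin | exact/measurable_EFinP].
apply: lte_mul_pinfty => //; last by rewrite lte_add_pinfty.
by rewrite lee_fin; lra.
Qed.

End drift.

(** * Minorization on bounded sets *)

Section minorization.
Context (R : realType) (a : R) (lam : zzE R -> R).
Hypotheses (a_gt0 : 0 < a) (lam_ge0 : forall x, 0 <= lam x).
Hypothesis (lam_cont : continuous lam).
Local Notation mu := (@lebesgue_measure R).
Local Notation flow := (flow a).
Local Notation turn := (turn a).
Local Notation factor := (factor a lam).
Local Notation surv := (surv a lam).
Local Notation wait_density := (wait_density a lam).
Local Notation jump_op := (jump_op a lam).
Local Notation nojump := (nojump a lam).
Local Notation semi := (semi a lam).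

Lemma surv_bounded_below (D : R) : exists2 e : R, 0 < e &
  forall s x, `|x.1| <= D -> `|(flow s x).1| <= D -> e <= surv s x.
Proof.
have [D0|D0] := ltP D 0.
  by exists 1 => // s x; rewrite leNgt (lt_le_trans D0).
have bnd j : exists2 e : R, 0 < e & forall y z, `|y| <= D -> `|z| <= D ->
    e <= factor (z, j) / factor (y, j).
  have cf := is_derive_continuous (is_derive_factor a lam_cont j).
  have DD : - D <= D by rewrite ge0_cp.
  have [c _ hc] := EVT_max DD (continuous_subspaceT cf).
  have [d _ hd] := EVT_min DD (continuous_subspaceT cf).
  exists (factor (d, j) / factor (c, j)); first by rewrite divr_gt0// factor_gt0.
  move=> y z yD zD; apply: ler_pM.
  - by rewrite ltW// factor_gt0.
  - by rewrite invr_ge0 ltW// factor_gt0.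
  - by apply: hd; rewrite in_itv/= -ler_norml.
  - rewrite lef_pV2 ?posrE; [|exact: factor_gt0|exact: factor_gt0].
    by apply: hc; rewrite in_itv/= -ler_norml.
have [e1 e10 h1] := bnd true; have [e2 e20 h2] := bnd false.
exists (Num.min e1 e2); first by rewrite lt_min e10.
move=> s [y []] yD zD; rewrite ge_min.
  by rewrite (h1 y _ yD zD).
by rewrite (h2 y _ yD zD) orbT.
Qed.

Lemma jump_op_bounded_below (u : R * zzE R -> \bar R) (G : R -> \bar R) (t : R) x :
  measurable_fun setT u -> (forall m, 0 <= u m)%E ->
  measurable_fun setT G -> (forall s, 0 <= G s)%E ->
  (forall s : R, G s <= (wait_density s x)%:E * u (t - s, turn s x)%R)%E ->
  (\int[mu]_s G s <= jump_op u (t, x))%E.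
Proof.
move=> mu_ u0 mG G0 hG; apply: ge0_le_integral => //.
exact: (@measurable_jump_opand1 _ a _ lam_cont u (t, x) mu_).
Qed.

Variables (y0 m1 m2 : R).
Hypotheses (y0_gt0 : 0 < y0) (m1_gt0 : 0 < m1) (m2_gt0 : 0 < m2).
Hypotheses (lam_right_plus : forall y, y0 <= y -> m1 <= lam (y, true))
  (lam_left_minus : forall y, y <= - y0 -> m2 <= lam (y, false)).

(** The minorizing measure as a functional: Lebesgue measure on [0, 1], in the
    direction +1. *)
Definition target (h : zzE R -> \bar R) : \bar R :=
  (\int[mu]_z ((\1_(`[0%R, 1%R]) z : R)%:E * h (z, true)))%E.

Let measurable_target h : measurable_fun setT h ->
  measurable_fun setT (fun z : R => (\1_(`[0%R, 1%R]) z : R)%:E * h (z, true))%E.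
Proof.
move=> mh; apply: emeasurable_funM; first by apply/measurable_EFinP; exact: measurable_indic.
exact: (measurableT_comp mh (measurable_pair2 true)).
Qed.

Let target0 (h : zzE R -> \bar R) (z : R) : (forall x, 0 <= h x)%E ->
  (0 <= (\1_(`[0%R, 1%R]) z : R)%:E * h (z, true))%E.
Proof. by move=> h0; rewrite mule_ge0// lee_fin indicE. Qed.

(** One jump suffices: moving left, turning left of - y0 where the rate is at
    least m2, and coming back to z in [0, 1]. The waiting time is an affine
    function of z, so the density of the former bounds the density of the
    latter from below. *)
Lemma minorization_minus (L T : R) : exists2 e : R, 0 < e &
  forall t y h, t <= T -> L + 1 + 2 * y0 <= a * t -> `|y| <= L ->
  measurable_fun setT h -> (forall x, 0 <= h x)%E ->
  (e%:E * target h <= semi h (t, (y, false)))%E.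
Proof.
have [e e0 he] := surv_bounded_below (L + a * T + 1).
pose a2 := 2 * a; have a20 : 0 < a2 by rewrite mulr_gt0.
exists (a2^-1 * (m2 * e * e)).
  by rewrite !mulr_gt0// invr_gt0.
move=> t y h tT at_ yL mh h0.
have Y0 : 0 < y0 := y0_gt0. have A0 : 0 < a := a_gt0. have N2 : 0 < m2 := m2_gt0.
have L0 : 0 <= L := le_trans (normr_ge0 y) yL.
have at0 : 0 < a * t by lra.
have t0 : 0 < t by rewrite -(pmulr_rgt0 _ a_gt0).
have aT : a * t <= a * T by rewrite ler_pM2l.
move: yL; rewrite ler_norml => /andP[yL1 yL2].
rewrite (semiE a lam_ge0 lam_cont _ mh h0).
apply: (@le_trans _ _ (jump_op (semi h) (t, (y, false)))); last first.
  by rewrite leeDr// nojump_ge0.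
have ms := measurable_semi a lam_ge0 lam_cont mh h0.
pose f (z : R) := ((\1_(`[0%R, 1%R]) z : R)%:E * h (z, true))%E.
have mf : measurable_fun setT f := measurable_target mh.
have f0 z : (0 <= f z)%E by exact: target0.
have a2N : - a2 != 0 by rewrite oppr_eq0 lt0r_neq0.
rewrite /target (ge0_integral_affine (y + a * t) a2N mf f0).
rewrite normrN gtr0_norm// muleA -EFinM mulrAC mulVf ?lt0r_neq0// mul1r.
have mf' : measurable_fun setT (fun s : R => f (- a2 * s + (y + a * t))).
  apply: (measurableT_comp mf (f := f)); exact: measurable_funD.
rewrite -ge0_integralZl//; last by rewrite lee_fin !mulr_ge0// ltW.
apply: jump_op_bounded_below => //.
- by move=> m; exact: semi_ge0.
- exact: measurable_funeM.
- by move=> s; rewrite mule_ge0// lee_fin !mulr_ge0// ltW.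
move=> s; set z := - a2 * s + (y + a * t).
rewrite /f indicE mem_setE in_itv/=.
have [/andP[z0 z1]|_] := boolP (0 <= z <= 1); last first.
  rewrite mul0e mule0 mule_ge0//; first by rewrite lee_fin wait_density_ge0.
  exact: semi_ge0.
(* y - a s is the turning point *)
pose w := y - a * s.
have wE : w = (y - a * t + z) / 2 by rewrite /w /z /a2; field.
have w1 : w <= - y0 by rewrite wE; lra.
have w2 : - (L + a * t) <= w by rewrite wE; lra.
have as0 : 0 < a * s by rewrite -(subKr y (a * s)) -/w; lra.
have s0 : 0 < s by rewrite -(pmulr_rgt0 _ a_gt0).
have ast : a * s <= a * t by rewrite -(subKr y (a * s)) -/w; lra.
have st : s <= t by rewrite -(ler_pM2l a_gt0).
have F1 : flow s (y, false) = (w, false) by rewrite /flow/= /w; congr pair; ring.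
have F2 : turn s (y, false) = (w, true) by rewrite /turn F1.
have F3 : flow (t - s) (w, true) = (z, true).
  by rewrite /flow/= /w /z /a2; congr pair; ring.
rewrite mul1e F2 (semiE a lam_ge0 lam_cont _ mh h0).
apply: (@le_trans _ _ ((wait_density s (y, false))%:E * nojump h (t - s, (w, true))%R)%E); last first.
  rewrite lee_wpmul2l ?lee_fin ?wait_density_ge0// leeDl// jump_op_ge0// => m.
  exact: semi_ge0.
rewrite nojumpE ?subr_ge0// F3 muleA lee_wpmul2r// -EFinM lee_fin.
rewrite wait_density_gt0// F1.
have w3 : `|w| <= L + a * T + 1 by rewrite ler_norml; lra.
apply: ler_pM; [by rewrite mulr_ge0// ltW|exact: ltW| |].
  apply: ler_pM; [exact: ltW|exact: ltW|exact: lam_left_minus|].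
  apply: he; rewrite ?F1//= ler_norml; lra.
by apply: he; rewrite ?F3//= ler_norml; lra.
Qed.

(** A distance that leaves room for both legs of the path below. *)
Definition reach (L : R) : R := 4 * L + 4 * y0 + 2 * a + 1.

(** From the direction +1 the process is first made to jump during a unit of
    time that it spends right of y0, where the rate is at least m1; the
    one-jump path then starts from a larger bounded set. *)
Lemma minorization (L T : R) : 0 <= L -> reach L <= a * T ->
  exists2 e : R, 0 < e &
  forall x h, `|x.1| <= L -> measurable_fun setT h -> (forall x, 0 <= h x)%E ->
  (e%:E * target h <= semi h (T, x))%E.
Proof.
rewrite /reach => L0 aT.
have Y0 : 0 < y0 := y0_gt0. have A0 : 0 < a := a_gt0. have N1 : 0 < m1 := m1_gt0.
pose L' := 2 * L + y0 + a.
have [e1 e10 h1] := minorization_minus L' T.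
have [e2 e20 h2] := surv_bounded_below L'.
exists (Num.min e1 (m1 * e2 * e1)).
  by rewrite lt_min e10 !mulr_gt0.
move=> [y j] h /= yL mh h0.
have T0 : (0 <= target h)%E by apply: integral_ge0 => z _; exact: target0.
case: j; last first.
  apply: (@le_trans _ _ (e1%:E * target h)%E).
    by rewrite lee_wpmul2r// lee_fin ge_min lexx.
  by apply: h1 => //; rewrite /L'; lra.
apply: (@le_trans _ _ ((m1 * e2 * e1)%:E * target h)%E).
  by rewrite lee_wpmul2r// lee_fin ge_min lexx orbT.
rewrite (semiE a lam_ge0 lam_cont _ mh h0).
apply: (@le_trans _ _ (jump_op (semi h) (T, (y, true)))); last first.
  by rewrite leeDr// nojump_ge0.
have ms := measurable_semi a lam_ge0 lam_cont mh h0.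
pose s1 := (L + y0) / a.
have as1 : a * s1 = L + y0 by rewrite mulrC divfK// lt0r_neq0.
have s10 : 0 < s1 by rewrite divr_gt0//; lra.
pose c := ((m1 * e2 * e1)%:E * target h)%E.
have c0 : (0 <= c)%E by rewrite mule_ge0// lee_fin !mulr_ge0// ltW.
apply: (@le_trans _ _ (\int[mu]_s ((\1_(`[s1, s1 + 1]) s)%:E * c))%E).
  have mi : measurable_fun setT (fun s : R => (\1_(`[s1, s1 + 1]) s : R)%:E).
    by apply/measurable_EFinP; exact: measurable_indic.
  have i0 (s : R) : setT s -> (0 <= (\1_(`[s1, s1 + 1]) s : R)%:E)%E.
    by rewrite lee_fin indicE.
  have -> : (\int[mu]_s ((\1_(`[s1, s1 + 1]) s)%:E * c) =
      \int[mu]_s (\1_(`[s1, s1 + 1]) s)%:E * c)%E.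
    exact: (ge0_integralZr mu measurableT mi i0 c0).
  rewrite integral_indic// setIT.
  have E : mu `[s1, s1 + 1]%classic = 1%E.
    rewrite lebesgue_measure_itv/= lte_fin ltrDl ltr01.
    by rewrite -EFinD addrAC subrr add0r.
  by move: E => /= ->; rewrite mul1e.
apply: jump_op_bounded_below => //.
- by move=> m; exact: semi_ge0.
- apply: emeasurable_funM; last exact: measurable_cst.
  by apply/measurable_EFinP; exact: measurable_indic.
- by move=> s; rewrite mule_ge0// lee_fin indicE.
move=> s; rewrite indicE mem_setE in_itv/=.
have [/andP[ss1 ss2]|_] := boolP (s1 <= s <= s1 + 1); last first.
  rewrite mul0e mule_ge0//; first by rewrite lee_fin wait_density_ge0.
  exact: semi_ge0.
have s0 : 0 < s by lra.
have F1 : flow s (y, true) = (y + a * s, true) by rewrite /flow/= mulr1.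
have F2 : turn s (y, true) = (y + a * s, false) by rewrite /turn F1.
have as2 : a * s1 <= a * s by rewrite ler_pM2l.
have as3 : a * s <= a * s1 + a by rewrite -[X in _ + X]mulr1 -mulrDr ler_pM2l.
move: yL; rewrite ler_norml => /andP[y1 y2].
have yl' : `|y + a * s| <= L' by rewrite /L' ler_norml; lra.
rewrite mul1e /c EFinM -muleA F2; apply: lee_pmul.
- by rewrite lee_fin mulr_ge0// ltW.
- by rewrite mule_ge0// lee_fin ltW.
- rewrite lee_fin wait_density_gt0// F1; apply: ler_pM; [exact: ltW|exact: ltW| |].
    by apply: lam_right_plus; lra.
  by apply: h2; rewrite ?F1//= /L' ler_norml; lra.
- apply: h1 => //; first by lra.
  by rewrite mulrBr /L'; lra.
Qed.

End minorization.

(** * Harris' theorem *)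

Section growth.
Context d (T : measurableType d) (R : realType).
Variable V : T -> R.
Hypotheses (mV : measurable_fun setT V) (V0 : forall x, 0 <= V x).
Implicit Types (m : probability T R) (phi : T -> R).

Lemma integrable_growth m phi (C : R) : (\int[m]_x (V x)%:E < +oo)%E ->
  measurable_fun setT phi -> (forall x, `|phi x| <= C * (1 + V x)) ->
  m.-integrable setT (EFin \o phi).
Proof.
move=> fin mphi hphi.
have iV : m.-integrable setT (EFin \o V).
  apply/integrableP; split; first exact/measurable_EFinP.
  by under eq_integral do rewrite /= ger0_norm//.
have i1 : m.-integrable setT (EFin \o cst (1 : R)).
  by apply: finite_measure_integrable_cst.
have iG : m.-integrable setT (fun x => C%:E * ((1 : R)%:E + (V x)%:E))%E.
  by apply: integrableZl => //; exact: integrableD.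
apply: le_integrable iG => //; first exact/measurable_EFinP.
by move=> x _; rewrite /= lee_fin (le_trans (hphi x))// ler_norm.
Qed.

Lemma Rintegral_growth m phi (C v : R) : 0 <= C ->
  (\int[m]_x (V x)%:E <= v%:E)%E ->
  measurable_fun setT phi -> (forall x, `|phi x| <= C * (1 + V x)) ->
  `|\int[m]_x phi x| <= C * (1 + v).
Proof.
move=> C0 hv mphi hphi; have fin := le_lt_trans hv (ltry _).
have iphi := integrable_growth fin mphi hphi.
rewrite -lee_fin -abse_EFin [in leLHS]/Rintegral fineK; last exact: integrable_fin_num.
apply: (le_trans (le_abse_integral _ _ _)) => //; first exact/measurable_EFinP.
apply: (@le_trans _ _ (\int[m]_x (C%:E * ((1 : R)%:E + (V x)%:E)))%E).
  apply: ge0_le_integral => //.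
  - by apply/measurable_EFinP; exact: measurableT_comp.
  - by apply: measurable_funeM; apply: emeasurable_funD => //; exact/measurable_EFinP.
  - by move=> x _; rewrite -EFinD -EFinM /= lee_fin.
rewrite ge0_integralZl//; last 2 first.
- by apply: emeasurable_funD => //; exact/measurable_EFinP.
- by move=> x _; rewrite -EFinD lee_fin addr_ge0.
rewrite ge0_integralD//; [|by move=> x _; rewrite lee_fin|exact/measurable_EFinP].
have -> : (\int[m]_x (1%:E : \bar R) = 1)%E.
  by rewrite integral_cst// mul1e; exact: probability_setT.
by rewrite EFinM lee_wpmul2l// EFinD leeD2l.
Qed.

End growth.

Section signed_mixture.
Context d (T : measurableType d) (R : realType).
Variables (m m' : probability T R) (k : T -> probability T R).
Hypothesis mk : forall A, measurable A -> measurable_fun setT (k ^~ A).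

Lemma measurable_Rintegral_kernel (phi : T -> R) : measurable_fun setT phi ->
  measurable_fun setT (fun x => \int[k x]_y phi y).
Proof.
move=> mphi; apply: (measurableT_comp (f := @fine R)) => //.
under eq_fun do rewrite integralE.
have mphiE : measurable_fun setT (EFin \o phi) by exact/measurable_EFinP.
apply: emeasurable_funB; apply: (measurable_integral_mixand (k := k)) => //.
- exact: measurable_funepos.
- exact: measurable_funeneg.
Qed.

Hypothesis mixE : forall h : T -> \bar R, measurable_fun setT h ->
  (forall x, 0 <= h x)%E -> (\int[m']_x h x = \int[m]_x \int[k x]_y h y)%E.

Lemma Rintegral_mixture (phi : T -> R) :
  (forall x, (k x).-integrable setT (EFin \o phi)) ->
  m'.-integrable setT (EFin \o phi) ->
  \int[m']_x phi x = \int[m]_x \int[k x]_y phi y.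
Proof.
move=> ik im'.
have mphi : measurable_fun setT (EFin \o phi) by exact: measurable_int im'.
have mp := measurable_funepos mphi; have mn := measurable_funeneg mphi.
have part (h : T -> \bar R) : measurable_fun setT h -> (forall x, 0 <= h x)%E ->
    m'.-integrable setT h -> m.-integrable setT (fun x => \int[k x]_y h y)%E.
  move=> mh h0 ih; apply/integrableP; split.
    exact: measurable_integral_mixand.
  rewrite (eq_integral (fun x => \int[k x]_y h y)%E); last first.
    by move=> x _; rewrite gee0_abs//; exact: integral_ge0.
  rewrite -mixE//.
  by have /integrableP[_] := ih; rewrite (eq_integral h)// => x _; rewrite gee0_abs.
rewrite {1}/Rintegral [X in fine X]integralE !mixE//.
rewrite -integralB//; last 2 first.
- by apply: part => //; exact: integrable_funepos.
- by apply: part => //; exact: integrable_funeneg.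
congr fine; apply: eq_integral => x _.
by rewrite -integralE /Rintegral fineK// (integrable_fin_num _ (ik x)).
Qed.

End signed_mixture.

Section harris_contraction.
Context d (T : measurableType d) (R : realType).
Variables (k : T -> probability T R) (nu : {measure set T -> \bar R}) (V : T -> R).
Hypotheses (mV : measurable_fun setT V) (V0 : forall x, 0 <= V x).
Hypothesis nu1 : nu setT = 1%E.
Variables (g K e Rr : R).
Hypotheses (g_ge0 : 0 <= g) (g_lt1 : g < 1) (K_ge0 : 0 <= K) (e_gt0 : 0 < e)
  (Rr_gt0 : 0 < Rr) (hRr : 2 * K < (1 - g) * Rr).
Hypothesis drift : forall x, (\int[k x]_y (V y)%:E <= (g * V x + K)%:E)%E.
Hypothesis minor : forall x, V x <= Rr -> forall h : T -> \bar R,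
  measurable_fun setT h -> (forall x, 0 <= h x)%E ->
  (e%:E * \int[nu]_y h y <= \int[k x]_y h y)%E.

(** The argument of Hairer and Mattingly. After subtraction of a constant, phi
    is bounded by l (1 + b V), and the drift condition bounds the difference of
    its two averages up to the constant 2 b K l. If V x + V y is large, the
    factor g < 1 absorbs this constant. Otherwise both kernels dominate e nu,
    on which phi contributes the same amount to both averages; this gains
    2 e l, which exceeds 2 b K l for small b. *)
Lemma harris_contraction : exists b al : R, [/\ 0 < b <= 1, 0 < al < 1 &
  forall (phi : T -> R) (l C : R), 0 <= l -> measurable_fun setT phi ->
  (forall x, `|phi x| <= C * (1 + V x)) ->
  (forall x y, phi x - phi y <= l * (2 + b * (V x + V y))) ->
  forall x y, \int[k x]_z phi z - \int[k y]_z phi z <=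
    al * (l * (2 + b * (V x + V y)))].
Proof.
have G0 : 0 <= g := g_ge0. have G1 : g < 1 := g_lt1. have KK : 0 <= K := K_ge0.
have E0 : 0 < e := e_gt0. have RR : 0 < Rr := Rr_gt0. have HR : 2 * K < (1 - g) * Rr := hRr.
have K1 : 0 < 2 * K + 1 by lra.
(* b is small enough for the noise 2 b K of the drift to be at most e *)
pose b := Num.min 1 (e / (2 * K + 1)).
have b0 : 0 < b by rewrite lt_min ltr01 divr_gt0.
have b1 : b <= 1 by rewrite ge_min lexx.
have bK : 2 * K * b <= e.
  have : b <= e / (2 * K + 1) by rewrite ge_min lexx orbT.
  rewrite ler_pdivlMr// => h; apply: le_trans h; rewrite mulrC ler_pM2l//.
  by lra.
pose eta := (1 - g) * Rr - 2 * K.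
have eta0 : 0 < eta by rewrite subr_gt0.
have bR : 0 < 2 + b * Rr by have := mulr_gt0 b0 RR; lra.
(* 1 - a3 is the ratio that the drift alone yields at V x + V y = Rr *)
pose a3 := b * eta / (2 + b * Rr).
have a3E : a3 * (2 + b * Rr) = b * eta by rewrite /a3 divfK// lt0r_neq0.
have a30 : 0 < a3 by rewrite divr_gt0// mulr_gt0.
have a3g : a3 <= 1 - g.
  rewrite -(ler_pM2r bR) a3E /eta mulrDr.
  have : b * (2 * K) >= 0 by rewrite !mulr_ge0// ltW.
  have := mulrA (1 - g) b Rr; have := mulrCA b (1 - g) Rr; lra.
pose al := Num.max (1 / 2) (Num.max (Num.max g (1 - e / 2)) (1 - a3)).
have al1 : al < 1.
  rewrite !gt_max G1 !ltrBlDr !ltrDl a30 divr_gt0// !andbT.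
  by rewrite ltr_pdivrMr ?mul1r ?ltr1n.
have [al0 alg ale al3] : [/\ 1 / 2 <= al, g <= al, 1 - e / 2 <= al & 1 - a3 <= al].
  by split; rewrite !le_max lexx ?orbT.
exists b, al; split; [by rewrite b0|by rewrite al1 andbT; lra|].
move=> phi l C l0 mphi hphi hl y x.
(* the constant c centres phi between - l (1 + b V) and l (1 + b V) *)
pose G z := 1 + b * V z.
pose S := [set phi z - l * G z | z in [set: T]].
have SE z w : phi z - l * G z <= phi w + l * G w.
  have := hl z w; rewrite /G.
  have -> : l * (2 + b * (V z + V w)) = l * (1 + b * V z) + l * (1 + b * V w) by ring.
  by lra.
pose c := sup S.
have hS z : phi z - l * G z <= c.
  apply: ub_le_sup; last by exists z.
  by exists (phi x + l * G x) => _ [w _ <-]; exact: SE.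
have hI z : c <= phi z + l * G z.
  apply: ge_sup; first by exists (phi x - l * G x); exists x.
  by move=> _ [w _ <-]; exact: SE.
pose f1 z := l * G z - phi z + c; pose f2 z := l * G z + phi z - c.
have f10 z : 0 <= f1 z by rewrite /f1; have := hS z; lra.
have f20 z : 0 <= f2 z by rewrite /f2; have := hI z; lra.
have mG : measurable_fun setT G by apply: measurable_funD => //; exact: measurable_funM.
have mlG : measurable_fun setT (fun z => l * G z) by exact: measurable_funM.
have mf1 : measurable_fun setT f1.
  by apply: measurable_funD => //; exact: measurable_funB.
have mf2 : measurable_fun setT f2.
  by apply: measurable_funB => //; exact: measurable_funD.
have iV z : (k z).-integrable setT (EFin \o V).
  apply: (@integrable_growth _ _ _ _ mV V0 (k z) V 1) => //.
    exact: le_lt_trans (drift z) (ltry _).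
  by move=> w; rewrite ger0_norm// mul1r lerDr.
have iphi z : (k z).-integrable setT (EFin \o phi).
  apply: (@integrable_growth _ _ _ _ mV V0 (k z) phi C) => //.
  exact: le_lt_trans (drift z) (ltry _).
have ic (r : R) z : (k z).-integrable setT (EFin \o cst r).
  exact: finite_measure_integrable_cst.
have ibV z : (k z).-integrable setT (EFin \o (fun w => b * V w)).
  exact: (integrableZl measurableT b (iV z)).
have iG z : (k z).-integrable setT (EFin \o G).
  exact: (integrableD measurableT (ic 1 z) (ibV z)).
have ilG z : (k z).-integrable setT (EFin \o (fun z => l * G z)).
  exact: (integrableZl measurableT l (iG z)).
have cE (r : R) z : \int[k z]_w r = r.
  by rewrite Rintegral_cst// [X in _ * fine X]probability_setT mulr1.
have bVle z : \int[k z]_w (l * G w) <= l * (1 + b * (g * V z + K)).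
  rewrite (RintegralZl _ _ (iG z))// ler_wpM2l// (RintegralD _ (ic 1 z) (ibV z))//.
  rewrite cE lerD2l (RintegralZl _ _ (iV z))// ler_pM2l//.
  rewrite -lee_fin /Rintegral fineK ?(integrable_fin_num measurableT (iV z))//.
  exact: drift.
have id1 z : (k z).-integrable setT (EFin \o (fun z => l * G z - phi z)).
  exact: (integrableB measurableT (ilG z) (iphi z)).
have id2 z : (k z).-integrable setT (EFin \o (fun z => l * G z + phi z)).
  exact: (integrableD measurableT (ilG z) (iphi z)).
have if1 z : (k z).-integrable setT (EFin \o f1).
  exact: (integrableD measurableT (id1 z) (ic c z)).
have if2 z : (k z).-integrable setT (EFin \o f2).
  exact: (integrableB measurableT (id2 z) (ic c z)).
have I1 z : \int[k z]_w f1 w = \int[k z]_w (l * G w) - \int[k z]_w phi w + c.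
  by rewrite (RintegralD _ (id1 z) (ic c z))// cE (RintegralB _ (ilG z) (iphi z)).
have I2 z : \int[k z]_w f2 w = \int[k z]_w (l * G w) + \int[k z]_w phi w - c.
  by rewrite (RintegralB _ (id2 z) (ic c z))// cE (RintegralD _ (ilG z) (iphi z)).
have p1 z : 0 <= \int[k z]_w f1 w by apply: Rintegral_ge0.
have p2 z : 0 <= \int[k z]_w f2 w by apply: Rintegral_ge0.
have small : V x <= Rr -> V y <= Rr ->
    2 * e * l <= \int[k y]_w f1 w + \int[k x]_w f2 w.
  move=> xR yR; rewrite -lee_fin EFinD /Rintegral !fineK ?(integrable_fin_num measurableT (if1 y)) ?(integrable_fin_num measurableT (if2 x))//.
  have h1 := minor yR (h := EFin \o f1) (proj2 (measurable_EFinP _ _) mf1) (fun z => f10 z).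
  have h2 := minor xR (h := EFin \o f2) (proj2 (measurable_EFinP _ _) mf2) (fun z => f20 z).
  apply: le_trans (leeD h1 h2).
  rewrite -ge0_muleDr; try (by apply: integral_ge0 => z _; rewrite lee_fin).
  rewrite -ge0_integralD//; try (by move=> z _; rewrite lee_fin); try exact/measurable_EFinP.
  rewrite mulrAC mulrC EFinM lee_wpmul2l ?lee_fin ?(ltW E0)//.
  rewrite -[leLHS]mule1.
  have <- : (\int[nu]_z ((2 * l)%:E : \bar R) = (2 * l)%:E * 1)%E.
    by rewrite integral_cst// nu1.
  apply: ge0_le_integral => //.
  - by move=> z _; rewrite lee_fin mulr_ge0.
  - by apply: emeasurable_funD; exact/measurable_EFinP.
  move=> z _; rewrite /= -EFinD lee_fin /f1 /f2 /G.
  have : 0 <= l * (b * V z) by rewrite !mulr_ge0// ltW.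
  by lra.
move: (p1 x) (p2 y) small (p1 y) (p2 x) (bVle x) (bVle y).
rewrite !I1 !I2.
move: (\int[k x]_w phi w) (\int[k y]_w phi w) (\int[k x]_w (l * G w)) (\int[k y]_w (l * G w)).
move=> px py Gx Gy p1x p2y small p1y p2x hx hy.
pose s := V x + V y; have s0 : 0 <= s by rewrite addr_ge0.
rewrite (addrC (V y)) -/s [leRHS]mulrCA.
have bs0 : 0 <= b * s by rewrite mulr_ge0// ltW.
have hxy : Gx + Gy <= l * (2 + b * g * s + 2 * K * b).
  have -> : l * (2 + b * g * s + 2 * K * b) =
    l * (1 + b * (g * V x + K)) + l * (1 + b * (g * V y + K)) by rewrite /s; ring.
  by lra.
have [/andP[xR yR]|] := boolP ((V x <= Rr) && (V y <= Rr)).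
  have := small xR yR => h.
  apply: (@le_trans _ _ (l * (2 + b * g * s + 2 * K * b - 2 * e))).
    by rewrite mulrBr; lra.
  rewrite ler_wpM2l//.
  have : 0 <= (al - g) * (b * s) by rewrite mulr_ge0// subr_ge0.
  by lra.
rewrite negb_and -!ltNge => h.
have sR : Rr <= s by case/orP: h => h; rewrite /s; have := V0 x; have := V0 y; lra.
apply: (@le_trans _ _ (l * (2 + b * g * s + 2 * K * b))); first by lra.
rewrite ler_wpM2l//.
have h1 : 0 <= (al - (1 - a3)) * (2 + b * s) by rewrite mulr_ge0// ?subr_ge0//; lra.
have h2 : 0 <= (1 - g - a3) * (b * (s - Rr)).
  by rewrite !mulr_ge0 ?subr_ge0// ltW.
have h3 : b * eta = b * ((1 - g) * Rr) - 2 * K * b by rewrite /eta; ring.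
by lra.
Qed.


End harris_contraction.

Section exponential_ergodicity.
Context d (T : measurableType d) (R : realType).
Variables (Q : R -> T -> probability T R) (mu : probability T R) (V : T -> R).
Hypotheses (mV : measurable_fun setT V) (V0 : forall x, 0 <= V x).
Hypothesis measurable_Q : forall t A, 0 <= t -> measurable A ->
  measurable_fun setT (fun x => Q t x A).
Hypothesis chapman_kolmogorov : forall (s t : R) x (h : T -> \bar R),
  0 <= s -> 0 <= t -> measurable_fun setT h -> (forall x, 0 <= h x)%E ->
  (\int[Q (s + t)%R x]_z h z = \int[Q s x]_z \int[Q t z]_w h w)%E.
Hypothesis invariant : forall (t : R) (h : T -> \bar R),
  0 <= t -> measurable_fun setT h -> (forall x, 0 <= h x)%E ->
  (\int[mu]_z h z = \int[mu]_z \int[Q t z]_w h w)%E.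
Variables (c K : R).
Hypotheses (c_gt0 : 0 < c) (K_ge0 : 0 <= K).
Hypothesis lyapunov : forall (t : R) x, 0 <= t ->
  (\int[Q t x]_z (V z)%:E <= (expR (- c * t) * V x + K)%:E)%E.
Hypothesis muV : (\int[mu]_z (V z)%:E < +oo)%E.
Variables (t0 e Rr : R) (nu : {measure set T -> \bar R}).
Hypothesis nu1 : nu setT = 1%E.
Hypotheses (t0_gt0 : 0 < t0) (e_gt0 : 0 < e) (Rr_gt0 : 0 < Rr).
Hypothesis Rr_large : 2 * K < (1 - expR (- c * t0)) * Rr.
Hypothesis minor : forall x, V x <= Rr -> forall h : T -> \bar R,
  measurable_fun setT h -> (forall x, 0 <= h x)%E ->
  (e%:E * \int[nu]_y h y <= \int[Q t0 x]_y h y)%E.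

Implicit Types (s t : R) (phi : T -> R) (x : T).

Let U (t : R) (phi : T -> R) (x : T) : R := \int[Q t x]_z phi z.

Let QV_fin t x : 0 <= t -> (\int[Q t x]_z (V z)%:E < +oo)%E.
Proof. by move=> t_ge0; exact: le_lt_trans (lyapunov x t_ge0) (ltry _). Qed.

Let U_growth t phi (C : R) x : 0 <= t -> 0 <= C -> measurable_fun setT phi ->
  (forall x, `|phi x| <= C * (1 + V x)) -> `|U t phi x| <= C * (1 + K) * (1 + V x).
Proof.
move=> t_ge0 C0 mphi hphi.
apply: (le_trans (Rintegral_growth mV V0 C0 (lyapunov x t_ge0) mphi hphi)).
rewrite -mulrA ler_wpM2l//.
have g1 : expR (- c * t) <= 1.
  by rewrite -[leRHS]expR0 ler_expR mulNr oppr_le0 mulr_ge0// ltW.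
have h1 : 0 <= (1 - expR (- c * t)) * V x by rewrite mulr_ge0// subr_ge0.
have h2 : 0 <= K * V x by rewrite mulr_ge0.
have KK : 0 <= K := K_ge0.
by have := V0 x; lra.
Qed.

Let measurable_U t phi : 0 <= t -> measurable_fun setT phi ->
  measurable_fun setT (U t phi).
Proof.
move=> t_ge0 mphi; apply: measurable_Rintegral_kernel => // A mA.
exact: measurable_Q.
Qed.

Let U_semigroup s t phi (C : R) x : 0 <= s -> 0 <= t -> measurable_fun setT phi ->
  (forall x, `|phi x| <= C * (1 + V x)) -> U (s + t) phi x = U s (U t phi) x.
Proof.
move=> s0 t_ge0 mphi hphi; apply: Rintegral_mixture.
- by move=> A mA; exact: measurable_Q.
- by move=> h mh h0; exact: chapman_kolmogorov.
- by move=> z; exact: (integrable_growth mV V0 (QV_fin z t_ge0) mphi hphi).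
- exact: (integrable_growth mV V0 (QV_fin x (addr_ge0 s0 t_ge0)) mphi hphi).
Qed.

Let mu_U t phi (C : R) : 0 <= t -> measurable_fun setT phi ->
  (forall x, `|phi x| <= C * (1 + V x)) -> \int[mu]_x phi x = \int[mu]_x U t phi x.
Proof.
move=> t_ge0 mphi hphi; apply: Rintegral_mixture.
- by move=> A mA; exact: measurable_Q.
- by move=> h mh h0; exact: invariant.
- by move=> z; exact: (integrable_growth mV V0 (QV_fin z t_ge0) mphi hphi).
- exact: (integrable_growth mV V0 muV mphi hphi).
Qed.

Let average_gap (f : T -> R) (p A B C : R) : measurable_fun setT f ->
  (forall x, `|f x| <= C * (1 + V x)) ->
  (forall y, `|p - f y| <= A + B * V y) ->
  `|p - \int[mu]_y f y| <= A + B * \int[mu]_y V y.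
Proof.
move=> mf hf hp.
have iV : mu.-integrable setT (EFin \o V).
  apply: (integrable_growth mV V0 muV mV (C := 1)) => x.
  by rewrite ger0_norm// mul1r lerDr.
have i_f := integrable_growth mV V0 muV mf hf.
have iB : mu.-integrable setT (EFin \o (fun y => B * V y)).
  exact: (integrableZl measurableT B iV).
have ic (r : R) : mu.-integrable setT (EFin \o cst r).
  exact: finite_measure_integrable_cst.
have cE (r : R) : \int[mu]_w r = r.
  by rewrite Rintegral_cst// [X in _ * fine X]probability_setT mulr1.
have up : \int[mu]_y f y <= p + A + B * \int[mu]_y V y.
  have -> : p + A + B * \int[mu]_y V y = \int[mu]_y (p + A + B * V y).
    by rewrite (RintegralD _ (ic (p + A)) iB)// cE RintegralZl.
  apply: le_Rintegral => //; first exact: (integrableD measurableT (ic (p + A)) iB).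
  by move=> y _; have := hp y; rewrite ler_norml; lra.
have lo : p - A - B * \int[mu]_y V y <= \int[mu]_y f y.
  have -> : p - A - B * \int[mu]_y V y = \int[mu]_y (p - A - B * V y).
    by rewrite (RintegralB _ (ic (p - A)) iB)// cE RintegralZl.
  apply: le_Rintegral => //; first exact: (integrableB measurableT (ic (p - A)) iB).
  by move=> y _; have := hp y; rewrite ler_norml; lra.
by rewrite ler_norml; lra.
Qed.

(** The contraction is iterated along multiples of t0, starting from the
    semigroup at the remaining time r, so that no continuity in time is
    needed. Averaging the second argument over mu turns the oscillation into
    the distance to equilibrium. *)
Lemma exponential_ergodicity : exists rho kappa : R,
  [/\ 0 < rho < 1, 0 < kappa & forall (t : R) x phi, 0 <= t ->
    measurable_fun setT phi -> (forall x, `|phi x| <= 1 + V x) ->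
    `|\int[Q t x]_z phi z - \int[mu]_z phi z| <= kappa * (1 + V x) * rho `^ t].
Proof.
have T0 : 0 < t0 := t0_gt0. have KK : 0 <= K := K_ge0.
have g1 : expR (- c * t0) < 1.
  by rewrite -[ltRHS]expR0 ltr_expR mulNr oppr_lt0 mulr_gt0.
have [b [al [/andP[b0 b1] /andP[al0 al1] contr]]] :=
  harris_contraction mV V0 nu1 (expR_ge0 _) g1 K_ge0 e_gt0 Rr_gt0 Rr_large
    (fun x => lyapunov x (ltW t0_gt0)) minor.
pose l0 := (1 + K) / b.
have l00 : 0 < l0 by rewrite divr_gt0//; lra.
pose M := \int[mu]_y V y.
have M0 : 0 <= M by apply: Rintegral_ge0.
have lal : ln al < 0 by apply: ln_lt0; rewrite al0.
pose rho := expR (ln al / t0).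
exists rho, (al^-1 * (l0 * (2 + b * M + b))); split.
- by rewrite expR_gt0 -[ltRHS]expR0 ltr_expR pmulr_llt0 ?invr_gt0.
- have bM : 0 <= b * M by rewrite mulr_ge0// ltW.
  by rewrite !mulr_gt0 ?invr_gt0//; lra.
move=> t x phi t_ge0 mphi hphi.
have hphi1 z : `|phi z| <= 1 * (1 + V z) by rewrite mul1r.
pose n := Num.truncn (t / t0).
have tt0 : 0 <= t / t0 by rewrite divr_ge0// ltW.
pose r := t - n%:R * t0.
have r0 : 0 <= r.
  by rewrite subr_ge0 -ler_pdivlMr// truncn_le.
have mr k : 0 <= k%:R * t0 + r by rewrite addr_ge0// mulr_ge0// ltW.
have mU k : measurable_fun setT (U (k%:R * t0 + r) phi) by exact: measurable_U.
have gU k z : `|U (k%:R * t0 + r) phi z| <= 1 * (1 + K) * (1 + V z).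
  exact: U_growth.
have lip k z w : U (k%:R * t0 + r) phi z - U (k%:R * t0 + r) phi w <=
    al ^+ k * l0 * (2 + b * (V z + V w)).
  elim: k z w => [|k IH] z w.
    rewrite expr0 mul1r mul0r add0r.
    have h1 := U_growth z r0 ler01 mphi hphi1; have h2 := U_growth w r0 ler01 mphi hphi1.
    have h3 v : 1 * (1 + K) * (1 + V v) <= l0 * (1 + b * V v).
      rewrite mul1r /l0 -mulrA ler_pM2l; last by lra.
      rewrite ler_pdivlMl// mulrDr mulr1 lerD2r//.
    have := h3 z; have := h3 w; move: h1 h2; rewrite !ler_norml.
    have -> : l0 * (2 + b * (V z + V w)) = l0 * (1 + b * V z) + l0 * (1 + b * V w) by ring.
    by lra.
  have kE : k.+1%:R * t0 + r = t0 + (k%:R * t0 + r) by rewrite -natr1; ring.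
  have E v : U (k.+1%:R * t0 + r) phi v = U t0 (U (k%:R * t0 + r) phi) v.
    by rewrite kE; apply: (U_semigroup _ _ _ _ hphi1) => //; exact: ltW.
  have lk : 0 <= al ^+ k * l0 by rewrite mulr_ge0 ?exprn_ge0// ltW.
  have := contr _ _ _ lk (mU k) (gU k) IH z w.
  by rewrite !E exprS -!mulrA.
have tE : t = n%:R * t0 + r by rewrite /r addrC subrK.
have UE : U t phi = U (n%:R * t0 + r) phi by rewrite -tE.
rewrite -/(U t phi x) (mu_U t_ge0 mphi hphi1) UE.
have gap : forall y, `|U (n%:R * t0 + r) phi x - U (n%:R * t0 + r) phi y| <=
    al ^+ n * l0 * (2 + b * V x) + al ^+ n * l0 * b * V y.
  move=> y; have h1 := lip n x y; have h2 := lip n y x.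
  rewrite (addrC (V y)) in h2.
  have -> : al ^+ n * l0 * (2 + b * V x) + al ^+ n * l0 * b * V y =
    al ^+ n * l0 * (2 + b * (V x + V y)) by ring.
  by rewrite ler_norml h1 andbT lerNl opprB.
apply: (le_trans (average_gap (mU n) (gU n) gap)).
have aln : al ^+ n <= al^-1 * rho `^ t.
  rewrite /rho /powR gt_eqF ?expR_gt0// expRK.
  rewrite -{1 2}(lnK al0) -expRN -expRD -expRM_natl ler_expR.
  have -> : - ln al + t * (ln al / t0) = (t / t0 - 1) * ln al by field; exact: lt0r_neq0.
  rewrite ler_wnM2r ?(ltW lal)// lerBlDr natr1 ltW//.
  exact: truncnS_gt.
have -> : al ^+ n * l0 * (2 + b * V x) + al ^+ n * l0 * b * \int[mu]_y V y =
  al ^+ n * (l0 * (2 + b * V x + b * M)) by rewrite -/M; ring.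
have -> : al^-1 * (l0 * (2 + b * M + b)) * (1 + V x) * rho `^ t =
  al^-1 * rho `^ t * (l0 * ((2 + b * M + b) * (1 + V x))) by ring.
have bM : 0 <= b * M by rewrite mulr_ge0// ltW.
have bV : 0 <= b * V x by rewrite mulr_ge0// ltW.
have bMV : 0 <= b * M * V x by rewrite mulr_ge0.
apply: ler_pM => //.
- by rewrite exprn_ge0// ltW.
- by rewrite mulr_ge0//; lra.
- by rewrite ler_pM2l//; have := V0 x; lra.
Qed.

End exponential_ergodicity.

(** * Exponential ergodicity of the zig-zag process *)

Section normalization.
Local Open Scope ereal_scope.
Context d (T : measurableType d) (R : realType).
Variables (m : {measure set T -> \bar R}) (P : probability T R).
Hypotheses (m_gt0 : 0 < m setT) (m_fin : m setT < +oo).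
Let c : R := ((fine (m setT))^-1)%R.

Lemma normalization_gt0 : (0 < c)%R.
Proof. by rewrite invr_gt0 fine_gt0// m_gt0. Qed.

Lemma mnormalizeE A : mnormalize m P A = c%:E * m A.
Proof. by rewrite /mnormalize gt_eqF// lt_eqF//= muleC. Qed.

Lemma ge0_integral_mnormalize (h : T -> \bar R) : measurable_fun setT h ->
  (forall x, 0 <= h x) -> \int[mnormalize m P]_x h x = c%:E * \int[m]_x h x.
Proof.
move=> mh h0; have c0 : (0 <= c)%R := ltW normalization_gt0.
transitivity (\int[mscale (NngNum c0) m]_x h x).
  by apply: eq_measure_integral => A _ _; exact: mnormalizeE.
by rewrite ge0_integral_mscale.
Qed.

End normalization.

Section rate_bounds.
Context (R : realType).

(** Each of the two extrema bounds the other, so that both are finite. *)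
Lemma rate_gap (D : set R) (z : R) (f g : R -> R) : D z -> (forall y, 0 <= f y) ->
  (ereal_sup [set (f y)%:E | y in D] < ereal_inf [set (g y)%:E | y in D])%E ->
  exists M m : R, [/\ 0 <= M, M < m, forall y, D y -> f y <= M &
                      forall y, D y -> m <= g y].
Proof.
move=> Dz f0; set s := ereal_sup _; set i := ereal_inf _ => si.
have fs y : D y -> ((f y)%:E <= s)%E by move=> Dy; apply: ereal_sup_ubound; exists y.
have gi y : D y -> (i <= (g y)%:E)%E by move=> Dy; apply: ereal_inf_lbound; exists y.
have s0 : (0 <= s)%E by apply: le_trans (fs z Dz); rewrite lee_fin.
have ioo : (i < +oo)%E by apply: le_lt_trans (gi z Dz) (ltry _).
have i0 : (0 <= i)%E := ltW (le_lt_trans s0 si).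
have sf : s \is a fin_num by rewrite ge0_fin_numE// (lt_trans si).
have iF : i \is a fin_num by rewrite ge0_fin_numE.
exists (fine s), (fine i); split.
- exact: fine_ge0.
- by rewrite -lte_fin !fineK.
- by move=> y Dy; rewrite -lee_fin fineK// fs.
- by move=> y Dy; rewrite -lee_fin fineK// gi.
Qed.

(** With k1 and k2 at the middle of the two gaps, any th close to 1 will do. *)
Lemma tilt_exists (M1 m1 M2 m2 : R) : 0 <= M1 -> M1 < m1 -> 0 <= M2 -> M2 < m2 ->
  exists th k1 k2 : R, [/\ 1 < th, M1 < k1 /\ M2 < k2, k1 * th < m1 /\ k2 * th < m2 &
    k1 * (th - 1) < m1 - M1 /\ k2 * (th - 1) < m2 - M2].
Proof.
move=> M10 Mm1 M20 Mm2.
pose k1 := (M1 + m1) / 2; pose k2 := (M2 + m2) / 2.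
have k10 : 0 < k1 by rewrite divr_gt0//; lra.
have k20 : 0 < k2 by rewrite divr_gt0//; lra.
pose e := Num.min ((m1 - M1) / 4 / k1) ((m2 - M2) / 4 / k2).
have d1 : 0 < (m1 - M1) / 4 by lra.
have d2 : 0 < (m2 - M2) / 4 by lra.
have e0 : 0 < e by rewrite lt_min (divr_gt0 d1 k10) (divr_gt0 d2 k20).
have e1 : k1 * e <= (m1 - M1) / 4.
  by rewrite mulrC -ler_pdivlMr// ge_min lexx.
have e2 : k2 * e <= (m2 - M2) / 4.
  by rewrite mulrC -ler_pdivlMr// ge_min lexx orbT.
exists (1 + e), k1, k2; rewrite addrAC subrr add0r !mulrDr !mulr1.
by split; [lra|split; rewrite /k1 /k2; lra|split; move: e1 e2; rewrite /k1 /k2; lra|split; lra].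
Qed.

End rate_bounds.

Section unit_segment.
Context (R : realType).

Let seg (z : measurableTypeR R) : R := \1_(`[0, 1]%classic : set R) z.
Let seg0 z : 0 <= seg z. Proof. by rewrite /seg indicE. Qed.
Let mseg : measurable_fun setT seg. Proof. exact: measurable_indic. Qed.
Let mright : measurable_fun setT (fun z : measurableTypeR R => (z, true) : zzE R).
Proof. exact: measurable_fun_pair. Qed.

Definition small_measure : {measure set (zzE R) -> \bar R} :=
  weighted_image (@lebesgue_measure R) seg0 mseg mright.

Lemma integral_small_measure h : measurable_fun setT h -> (forall x, 0 <= h x)%E ->
  (\int[small_measure]_x h x = target h)%E.
Proof. by move=> mh h0; rewrite ge0_integral_weighted_image. Qed.

Lemma small_measureT : small_measure setT = 1%E.
Proof.
rewrite [LHS]weighted_imageE.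
under eq_integral do rewrite indicE in_setT mulr1.
rewrite integral_indic//= setIT lebesgue_measure_itv/= lte_fin ltr01.
by rewrite -EFinD subr0.
Qed.

End unit_segment.

Section reference_positivity.
Local Open Scope ereal_scope.
Context (R : realType).

Lemma integral_leb_pm_gt0 (w : zzE R -> R) (e : R) : measurable_fun setT w ->
  (forall x, 0 <= w x)%R -> (0 < e)%R ->
  (forall y, (0 <= y <= 1)%R -> (e <= w (y, true))%R) ->
  0 < \int[leb_pm R]_x (w x)%:E.
Proof.
move=> mw w0 e0 we.
have mwE : measurable_fun setT (fun x => (w x)%:E) by exact/measurable_EFinP.
have mwj j : measurable_fun setT (fun y : R => (w (y, j))%:E).
  exact: (measurableT_comp mwE (measurable_pair2 j)).
have mS : measurable_fun setT (fun y : R => (w (y, false))%:E + (w (y, true))%:E).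
  exact: emeasurable_funD.
rewrite integral_ref//.
apply: (@lt_le_trans _ _ (\int[@lebesgue_measure R]_(y in `[0%R, 1%R]) e%:E)).
  have E : @lebesgue_measure R `[0%R, 1%R]%classic = 1%E.
    by rewrite lebesgue_measure_itv/= lte_fin ltr01 -EFinD subr0.
  by rewrite integral_cst//; move: E => /= ->; rewrite mule1 lte_fin.
apply: (@le_trans _ _ (\int[@lebesgue_measure R]_(y in `[0%R, 1%R])
    ((w (y, false))%:E + (w (y, true))%:E))).
  apply: ge0_le_integral => //.
  - by move=> y _; rewrite lee_fin ltW.
  - exact: (measurable_funTS mS).
  - move=> y; rewrite /= in_itv/= => hy; rewrite -EFinD lee_fin.
    apply: (le_trans (we y hy)); rewrite lerDr; exact: w0.
apply: ge0_subset_integral => //.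
by move=> y _; rewrite -EFinD lee_fin addr_ge0.
Qed.

End reference_positivity.

Section zigzag_family.
Context (R : realType) (a : R) (lam : zzE R -> R).
Hypotheses (a_gt0 : 0 < a) (lam_ge0 : forall x, 0 <= lam x).
Hypothesis (lam_cont : continuous lam).
Hypothesis tail : tail_zero a lam.
Variable X : forall x, zigzag a lam x.
Local Notation semi := (semi a lam).
Local Notation weight := (weight a lam).
Local Open Scope ereal_scope.

Lemma zz_lawE t x A : (0 <= t)%R -> measurable A ->
  zz_law (X x) t A = semi (fun z => (\1_A z)%:E) (t, x).
Proof.
move=> t0 mA.
have mi : measurable_fun setT (fun z : zzE R => (\1_A z : R)%:E).
  by apply/measurable_EFinP; exact: measurable_indic.
rewrite -(integral_law a_gt0 lam_ge0 lam_cont tail (X x) t0 mi).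
  by rewrite integral_indic// setIT.
by move=> z; rewrite lee_fin indicE.
Qed.

Lemma measurable_zz_law t A : (0 <= t)%R -> measurable A ->
  measurable_fun setT (fun x => zz_law (X x) t A).
Proof.
move=> t0 mA; under eq_fun do rewrite zz_lawE//.
apply: measurable_semi1 => //.
by apply/measurable_EFinP; exact: measurable_indic.
Qed.

(** The left side is the integral against a mixture of laws, and two measures
    are compared on sets, where [semiD] applies. *)
Lemma zz_law_semigroup (s t : R) x (h : zzE R -> \bar R) :
  (0 <= s)%R -> (0 <= t)%R -> measurable_fun setT h -> (forall x, 0 <= h x) ->
  \int[zz_law (X x) (s + t)]_z h z =
  \int[zz_law (X x) s]_z \int[zz_law (X z) t]_w h w.
Proof.
move=> s0 t0 mh h0.
have mk A : measurable A -> measurable_fun setT (fun z => zz_law (X z) t A).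
  exact: measurable_zz_law.
rewrite -(ge0_integral_mixture (zz_law (X x) s)
  (k := fun z => zz_law (X z) t) mk mh h0).
apply: eq_measure_integral => A mA _; rewrite /mixture.
have mi : measurable_fun setT (fun z : zzE R => (\1_A z : R)%:E).
  by apply/measurable_EFinP; exact: measurable_indic.
have i0 (z : zzE R) : 0 <= (\1_A z : R)%:E by rewrite lee_fin indicE.
transitivity (semi (fun z => (\1_A z)%:E) (s + t, x)%R).
  by apply: zz_lawE => //; exact: addr_ge0.
rewrite semiD//; last first.
  by move=> z; rewrite i0 lee_fin indicE lern1 leq_b1.
rewrite -(integral_law a_gt0 lam_ge0 lam_cont tail (X x) s0).
- by apply: eq_integral => z _; apply/esym; exact: zz_lawE.
- exact: measurable_semi1.
- by move=> z; exact: semi_ge0.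
Qed.

Let mid : measurable_fun setT (fun x : (measurableTypeR R * bool)%type => x : zzE R).
Proof. exact: measurable_id. Qed.

Let weight_ge0 (x : (measurableTypeR R * bool)%type) : (0 <= weight x)%R.
Proof. by rewrite ltW// weight_gt0. Qed.

Let mw : measurable_fun setT (weight : (measurableTypeR R * bool)%type -> R).
Proof. exact: (measurable_weight a lam_cont). Qed.

Definition weighted_ref : {measure set (zzE R) -> \bar R} :=
  weighted_image (leb_pm R) weight_ge0 mw mid.

Lemma integral_weighted_ref h : measurable_fun setT h -> (forall x, 0 <= h x) ->
  \int[weighted_ref]_x h x = \int[leb_pm R]_x ((weight x)%:E * h x).
Proof. by move=> mh h0; rewrite ge0_integral_weighted_image. Qed.

Lemma weighted_ref_gt0 : 0 < weighted_ref setT.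
Proof.
have cw : continuous (fun y => weight (y, true)).
  exact: is_derive_continuous (is_derive_weight a lam_cont true).
have [c _ hc] := EVT_min (@ler01 R) (continuous_subspaceT cw).
pose e := weight (c, true).
have e0 : (0 < e)%R by exact: weight_gt0.
have -> : weighted_ref setT = \int[leb_pm R]_x (weight x)%:E.
  rewrite [LHS]weighted_imageE; apply: eq_integral => x _.
  by rewrite indicE in_setT mulr1.
apply: (integral_leb_pm_gt0 (measurable_weight a lam_cont) weight_ge0 e0) => y hy.
by apply: hc; rewrite in_itv.
Qed.

Lemma scaled_weighted_refE (c : R) A : (0 <= c)%R -> measurable A ->
  c%:E * weighted_ref A = \int[leb_pm R]_(x in A) (c * weight x)%:E.
Proof.
move=> c0 mA; rewrite [weighted_ref A]weighted_imageE [RHS]integral_mkcond.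
have mi : measurable_fun setT (fun x : (measurableTypeR R * bool)%type =>
    (weight x * \1_A (x : zzE R))%:E).
  apply/measurable_EFinP; apply: (measurable_funM mw).
  exact: (@measurable_indic _ (zzE R) R setT A mA).
have i0 (x : (measurableTypeR R * bool)%type) (_ : setT x) :
    0 <= (weight x * \1_A (x : zzE R))%:E.
  by rewrite lee_fin indicE mulr_ge0// weight_ge0.
have c0E : 0 <= c%:E by rewrite lee_fin.
rewrite -(ge0_integralZl (leb_pm R) measurableT mi i0 c0E).
apply: eq_integral => x _; rewrite patchE indicE.
by case: (x \in A); rewrite ?mulr1 ?mulr0 ?mule0 ?EFinM.
Qed.

Lemma invariant_weighted_ref (t : R) h : (0 <= t)%R -> measurable_fun setT h ->
  (forall x, 0 <= h x) ->
  \int[weighted_ref]_x h x = \int[weighted_ref]_x \int[zz_law (X x) t]_z h z.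
Proof.
move=> t0 mh h0.
under [RHS]eq_integral do rewrite integral_law//.
rewrite !integral_weighted_ref//; last 2 first.
- exact: measurable_semi1.
- by move=> x; exact: semi_ge0.
by rewrite semi_invariant.
Qed.

End zigzag_family.

Section assembly.
Context (R : realType) (a : R) (lam : zzE R -> R).
Hypotheses (a_gt0 : 0 < a) (lam_ge0 : forall x, 0 <= lam x).
Hypothesis (lam_cont : continuous lam).
Variables (y0 M1 m1 M2 m2 : R).
Hypotheses (y0_gt0 : 0 < y0) (M1_ge0 : 0 <= M1) (M2_ge0 : 0 <= M2).
Hypotheses (Mm1 : M1 < m1) (Mm2 : M2 < m2).
Hypotheses (lam_right_minus : forall y, y0 <= y -> lam (y, false) <= M1)
  (lam_right_plus : forall y, y0 <= y -> m1 <= lam (y, true))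
  (lam_left_plus : forall y, y <= - y0 -> lam (y, true) <= M2)
  (lam_left_minus : forall y, y <= - y0 -> m2 <= lam (y, false)).
Variable X : forall x : zzE R, zigzag a lam x.

Let tail : tail_zero a lam :=
  tail_zero_of_rates a_gt0 lam_cont M1_ge0 M2_ge0 Mm1 Mm2
    lam_right_plus lam_left_minus.

Lemma dist_fnorm_le (f : zzE R -> R) (P Q : probability (zzE R) R) (b : R) :
  (forall g : zzE R -> R, measurable_fun setT g -> (forall x, `|g x| <= f x) ->
    [/\ P.-integrable setT (EFin \o g), Q.-integrable setT (EFin \o g) &
        `|\int[P]_z g z - \int[Q]_z g z| <= b]) ->
  (dist_fnorm f P Q <= b%:E)%E.
Proof.
move=> h; apply: ge_ereal_sup => _ [g [mg hg] <-].
have [iP iQ hb] := h g mg hg.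
rewrite -(fineK (integrable_fin_num measurableT iP)).
by rewrite -(fineK (integrable_fin_num measurableT iQ)) -EFinB abse_EFin lee_fin.
Qed.

Theorem zigzag_exponentially_ergodic : exists mu : probability (zzE R) R,
    [/\ has_density_prop_to mu (fun x => expR (- zz_potential a lam x.1)),
        zz_invariant X mu &
        exists (rho kappa : R) (V : zzE R -> R),
          [/\ 0 < rho < 1, 0 < kappa, (forall x, 0 <= V x), norm_like V &
              forall (t : R) (x : zzE R), 0 <= t ->
                (dist_fnorm (fun z => 1 + V z)%R (zz_law (X x) t) mu
                 <= (kappa * (1 + V x) * rho `^ t)%:E)%E]].
Proof.
have [th [k1 [k2 [th1 [Mk1 Mk2] [km1 km2] [g1 g2]]]]] :=
  tilt_exists M1_ge0 Mm1 M2_ge0 Mm2.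
pose al1 := k1 * (th - 1) / a; pose al2 := k2 * (th - 1) / a.
have th10 : 0 < th - 1 by rewrite subr_gt0.
have al10 : 0 < al1 by rewrite divr_gt0// mulr_gt0// (le_lt_trans M1_ge0).
have al20 : 0 < al2 by rewrite divr_gt0// mulr_gt0// (le_lt_trans M2_ge0).
pose V := lyap th al1 al2; pose dV := dlyap th al1 al2.
have V0 : forall x, 0 <= V x := @lyap_ge0 _ th al1 al2 th1.
have [c [K [c0 K0 dr]]] : exists c K : R, [/\ 0 < c, 0 <= K & forall x,
    a * dir R x.2 * dV x + lam x * (V (flip x) - V x) <= - c * V x + K].
  exact: (drift a_gt0 lam_ge0 lam_cont y0_gt0 M1_ge0 M2_ge0 Mm1 Mm2
    lam_right_minus lam_right_plus lam_left_plus lam_left_minus).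
have mV : measurable_fun setT V.
  by apply: (@measurable_V _ V dV) => j y; exact: is_derive_lyap.
have mVE : measurable_fun setT (fun x => (V x)%:E) by exact/measurable_EFinP.
have VE0 x : (0 <= (V x)%:E)%E by rewrite lee_fin.
have lyapunov (t : R) x : 0 <= t ->
    (\int[zz_law (X x) t]_z (V z)%:E <= (expR (- c * t) * V x + K / c)%:E)%E.
  move=> t0; rewrite (integral_law a_gt0 lam_ge0 lam_cont tail (X x) t0 mVE VE0).
  apply: (semi_lyapunov a_gt0 lam_ge0 lam_cont V0 _ _ c0 K0 dr x t0).
    by move=> j y; exact: is_derive_lyap.
  by move=> j; exact: dlyap_cont.
pose m0 := weighted_ref a lam_cont.
have fin : (\int[m0]_x (1 + V x)%:E < +oo)%E.
  rewrite integral_weighted_ref.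
  - exact: (lyap_weight_fin a_gt0 lam_cont y0_gt0 M1_ge0 M2_ge0 Mm1 Mm2
      lam_right_minus lam_right_plus lam_left_plus lam_left_minus).
  - by apply/measurable_EFinP; exact: measurable_funD.
  - by move=> x; rewrite lee_fin addr_ge0.
have m0_gt0 : (0 < m0 setT)%E by exact: weighted_ref_gt0.
have m0_fin : (m0 setT < +oo)%E.
  apply: le_lt_trans fin.
  rewrite -[leLHS]mul1e -(integral_cst m0 measurableT 1%E).
  apply: ge0_le_integral => //.
  - by apply/measurable_EFinP; exact: measurable_funD.
  - by move=> x _; rewrite lee_fin lerDl.
have V_fin : (\int[m0]_x (V x)%:E < +oo)%E.
  apply: le_lt_trans fin; apply: ge0_le_integral => //.
  - by apply/measurable_EFinP; exact: measurable_funD.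
  - by move=> x _; rewrite lee_fin lerDr.
pose P0 : probability (zzE R) R := zz_law (X (0, true)) 0.
pose mu : probability (zzE R) R := mnormalize m0 P0.
have int_mu h := @ge0_integral_mnormalize _ _ _ m0 P0 m0_gt0 m0_fin h.
have inv (t : R) (h : zzE R -> \bar R) : 0 <= t -> measurable_fun setT h ->
    (forall x, 0 <= h x)%E ->
    (\int[mu]_z h z = \int[mu]_z \int[zz_law (X z) t]_w h w)%E.
  move=> t0 mh h0.
  have mk A : measurable A -> measurable_fun setT (fun z => zz_law (X z) t A).
    exact: measurable_zz_law.
  have mS : measurable_fun setT (fun z => \int[zz_law (X z) t]_w h w)%E.
    exact: (measurable_integral_mixand (k := fun z => zz_law (X z) t) mk mh h0).
  have S0 z : (0 <= \int[zz_law (X z) t]_w h w)%E by exact: integral_ge0.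
  rewrite (int_mu _ mh h0) (int_mu _ mS S0).
  by rewrite (invariant_weighted_ref a_gt0 lam_ge0 lam_cont tail X t0 mh h0).
have muV : (\int[mu]_z (V z)%:E < +oo)%E.
  rewrite (int_mu _ mVE VE0); apply: lte_mul_pinfty; [|by []|exact: V_fin].
  by rewrite lee_fin ltW// normalization_gt0.
exists mu; split.
- exists ((fine (m0 setT))^-1); first exact: normalization_gt0.
  move=> A mA; rewrite [LHS](mnormalizeE P0 m0_gt0 m0_fin).
  rewrite (scaled_weighted_refE a lam_cont (ltW (normalization_gt0 m0_gt0 m0_fin)) mA).
  by apply: eq_integral => x _; rewrite exp_potentialE.
- move=> t t0 A mA.
  have mi : measurable_fun setT (fun z : zzE R => (\1_A z : R)%:E).
    by apply/measurable_EFinP; exact: measurable_indic.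
  have := inv t (fun z => (\1_A z)%:E) t0 mi.
  rewrite integral_indic// setIT => -> //.
  by apply: eq_integral => x _; rewrite integral_indic// setIT.
(* the level Rr is chosen from the drift at time 1 and only then the step t0 of
   the skeleton, because t0 has to be large in terms of the sublevel set *)
pose Rr := 2 * (K / c) / (1 - expR (- c)) + 1.
have KC0 : 0 <= K / c by rewrite divr_ge0// ltW.
have ec : 0 < 1 - expR (- c) by rewrite subr_gt0 -[ltRHS]expR0 ltr_expR oppr_lt0.
have Rr0 : 0 < Rr by rewrite ltr_wpDl// divr_ge0 ?(ltW ec)// mulr_ge0.
pose L := Rr * (al1^-1 + al2^-1).
have L0 : 0 <= L by apply: mulr_ge0 (ltW Rr0) (addr_ge0 _ _); rewrite invr_ge0 ltW.
pose t0 := Num.max 1 (reach a y0 L / a).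
have t01 : 1 <= t0 by rewrite le_max lexx.
have t00 : 0 < t0 := lt_le_trans ltr01 t01.
have at0 : reach a y0 L <= a * t0.
  by rewrite mulrC -ler_pdivrMr// le_max lexx orbT.
have m10 : 0 < m1 := le_lt_trans M1_ge0 Mm1.
have m20 : 0 < m2 := le_lt_trans M2_ge0 Mm2.
have [e e0 he] := minorization a_gt0 lam_ge0 lam_cont y0_gt0 m10 m20
  lam_right_plus lam_left_minus L0 at0.
have Rr_large : 2 * (K / c) < (1 - expR (- c * t0)) * Rr.
  have h1 : expR (- c * t0) <= expR (- c).
    by rewrite ler_expR mulNr lerN2 ler_peMr// ltW.
  apply: (@lt_le_trans _ _ ((1 - expR (- c)) * Rr)); last first.
    by rewrite ler_pM2r// lerD2l lerN2.
  rewrite /Rr mulrDr mulr1 [X in X + _]mulrC divfK ?lt0r_neq0//.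
  by rewrite ltrDl.
have minor x : V x <= Rr -> forall h : zzE R -> \bar R,
    measurable_fun setT h -> (forall x, 0 <= h x)%E ->
    (e%:E * \int[small_measure R]_y h y <= \int[zz_law (X x) t0]_y h y)%E.
  move=> xR h mh h0; rewrite integral_small_measure//.
  rewrite (integral_law a_gt0 lam_ge0 lam_cont tail (X x) (ltW t00) mh h0).
  apply: he => //; apply: le_trans (lyap_proper th1 al10 al20 x) _.
  by rewrite ler_wpM2r// addr_ge0// invr_ge0 ltW.
have [rho [kappa [rho01 kappa0 hrk]]] :=
  @exponential_ergodicity _ _ R (fun t x => zz_law (X x) t) mu V mV V0
    (measurable_zz_law a_gt0 lam_ge0 lam_cont tail X)
    (zz_law_semigroup a_gt0 lam_ge0 lam_cont tail X)
    inv c (K / c) c0 KC0 lyapunov muV t0 e Rr (small_measure R)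
    (small_measureT R) t00 e0 Rr0 Rr_large minor.
exists rho, kappa, V; split => //; first exact: lyap_norm_like.
move=> t x t_ge0; apply: dist_fnorm_le => g mg hg.
have hg1 z : `|g z| <= 1 * (1 + V z) by rewrite mul1r.
split; last exact: hrk.
- exact: (integrable_growth mV V0 (le_lt_trans (lyapunov t x t_ge0) (ltry _)) mg hg1).
- exact: (integrable_growth mV V0 muV mg hg1).
Qed.

End assembly.

Theorem theorem5 (R : realType) (a : R) (a_gt0 : 0 < a)
    (lam : zzE R -> R) (lam_ge0 : forall x, 0 <= lam x)
    (lam_cont : continuous lam)
    (y0 : R) (y0_gt0 : 0 < y0)
    (lam_right :
      (ereal_sup [set (lam (y, false))%:E | y in [set y | (y0 <= y)%R]] <
       ereal_inf [set (lam (y, true))%:E | y in [set y | (y0 <= y)%R]])%E)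
    (lam_left :
      (ereal_sup [set (lam (y, true))%:E | y in [set y | (y <= - y0)%R]] <
       ereal_inf [set (lam (y, false))%:E | y in [set y | (y <= - y0)%R]])%E)
    (X : forall x : zzE R, zigzag a lam x) :
  exists mu : probability (zzE R) R,
    [/\ has_density_prop_to mu (fun x => expR (- zz_potential a lam x.1)),
        zz_invariant X mu &
        exists (rho kappa : R) (V : zzE R -> R),
          [/\ 0 < rho < 1, 0 < kappa, (forall x, 0 <= V x), norm_like V &
              forall (t : R) (x : zzE R), 0 <= t ->
                (dist_fnorm (fun z => 1 + V z)%R (zz_law (X x) t) mu
                 <= (kappa * (1 + V x) * rho `^ t)%:E)%E]].
Proof.
have [M1 [m1 [M1_ge0 Mm1 hM1 hm1]]] := rate_gap
  (f := fun y => lam (y, false)) (g := fun y => lam (y, true))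
  (lexx y0 : [set y | y0 <= y] y0) (fun y => lam_ge0 (y, false)) lam_right.
have [M2 [m2 [M2_ge0 Mm2 hM2 hm2]]] := rate_gap
  (f := fun y => lam (y, true)) (g := fun y => lam (y, false))
  (lexx (- y0) : [set y | y <= - y0] (- y0)) (fun y => lam_ge0 (y, true)) lam_left.
exact: (zigzag_exponentially_ergodic a_gt0 lam_ge0 lam_cont y0_gt0 M1_ge0 M2_ge0
  Mm1 Mm2 hM1 hm1 hM2 hm2 X).
Qed.
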